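(* Let $\Theta=(\theta_{k,\ell})$ and $\Theta'=(\theta'_{k,\ell})$ be real antisymmetric $d\times d$ matrices. Let $H\subset K$ be Hilbert spaces with $\dim H=d$, $\dim K=2d$, and let $z_1,\dots,z_d\in K$ be linearly independent vectors such that $x_k:=P_Hz_k$ ($k=1,\dots,d$) are linearly independent and such that, with $y_k:=P_{H^\perp}z_k$, for all $k,\ell$: $2\operatorname{Im}\langle z_\ell,z_k\rangle=\theta'_{k,\ell}$, $2\operatorname{Im}\langle x_\ell,x_k\rangle=\theta_{k,\ell}$, and $\|y_k\|^2=\frac12\|\Theta'-\Theta\|$ (such $H,K,z_1,\dots,z_d$ always exist). Then: (1) $A_\Theta$ has a representation by Weyl unitaries, $u_{\Theta,k}\mapsto W(x_k)$; (2) $A_{\Theta'}$ has a representation by Weyl unitaries, $u_{\Theta',k}\mapsto W(z_k)$; (3) $W(x_1),\dots,W(x_d)$ (acting on $\Gamma(H)$) is a compression of $cW(z_1),\dots,cW(z_d)$ (acting on $\Gamma(K)\supset\Gamma(H)$) with $c=e^{\frac14\|\Theta-\Theta'\|}$, i.e. $W(x_k)=P_{\Gamma(H)}\,cW(z_k)|_{\Gamma(H)}$ for all $k$. Consequently, for all real antisymmetric $d\times d$ matrices $\Theta,\Theta'$, $$c_{\Theta,\Theta'}\leq e^{\frac14\|\Theta-\Theta'\|}.$$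
   Context: Inner products are linear in the first argument; $P_H$, $P_{H^\perp}$, $P_{\Gamma(H)}$ are orthogonal projections; $\|\Theta-\Theta'\|$ is the operator norm. For a Hilbert space $H$, $\Gamma(H)=\bigoplus_{k\ge0}H^{\otimes_s k}$ is the symmetric Fock space, with exponential vectors $e(x)=\sum_{k\ge0}\frac1{\sqrt{k!}}x^{\otimes k}$, $x\in H$, which are total. For $z\in H$ the Weyl unitary $W(z)\in B(\Gamma(H))$ is determined by $W(z)e(x)=e(z+x)\exp\left(-\frac{\|z\|^2}{2}-\langle x,z\rangle\right)$ for all $x\in H$. For a real antisymmetric $d\times d$ matrix $\Theta=(\theta_{k,\ell})$, $A_\Theta$ is the universal C*-algebra generated by unitaries $u_{\Theta,1},\dots,u_{\Theta,d}$ satisfying $u_{\Theta,\ell}u_{\Theta,k}=e^{i\theta_{k,\ell}}u_{\Theta,k}u_{\Theta,\ell}$ for all $k,\ell$, and $u_\Theta=(u_{\Theta,1},\dots,u_{\Theta,d})$. For $d$-tuples of unitaries write $u\sim v$ if there is a $*$-isomorphism $C^*(u)\to C^*(v)$ mapping $u_i\mapsto v_i$ for all $i$. For $c>0$ write $u\prec cv$ if there exist Hilbert spaces $H\subseteq K$ and tuples $U\in B(H)^d$, $V\in B(K)^d$ with $U\sim u$, $V\sim v$ and $U_i=P_H\,cV_i|_H$ for all $i$. Put $c(u,v)=\inf\{c: u\prec cv\}$ and $c_{\Theta,\Theta'}:=c(u_\Theta,u_{\Theta'})$. *)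

(* Defs.v *)
From HB Require Import structures.
From mathcomp Require Import all_boot all_order all_algebra perm.
From mathcomp Require Import mathcomp_extra boolp classical_sets functions reals ereal.
From mathcomp Require Import topology normedtype sequences exp trigo.
From mathcomp Require Import complex ring lra.

Set Implicit Arguments.
Unset Strict Implicit.
Unset Printing Implicit Defensive.

Import Order.TTheory GRing.Theory Num.Theory.
Import numFieldNormedType.Exports.

Local Open Scope classical_set_scope.
Local Open Scope ring_scope.
Local Open Scope complex_scope.

HB.mixin Record isHilbert (R : realType) V
    of CompleteNormedModule R[i] V := {
  dot : V -> V -> R[i];
  dotDl : forall x y z, dot (x + y) z = dot x z + dot y z;
  dotZl : forall a x y, dot (a *: x) y = a * dot x y;
  dotC : forall x y, dot y x = Num.conj (dot x y);
  dot_norm : forall x, dot x x = `|x| ^+ 2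
}.

#[short(type="hilbertType")]
HB.structure Definition Hilbert (R : realType) :=
  {V of isHilbert R V & CompleteNormedModule R[i] V}.

(* Unital C*-algebras; the zero algebra is allowed.  The product is a field of
   the mixin because a join of the ring and normed-module hierarchies below
   numDomainType cannot be declared after the fact. *)
HB.mixin Record isCStarAlgebra (R : realType) A
    of CompleteNormedModule R[i] A := {
  cmul : A -> A -> A;
  cone : A;
  star : A -> A;
  cmulA : associative cmul;
  cmul1l : left_id cone cmul;
  cmul1r : right_id cone cmul;
  cmulDl : left_distributive cmul +%R;
  cmulDr : right_distributive cmul +%R;
  cmulZl : forall (a : R[i]) x y, cmul (a *: x) y = a *: cmul x y;
  cmulZr : forall (a : R[i]) x y, cmul x (a *: y) = a *: cmul x y;
  starD : {morph star : x y / x + y};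
  starZ : forall (a : R[i]) x, star (a *: x) = Num.conj a *: star x;
  starM : forall x y, star (cmul x y) = cmul (star y) (star x);
  starK : involutive star;
  cmul_norm : forall x y, `|cmul x y| <= `|x| * `|y|;
  cstar_norm : forall x, `|cmul (star x) x| = `|x| ^+ 2
}.

#[short(type="cstarAlgType")]
HB.structure Definition CStarAlgebra (R : realType) :=
  {A of isCStarAlgebra R A & CompleteNormedModule R[i] A}.


(* Real-valued norm and real part of the inner product. *)
Section HilbertTheory.
Context {R : realType}.
Implicit Type V : completeNormedModType R[i].

Definition rnorm V (x : V) : R := complex.Re `|x|.

Lemma rnormE V (x : V) : (rnorm x)%:C = `|x|.
Proof. by rewrite RRe_real// normr_real. Qed.

Lemma rnorm_ge0 V (x : V) : 0 <= rnorm x.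
Proof. by rewrite -ler0c rnormE. Qed.

Lemma rnormD V (x y : V) : rnorm (x + y) <= rnorm x + rnorm y.
Proof. by rewrite -lecR rmorphD/= !rnormE ler_normD. Qed.

Lemma rnormN V (x : V) : rnorm (- x) = rnorm x.
Proof. by rewrite /rnorm normrN. Qed.

Lemma rnorm0 V : rnorm (0 : V) = 0.
Proof. by rewrite /rnorm normr0. Qed.

Lemma rnorm0_eq0 V (x : V) : rnorm x = 0 -> x = 0.
Proof. by move=> x0; apply/normr0_eq0; rewrite -rnormE x0. Qed.

Lemma rnormZ V (a : R[i]) (x : V) : rnorm (a *: x) = complex.Re `|a| * rnorm x.
Proof.
by apply: complexI; rewrite rmorphM/= !rnormE normrZ.
Qed.

Lemma rnorm_small V (x : V) (M : R) : 0 <= M ->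
  (forall e : R, 0 < e -> rnorm x <= e * M) -> x = 0.
Proof.
move=> M0 xM; apply: rnorm0_eq0; apply/eqP; rewrite eq_le rnorm_ge0 andbT.
apply/ler_addgt0Pr => e e0; rewrite add0r.
have M1 : 0 < M + 1 by rewrite ltr_wpDl.
have e1 : 0 < e / (M + 1) by exact: divr_gt0.
apply: (le_trans (xM _ e1)).
rewrite -mulrA; apply: ler_piMr; first exact: ltW.
by rewrite mulrC ler_pdivrMr ?mul1r ?lerDl ?ler01.
Qed.

(* Convergence of a Cauchy filter, with real radii. *)
Lemma cauchy_filter_lim V (F : set_system V) : ProperFilter F -> cauchy F ->
  exists l : V, forall (x : V) (e : R),
    F [set y | rnorm (x - y) <= e] -> rnorm (x - l) <= e.
Proof.
move=> FF /cauchy_cvgP/cvg_ex[l Fl]; exists l => x e Fxe.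
apply/ler_addgt0Pr => d d0.
have d0C : 0 < d%:C by rewrite ltcR.
have /= Fd := (@fcvgrPdist_lt _ _ _ FF l).1 Fl _ d0C.
have [y [/= xy ly]] := filter_ex (filterI Fxe Fd).
have -> : x - l = (x - y) - (l - y) by rewrite opprB addrA subrK.
apply: le_trans (rnormD _ _) _; apply: lerD => //.
by rewrite rnormN -lecR rnormE ltW.
Qed.

Lemma cauchy_real V (F : set_system V) : ProperFilter F ->
  (forall e : R, 0 < e -> exists x, F [set y | rnorm (x - y) < e]) -> cauchy F.
Proof.
move=> FF Fe; apply: cauchy_exP => e e0.
have eE : (complex.Re e)%:C = e by rewrite RRe_real// gtr0_real.
have [|x Fx] := Fe (complex.Re e); first by rewrite -ltcR eE.
exists x; apply: filterS Fx => y /= xy.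
by rewrite -ball_normE /= -rnormE -eE ltcR.
Qed.

Section Riesz.
Variable H : hilbertType R.
Implicit Types x y z : H.

Definition rdot x y : R := complex.Re (dot x y).

Lemma dotDr x y z : dot x (y + z) = dot x y + dot x z.
Proof. by rewrite dotC dotDl rmorphD/= -!dotC. Qed.

Lemma dotZr a x y : dot x (a *: y) = Num.conj a * dot x y.
Proof. by rewrite dotC dotZl rmorphM/= -dotC. Qed.

Lemma dot0l y : dot 0 y = 0.
Proof. by have := dotZl 0 (0 : H) y; rewrite scale0r mul0r. Qed.

Lemma dot0r x : dot x 0 = 0.
Proof. by rewrite dotC dot0l rmorph0. Qed.

Lemma dotNl x y : dot (- x) y = - dot x y.
Proof. by rewrite -scaleN1r dotZl mulN1r. Qed.

Lemma dotNr x y : dot x (- y) = - dot x y.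
Proof. by rewrite dotC dotNl rmorphN/= -dotC. Qed.

Lemma rdotDl x y z : rdot (x + y) z = rdot x z + rdot y z.
Proof. by rewrite /rdot dotDl raddfD. Qed.

Lemma rdotC x y : rdot x y = rdot y x.
Proof. by rewrite /rdot dotC; case: (dot y x). Qed.

Lemma rdotDr x y z : rdot x (y + z) = rdot x y + rdot x z.
Proof. by rewrite rdotC rdotDl !(rdotC x). Qed.

Lemma rdotNl x y : rdot (- x) y = - rdot x y.
Proof. by rewrite /rdot dotNl raddfN. Qed.

Lemma rdotNr x y : rdot x (- y) = - rdot x y.
Proof. by rewrite rdotC rdotNl rdotC. Qed.

Lemma rdotZl (a : R) x y : rdot (a%:C *: x) y = a * rdot x y.
Proof. by rewrite /rdot dotZl; case: (dot x y) => b c /=; rewrite mul0r subr0. Qed.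

Lemma rdotZr (a : R) x y : rdot x (a%:C *: y) = a * rdot x y.
Proof. by rewrite rdotC rdotZl rdotC. Qed.

Lemma rdotxx x : rdot x x = rnorm x ^+ 2.
Proof. by rewrite /rdot dot_norm -rnormE -rmorphXn. Qed.

Lemma dotE x y : dot x y = rdot x y +i* - rdot ('i *: x) y.
Proof.
by rewrite /rdot dotZl; case: (dot x y) => a b /=; rewrite mul0r mul1r sub0r opprK.
Qed.

End Riesz.
End HilbertTheory.

Section RieszRepresentation.
Context {R : realType}.
Variable H : hilbertType R.
Implicit Types x y z : H.

Lemma rdot_cauchy x y : rdot x y <= rnorm x * rnorm y.
Proof.
have [x0|x0] := eqVneq (rnorm x) 0.
  by rewrite (rnorm0_eq0 x0) /rdot dot0l rnorm0 mul0r.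
have [y0|y0] := eqVneq (rnorm y) 0.
  by rewrite (rnorm0_eq0 y0) /rdot dot0r rnorm0 mulr0.
have px : 0 < rnorm x by rewrite lt_def x0 rnorm_ge0.
have py : 0 < rnorm y by rewrite lt_def y0 rnorm_ge0.
set a := rnorm x in px *; set b := rnorm y in py *.
have := sqr_ge0 (rnorm (b%:C *: x + - (a%:C *: y))).
rewrite -rdotxx !rdotDl !rdotDr !rdotNl !rdotNr !rdotZl !rdotZr !rdotxx.
rewrite (rdotC y x) -/a -/b => h.
have ab : 0 < a * b by rewrite mulr_gt0.
rewrite -(ler_pM2l ab); nra.
Qed.

Lemma real_riesz (f : H -> R) (M : R) :
  (forall x y, f (x + y) = f x + f y) ->
  (forall (a : R) x, f (a%:C *: x) = a * f x) ->
  (forall x, f x <= M * rnorm x) ->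
  exists y, forall x, f x = rdot x y.
Proof.
move=> fD fZ fM.
pose J x := 2 * f x - rdot x x.
have JM x : J x <= M ^+ 2.
  rewrite /J rdotxx; have := fM x; have := sqr_ge0 (M - rnorm x); nra.
have Jsup : has_sup (range J).
  by split; [exists (J 0), 0|exists (M ^+ 2) => _ [x _ <-]].
set S := sup (range J).
have JS x : J x <= S by apply: (sup_upper_bound Jsup); exists x.
pose D (e : R) := [set x | S - e < J x].
pose F := filter_from [set e : R | 0 < e] D.
have D0 e : 0 < e -> D e !=set0.
  by move=> /(sup_adherent)/(_ Jsup)[_ [x _ <-]] xS; exists x.
have FF : ProperFilter F.
  apply: filter_from_proper; last by move=> e; exact: D0.
  apply: filter_from_filter; first by exists 1; exact: ltr01.
  move=> i j /= i0 j0; exists (Num.min i j); first by rewrite lt_min i0.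
  move=> x; rewrite /D/= => h.
  by split; apply: le_lt_trans h; rewrite lerB// ge_min lexx ?orbT.
have close (t : R) x y : 0 < t -> D (t ^+ 2) x -> D (t ^+ 2) y ->
    rnorm (x - y) <= 2 * t.
  move=> t0 Dx Dy.
  have := JS ((2^-1)%:C *: (x + y)); move: Dx Dy; rewrite /D/= /J.
  rewrite fZ fD rdotZl rdotZr !rdotDl !rdotDr (rdotC y x) => Dx Dy h.
  rewrite -(@ler_pXn2r _ 2)// ?nnegrE ?rnorm_ge0 ?mulr_ge0 ?(ltW t0)//.
  rewrite -rdotxx rdotDl !rdotDr !rdotNl !rdotNr (rdotC y x); nra.
have FD (t : R) : 0 < t -> F (D t) by move=> t0; exists t.
have cF : cauchy F.
  apply: cauchy_real => e e0.
  have t0 : 0 < e / 4 by rewrite divr_gt0.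
  have t2 : 0 < (e / 4) ^+ 2 by rewrite exprn_gt0.
  have [x Dx] := D0 _ t2; exists x.
  apply: filterS (FD _ t2) => y Dy /=.
  by apply: le_lt_trans (close _ _ _ t0 Dx Dy) _; lra.
have [l Fl] := cauchy_filter_lim FF cF.
have main h : f h <= rdot h l.
  apply/ler_addgt0Pr => e e0.
  pose C := 1 + rnorm h ^+ 2 + 2 * rnorm h.
  have C0 : 0 < C.
    by rewrite /C -addrA ltr_pwDl// addr_ge0 ?sqr_ge0 ?mulr_ge0 ?rnorm_ge0.
  pose t := e / C.
  have t0 : 0 < t by rewrite divr_gt0.
  have t2 : 0 < t ^+ 2 by rewrite exprn_gt0.
  have [x Dx] := D0 _ t2.
  have xl : rnorm (x - l) <= 2 * t.
    by apply: Fl; apply: filterS (FD _ t2) => y; exact: close.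
  have tC : t * C = e by rewrite /t divfK// gt_eqF.
  have h1 := rdot_cauchy (x - l) h.
  rewrite rdotDl rdotNl in h1.
  have h2 : rnorm (x - l) * rnorm h <= 2 * t * rnorm h.
    by rewrite ler_wpM2r ?rnorm_ge0.
  have := JS (x + t%:C *: h); move: Dx; rewrite /D/= /J.
  rewrite fD fZ !rdotDl !rdotDr !rdotZl !rdotZr (rdotC h x) (rdotC h l).
  move=> h3 h4.
  have h5 : t * (2 * (f h - rdot x h)) <= t * (t * (1 + rdot h h)) by nra.
  rewrite ler_pM2l// in h5.
  rewrite rdotxx in h5.
  rewrite -tC /C; nra.
exists l => x; apply/eqP; rewrite eq_le main/=.
have := main (- x); rewrite rdotNl.
have -> : f (- x) = - f x.
  by have := fZ (-1) x; rewrite rmorphN1 scaleN1r mulN1r.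
by rewrite lerN2.
Qed.

Lemma riesz (f : H -> R[i]) (M : R) :
  (forall (a : R[i]) x y, f (a *: x + y) = a * f x + f y) ->
  (forall x, `|f x| <= M%:C * `|x|) ->
  exists y, forall x, f x = dot x y.
Proof.
move=> fL fM.
have fD x y : f (x + y) = f x + f y by have := fL 1 x y; rewrite scale1r mul1r.
have f0 : f 0 = 0 by apply: (addrI (f 0)); rewrite -fD !addr0.
have fZ a x : f (a *: x) = a * f x by have := fL a x 0; rewrite !addr0 f0 addr0.
have [||x|y fy] := @real_riesz (fun x => complex.Re (f x)) M.
- by move=> x y; rewrite fD raddfD.
- by move=> a x; rewrite fZ; case: (f x) => b c /=; rewrite mul0r subr0.
- have := fM x; rewrite -rnormE -rmorphM/= => h; rewrite -lecR.
  apply: le_trans h; apply: le_trans (normc_ge_Re _).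
  by rewrite lecR ler_norm.
exists y => x; rewrite dotE -!fy fZ.
by case: (f x) => a b /=; rewrite mul0r mul1r sub0r opprK.
Qed.

End RieszRepresentation.

(* The C*-algebra B(H) of bounded operators on H is [bop H]. *)
Section BoundedOperators.
Context {R : realType}.

Definition bounded_op (H : hilbertType R) (f : H -> H) : Prop :=
  linear f /\ exists M : R, forall x, `|f x| <= M%:C * `|x|.

Definition bop_pred (H : hilbertType R) : {pred H -> H} :=
  [pred f | `[< bounded_op f >]].

Record bop (H : hilbertType R) : Type := Bop {
  bop_fun :> H -> H;
  _ : bop_fun \in @bop_pred H
}.

HB.instance Definition _ H := [isSub for @bop_fun H].
HB.instance Definition _ H := [Choice of bop H by <:].

Section BoundedOperatorsLmodule.
Variable H : hilbertType R.
Implicit Types (S T : bop H) (x y : H).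

Lemma bopP S T : S =1 T -> S = T.
Proof. by move=> ST; apply: val_inj; apply: funext. Qed.

Lemma bop_linear T : linear T.
Proof. by case: T => f /= fP; have /asboolP[] := fP. Qed.

HB.instance Definition _ T :=
  GRing.isLinear.Build R[i] H H *:%R (bop_fun T) (bop_linear T).

Lemma bounded_opP (f : H -> H) : linear f ->
  (exists M : R, forall x, rnorm (f x) <= M * rnorm x) -> bounded_op f.
Proof.
move=> fl [M fM]; split=> //; exists M => x.
by rewrite -!rnormE -rmorphM/= lecR.
Qed.

Lemma bop_bounded T : exists2 M : R, 0 <= M & forall x, rnorm (T x) <= M * rnorm x.
Proof.
case: T => f /= fP; have /asboolP[_ [M fM]] := fP; exists `|M| => // x.
apply: (@le_trans _ _ (M * rnorm x)).
  by rewrite -lecR rmorphM/= !rnormE.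
by rewrite ler_wpM2r ?rnorm_ge0 ?ler_norm.
Qed.

Lemma bop_submod : submod_closed (@bop_pred H).
Proof.
split; rewrite ?inE.
  apply: bounded_opP; first by move=> a x y; rewrite scaler0 addr0.
  by exists 0 => x; rewrite /= rnorm0 mul0r.
move=> a f g; rewrite !inE => fB gB.
have [M M0 fM] := bop_bounded (Bop (asboolT fB)).
have [N N0 gN] := bop_bounded (Bop (asboolT gB)).
apply: bounded_opP.
  move=> b x y /=.
  rewrite !fctE fB.1 gB.1 !scalerDr !scalerA (mulrC a b).
  by rewrite -!addrA; congr (_ + _); rewrite addrCA.
exists (complex.Re `|a| * M + N) => x; apply: le_trans (rnormD _ _) _.
rewrite rnormZ mulrDl lerD ?gN// -mulrA ler_wpM2l ?fM//.
by rewrite -ler0c RRe_real// normr_real.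
Qed.

HB.instance Definition _ := GRing.isSubmodClosed.Build _ _ (@bop_pred H) bop_submod.
HB.instance Definition _ := [SubChoice_isSubLmodule of bop H by <:].

Lemma bopDE S T x : (S + T) x = S x + T x. Proof. by []. Qed.
Lemma bopZE (a : R[i]) T x : (a *: T) x = a *: T x. Proof. by []. Qed.
Lemma bopNE T x : (- T) x = - T x. Proof. by []. Qed.
Lemma bop0E x : (0 : bop H) x = 0. Proof. by []. Qed.

End BoundedOperatorsLmodule.
End BoundedOperators.

Section OperatorNorm.
Context {R : realType}.
Variable H : hilbertType R.
Implicit Types (S T : bop H) (x y : H).

Definition opnorm T : R := sup [set rnorm (T x) | x in [set x | rnorm x <= 1]].

Lemma opnorm_has_sup T :
  has_sup [set rnorm (T x) | x in [set x | rnorm x <= 1]].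
Proof.
have [M M0 TM] := bop_bounded T.
split; first by exists (rnorm (T 0)), 0 => //=; rewrite rnorm0.
by exists M => _ [x /= x1 <-]; apply: le_trans (TM x) _; rewrite ler_piMr.
Qed.

Lemma le_opnorm T x : rnorm (T x) <= opnorm T * rnorm x.
Proof.
have [x0|x0] := eqVneq (rnorm x) 0.
  by rewrite (rnorm0_eq0 x0) linear0 !rnorm0 mulr0.
have px : 0 < rnorm x by rewrite lt_def x0 rnorm_ge0.
rewrite -ler_pdivrMr//.
apply: (sup_upper_bound (opnorm_has_sup T)).
have nE : complex.Re `|(rnorm x)^-1%:C| = (rnorm x)^-1 :> R.
  by rewrite ger0_norm// ler0c invr_ge0 ltW.
exists ((rnorm x)^-1%:C *: x); first by rewrite /= rnormZ nE mulVf.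
by rewrite linearZ/= rnormZ nE mulrC.
Qed.

Lemma opnorm_le T (M : R) : (forall x, rnorm x <= 1 -> rnorm (T x) <= M) ->
  opnorm T <= M.
Proof.
move=> TM; apply: ge_sup; first by case: (opnorm_has_sup T).
by move=> _ [x /= x1 <-]; exact: TM.
Qed.

Lemma opnorm_ge0 T : 0 <= opnorm T.
Proof.
apply: (sup_upper_bound (opnorm_has_sup T)).
by exists 0; rewrite /= ?linear0 rnorm0.
Qed.

Lemma opnorm_leM T (M : R) : 0 <= M -> (forall x, rnorm (T x) <= M * rnorm x) ->
  opnorm T <= M.
Proof.
by move=> M0 TM; apply: opnorm_le => x x1; apply: le_trans (TM x) _; rewrite ler_piMr.
Qed.

Definition bopnorm T : R[i] := (opnorm T)%:C.

Lemma bopnormD S T : bopnorm (S + T) <= bopnorm S + bopnorm T.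
Proof.
rewrite /bopnorm -rmorphD/= lecR; apply: opnorm_leM.
  by rewrite addr_ge0 ?opnorm_ge0.
move=> x; rewrite bopDE mulrDl; apply: le_trans (rnormD _ _) _.
by rewrite lerD ?le_opnorm.
Qed.

Lemma opnormZ_le (a : R[i]) T : opnorm (a *: T) <= complex.Re `|a| * opnorm T.
Proof.
have a0 : 0 <= complex.Re `|a| by rewrite -ler0c RRe_real// normr_real.
apply: opnorm_leM; first by rewrite mulr_ge0 ?opnorm_ge0.
by move=> x; rewrite bopZE rnormZ -mulrA ler_wpM2l ?le_opnorm.
Qed.

Lemma bopnormZ (a : R[i]) T : bopnorm (a *: T) = `|a| * bopnorm T.
Proof.
have aE : (complex.Re `|a|)%:C = `|a| by rewrite RRe_real// normr_real.
rewrite /bopnorm -[X in _ = X * _]aE -rmorphM; congr (_%:C).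
apply/eqP; rewrite eq_le opnormZ_le andTb.
have [->|a0] := eqVneq a 0; first by rewrite normr0 mul0r opnorm_ge0.
have a1 : 0 < complex.Re `|a| by rewrite -ltcR aE normr_gt0.
rewrite mulrC -ler_pdivlMr// mulrC.
have {1}-> : T = a^-1 *: (a *: T) by rewrite scalerA mulVf// scale1r.
apply: le_trans (opnormZ_le _ _) _; rewrite ler_wpM2r ?opnorm_ge0//.
have -> : complex.Re `|a^-1| = (complex.Re `|a|)^-1 => //.
by apply: complexI; rewrite RRe_real ?normr_real// normfV -[in LHS]aE -fmorphV.
Qed.

Lemma bopnorm0_eq0 T : bopnorm T = 0 -> T = 0.
Proof.
move=> /complexI T0; apply: bopP => x; apply: rnorm0_eq0.
apply/eqP; rewrite eq_le rnorm_ge0 andbT.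
by apply: le_trans (le_opnorm _ _) _; rewrite T0 mul0r.
Qed.

HB.instance Definition _ :=
  Lmodule_isNormed.Build R[i] (bop H) bopnormD bopnormZ bopnorm0_eq0.

Lemma bop_normE T : `|T| = (opnorm T)%:C. Proof. by []. Qed.

Lemma bop_ballE T (e : R) S : ball T e%:C S = (opnorm (T - S) < e).
Proof. by rewrite -ball_normE /ball_ /= ltcR. Qed.

Lemma bop_complete (F : set_system (bop H)) :
  ProperFilter F -> cauchy F -> cvg F.
Proof.
move=> FF cF.
have FB (e : R) : 0 < e -> exists T, F [set S | opnorm (T - S) < e].
  move=> e0.
  have e0C : 0 < e%:C by rewrite ltcR.
  move: cF => /cauchyP/(_ _ e0C)[T FT]; exists T.
  by apply: filterS FT => S; rewrite bop_ballE.
pose Fx x := (fun T : bop H => T x) @ F.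
have cFx x : cauchy (Fx x).
  apply: cauchy_real => e e0.
  have x1 : 0 < 1 + rnorm x by rewrite ltr_pwDl// rnorm_ge0.
  have [T FT] := FB (e / (1 + rnorm x)) (divr_gt0 e0 x1).
  exists (T x); rewrite /Fx/=; apply: filterS FT => S /= TS.
  apply: (@le_lt_trans _ _ (opnorm (T - S) * (rnorm x))).
    by rewrite -bopNE -bopDE le_opnorm.
  apply: (@le_lt_trans _ _ (e / (1 + rnorm x) * rnorm x)).
    by rewrite ler_wpM2r ?rnorm_ge0// ltW.
  rewrite mulrAC ltr_pdivrMr// ltr_pM2l// ltrDr ltr01 //.
have [g gP] := choice (fun x => cauchy_filter_lim _ (cFx x)).
have gT (e : R) T x : F [set S | opnorm (T - S) < e] ->
    rnorm (T x - g x) <= e * rnorm x.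
  move=> FT; apply: gP; rewrite /Fx/=; apply: filterS FT => S /= TS.
  by rewrite -bopNE -bopDE (le_trans (le_opnorm _ _))// ler_wpM2r ?rnorm_ge0// ltW.
have glin : linear g.
  move=> a x y; apply/eqP; rewrite -subr_eq0; apply/eqP.
  pose M := rnorm (a *: x + y) + (complex.Re `|a| * rnorm x + rnorm y).
  have M0 : 0 <= M.
    rewrite /M !addr_ge0 ?mulr_ge0 ?rnorm_ge0//.
    by rewrite -ler0c RRe_real// normr_real.
  apply: (rnorm_small M0) => e e0.
  have [T FT] := FB _ e0.
  have -> : g (a *: x + y) - (a *: g x + g y) =
     - (T (a *: x + y) - g (a *: x + y)) + (a *: (T x - g x) + (T y - g y)).
    have -> : a *: (T x - g x) + (T y - g y) = T (a *: x + y) - (a *: g x + g y).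
      by rewrite linearP scalerBr addrACA -opprD.
    by rewrite opprB addrA subrK.
  rewrite /M !mulrDr; apply: le_trans (rnormD _ _) _; rewrite rnormN lerD ?gT//.
  apply: le_trans (rnormD _ _) _; rewrite lerD ?gT// rnormZ mulrCA.
  by rewrite ler_wpM2l ?gT// -ler0c RRe_real// normr_real.
have gbd : bounded_op g.
  apply: bounded_opP => //; have [T FT] := FB 1 ltr01.
  exists (opnorm T + 1) => x.
  have -> : g x = T x - (T x - g x) by rewrite opprB addrC subrK.
  apply: le_trans (rnormD _ _) _; rewrite mulrDl lerD ?le_opnorm//.
  by rewrite rnormN; exact: gT.
pose G := Bop (asboolT gbd : g \in @bop_pred _ H).
apply/cvg_ex; exists G; apply/cvgrPdist_lt => e e0.
have eE : (complex.Re e)%:C = e by rewrite RRe_real// gtr0_real.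
rewrite -eE; set d := complex.Re e.
have d0 : 0 < d by rewrite -ltcR eE.
have d2 : 0 < d / 2 by rewrite divr_gt0.
have [T FT] := FB _ d2.
apply: (filterS _ FT) => S /= TS; rewrite bop_normE ltcR.
have GT : opnorm (G - T) <= d / 2.
  apply: opnorm_leM; first exact: ltW.
  by move=> x; rewrite bopDE bopNE -rnormN opprB; exact: gT.
have -> : G - S = (G - T) + (T - S) by rewrite addrA subrK.
have := bopnormD (G - T) (T - S); rewrite /bopnorm -rmorphD lecR => h.
by apply: le_lt_trans h _; rewrite [ltRHS](splitr d); exact: ler_ltD GT TS.
Qed.

HB.instance Definition _ := Uniform_isComplete.Build (bop H) bop_complete.

End OperatorNorm.

Section OperatorAlgebra.
Context {R : realType}.
Variable H : hilbertType R.
Implicit Types (S T : bop H) (x y : H).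

Lemma dot_ext y z : (forall x, dot x y = dot x z) -> y = z.
Proof.
move=> yz; apply/eqP; rewrite -subr_eq0; apply/eqP/rnorm0_eq0.
have : rdot (y - z) (y - z) = 0.
  by rewrite /rdot dotDr dotNr yz subrr.
by rewrite rdotxx => /eqP; rewrite sqrf_eq0 => /eqP.
Qed.

Lemma bop_mul_subproof S T : bounded_op (S \o T).
Proof.
apply: bounded_opP; first by move=> a x y /=; rewrite !linearP.
exists (opnorm S * opnorm T) => x /=; apply: le_trans (le_opnorm _ _) _.
by rewrite -mulrA ler_wpM2l ?opnorm_ge0 ?le_opnorm.
Qed.

Definition bop_mul S T : bop H :=
  Bop (asboolT (bop_mul_subproof S T) : S \o T \in @bop_pred _ H).

Lemma bop_one_subproof : bounded_op (id : H -> H).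
Proof. by apply: bounded_opP => //; exists 1 => x; rewrite mul1r. Qed.

Definition bop_one : bop H :=
  Bop (asboolT bop_one_subproof : id \in @bop_pred _ H).

Lemma bop_adj_ex T : exists S : bop H, forall x y, dot (T x) y = dot x (S y).
Proof.
have fT y : exists z, forall x, dot (T x) y = dot x z.
  apply: (@riesz _ _ (fun x => dot (T x) y) (opnorm T * rnorm y)).
    by move=> a x z; rewrite linearP dotDl dotZl.
  move=> x; have [c c1 cE] : exists2 c : R[i], `|c| = 1 &
      `|dot (T x) y| = c * dot (T x) y.
    have [->|d0] := eqVneq (dot (T x) y) 0.
      by exists 1; rewrite ?normr1// normr0 mulr0.
    exists (`|dot (T x) y| / dot (T x) y); last by rewrite divfK.
    by rewrite normrM normrV ?unitfE// normr_id mulfV// normr_eq0.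
  have -> : `|dot (T x) y| = (rdot (c *: T x) y)%:C.
    rewrite /rdot dotZl -cE RRe_real//; exact: normr_real.
  rewrite -rnormE -rmorphM lecR; apply: le_trans (rdot_cauchy _ _) _.
  rewrite rnormZ c1 mul1r mulrAC.
  by rewrite ler_wpM2r ?rnorm_ge0// le_opnorm.
have [f fP] := choice fT.
have fl : linear f.
  move=> a x y; apply: dot_ext => z.
  by rewrite -fP !dotDr !dotZr -!fP.
have fb : bounded_op f.
  apply: bounded_opP => //; exists (opnorm T) => y.
  have [->|y0] := eqVneq (rnorm (f y)) 0.
    by rewrite mulr_ge0 ?opnorm_ge0 ?rnorm_ge0.
  have py : 0 < rnorm (f y) by rewrite lt_def y0 rnorm_ge0.
  rewrite -(ler_pM2l py) -expr2 -rdotxx /rdot -fP -/(rdot _ _).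
  apply: le_trans (rdot_cauchy _ _) _; rewrite mulrA [rnorm (f y) * _]mulrC.
  by rewrite ler_wpM2r ?rnorm_ge0// le_opnorm.
by exists (Bop (asboolT fb : f \in @bop_pred _ H)).
Qed.

Definition bop_adj T : bop H := projT1 (cid (bop_adj_ex T)).

Lemma bop_adjP T x y : dot (T x) y = dot x (bop_adj T y).
Proof. by rewrite /bop_adj; case: cid. Qed.

Lemma bop_adjP' T x y : dot (bop_adj T x) y = dot x (T y).
Proof. by rewrite dotC -bop_adjP -dotC. Qed.

Lemma bop_adj_uniq S T : (forall x y, dot (T x) y = dot x (S y)) -> bop_adj T = S.
Proof. by move=> TS; apply: bopP => y; apply: dot_ext => x; rewrite -bop_adjP. Qed.

Lemma bop_mulA : associative bop_mul.
Proof. by move=> S T U; apply: bopP. Qed.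

Lemma bop_mul1l : left_id bop_one bop_mul.
Proof. by move=> S; apply: bopP. Qed.

Lemma bop_mul1r : right_id bop_one bop_mul.
Proof. by move=> S; apply: bopP. Qed.

Lemma bop_mulDl : left_distributive bop_mul +%R.
Proof. by move=> S T U; apply: bopP. Qed.

Lemma bop_mulDr : right_distributive bop_mul +%R.
Proof. by move=> S T U; apply: bopP => x; exact: (linearD S (T x) (U x)). Qed.

Lemma bop_mulZl (a : R[i]) S T : bop_mul (a *: S) T = a *: bop_mul S T.
Proof. by apply: bopP. Qed.

Lemma bop_mulZr (a : R[i]) S T : bop_mul S (a *: T) = a *: bop_mul S T.
Proof. by apply: bopP => x; exact: (linearZZ S a (T x)). Qed.

Lemma bop_adjD : {morph bop_adj : S T / S + T}.
Proof.
move=> S T; apply: bop_adj_uniq => x y.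
by rewrite !bopDE dotDl dotDr -!bop_adjP.
Qed.

Lemma bop_adjZ (a : R[i]) T : bop_adj (a *: T) = Num.conj a *: bop_adj T.
Proof.
apply: bop_adj_uniq => x y.
by rewrite !bopZE dotZl dotZr -bop_adjP conjCK.
Qed.

Lemma bop_adjM S T : bop_adj (bop_mul S T) = bop_mul (bop_adj T) (bop_adj S).
Proof. by apply: bop_adj_uniq => x y /=; rewrite !bop_adjP. Qed.

Lemma bop_adjK : involutive bop_adj.
Proof. by move=> T; apply: bop_adj_uniq => x y; rewrite bop_adjP'. Qed.

Lemma bop_mul_norm S T : `|bop_mul S T| <= `|S| * `|T|.
Proof.
rewrite !bop_normE -rmorphM lecR; apply: opnorm_leM.
  by rewrite mulr_ge0 ?opnorm_ge0.
move=> x /=; apply: le_trans (le_opnorm _ _) _.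
by rewrite -mulrA ler_wpM2l ?opnorm_ge0 ?le_opnorm.
Qed.

Lemma opnorm_adj_le T : opnorm T ^+ 2 <= opnorm (bop_mul (bop_adj T) T).
Proof.
set N := opnorm _; have N0 : 0 <= N by exact: opnorm_ge0.
rewrite -(@ler_sqrt R) ?exprn_ge0 ?opnorm_ge0//.
rewrite sqrtr_sqr ger0_norm ?opnorm_ge0//; apply: opnorm_leM.
  exact: sqrtr_ge0.
move=> x; rewrite -(@ler_pXn2r _ 2)// ?nnegrE ?mulr_ge0 ?sqrtr_ge0 ?rnorm_ge0//.
rewrite exprMn sqr_sqrtr ?opnorm_ge0// -rdotxx /rdot bop_adjP -/(rdot _ _).
apply: le_trans (rdot_cauchy _ _) _; rewrite mulrC expr2 mulrA.
rewrite ler_wpM2r ?rnorm_ge0//.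
exact: (le_opnorm (bop_mul (bop_adj T) T)).
Qed.

Lemma bop_cstar T : `|bop_mul (bop_adj T) T| = `|T| ^+ 2.
Proof.
have le_adj S : opnorm S <= opnorm (bop_adj S).
  have [S0|S0] := eqVneq (opnorm S) 0; first by rewrite S0 opnorm_ge0.
  have pS : 0 < opnorm S by rewrite lt_def S0 opnorm_ge0.
  rewrite -(ler_pM2r pS) -expr2; apply: le_trans (opnorm_adj_le _) _.
  by have := bop_mul_norm (bop_adj S) S; rewrite !bop_normE -rmorphM lecR.
have adjE : opnorm (bop_adj T) = opnorm T.
  by apply/eqP; rewrite eq_le le_adj andbT;
    have := le_adj (bop_adj T); rewrite bop_adjK.
apply/eqP; rewrite eq_le; apply/andP; split.
  apply: le_trans (bop_mul_norm _ _) _.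
  by rewrite !bop_normE adjE expr2.
by rewrite !bop_normE -rmorphXn lecR opnorm_adj_le.
Qed.

HB.instance Definition _ := isCStarAlgebra.Build R (bop H)
  bop_mulA bop_mul1l bop_mul1r bop_mulDl bop_mulDr bop_mulZl bop_mulZr
  bop_adjD bop_adjZ bop_adjM bop_adjK bop_mul_norm bop_cstar.

End OperatorAlgebra.

Section HilbertSubspaces.
Context {R : realType}.

Definition closed_span (H : hilbertType R) (S : set H) : set H :=
  \bigcap_(W in [set W : set H | [/\ closed W, S `<=` W, W 0 &
    forall (a : R[i]) x y, W x -> W y -> W (a *: x + y)]]) W.

Definition lin_indep (H : hilbertType R) (n : nat) (v : 'I_n -> H) : Prop :=
  forall a : 'I_n -> R[i], \sum_(i < n) a i *: v i = 0 -> forall i, a i = 0.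

Definition has_dim (H : hilbertType R) (n : nat) : Prop :=
  exists b : 'I_n -> H, lin_indep b /\
    forall x, exists a : 'I_n -> R[i], x = \sum_(i < n) a i *: b i.

Definition orthocompl (H : hilbertType R) (S : set H) : set H :=
  [set x | forall s, S s -> dot x s = 0].

(* The orthogonal projection onto a closed subspace S. *)
Definition orthproj (H : hilbertType R) (S : set H) (z : H) : H :=
  xget 0 [set p | S p /\ orthocompl S (z - p)].

(* An inclusion H <= K of Hilbert spaces is given by an isometric embedding
   iota : H -> K, whose range is the copy of H inside K. *)
Definition isometric (H K : hilbertType R) (iota : H -> K) : Prop :=
  linear iota /\ forall x y, dot (iota x) (iota y) = dot x y.

(* T = P_H S |_H *)
Definition is_compression (H K : hilbertType R) (iota : H -> K)
    (T : bop H) (S : bop K) : Prop :=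
  forall h, iota (T h) = orthproj (range iota) (S (iota h)).

End HilbertSubspaces.

Section CStarTuples.
Context {R : realType}.

Definition unitary (A : cstarAlgType R) (u : A) : Prop :=
  cmul (star u) u = cone /\ cmul u (star u) = cone.

Record closed_star_subalg (A : cstarAlgType R) (S : set A) : Prop := {
  csubalg_closed : closed S;
  csubalg_one : S cone;
  csubalg_lin : forall (a : R[i]) x y, S x -> S y -> S (a *: x + y);
  csubalg_mul : forall x y, S x -> S y -> S (cmul x y);
  csubalg_star : forall x, S x -> S (star x)
}.

(* C*(u) *)
Definition cstar_gen (A : cstarAlgType R) (d : nat) (u : 'I_d -> A) : set A :=
  \bigcap_(S in [set S | closed_star_subalg S /\ forall i, S (u i)]) S.

(* phi restricts to a unital *-homomorphism on the unital *-subalgebra S *)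
Record star_hom_on (A B : cstarAlgType R) (S : set A) (phi : A -> B) : Prop := {
  shom_lin : forall (a : R[i]) x y, S x -> S y ->
    phi (a *: x + y) = a *: phi x + phi y;
  shom_mul : forall x y, S x -> S y -> phi (cmul x y) = cmul (phi x) (phi y);
  shom_star : forall x, S x -> phi (star x) = star (phi x);
  shom_one : phi cone = cone
}.

Definition star_hom (A B : cstarAlgType R) (phi : A -> B) : Prop :=
  star_hom_on setT phi.

Definition sim (A B : cstarAlgType R) (d : nat)
    (u : 'I_d -> A) (v : 'I_d -> B) : Prop :=
  exists phi : A -> B, [/\ star_hom_on (cstar_gen u) phi,
    set_bij (cstar_gen u) (cstar_gen v) phi & forall i, phi (u i) = v i].

(* u \prec c v *)
Definition prec (A B : cstarAlgType R) (d : nat)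
    (u : 'I_d -> A) (c : R) (v : 'I_d -> B) : Prop :=
  exists (H K : hilbertType R) (iota : H -> K)
      (U : 'I_d -> bop H) (V : 'I_d -> bop K),
    [/\ isometric iota, sim U u, sim V v &
        forall i, is_compression iota (U i) (c%:C *: V i)].

(* The infimum is taken in the extended reals, so that it is +oo when no
   dilation exists. *)
Definition dil_const (A B : cstarAlgType R) (d : nat)
    (u : 'I_d -> A) (v : 'I_d -> B) : \bar R :=
  ereal_inf [set c%:E | c in [set c : R | 0 < c /\ prec u c v]].

End CStarTuples.

Section NoncommutativeTori.
Context {R : realType}.

Definition cexp (z : R[i]) : R[i] :=
  (expR (complex.Re z))%:C * (cos (complex.Im z) +i* sin (complex.Im z)).

Definition antisymmetric_mx (d : nat) (M : 'M[R]_d) : Prop := M^T = - M.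

Definition enorm (d : nat) (v : 'cV[R]_d) : R :=
  Num.sqrt (\sum_(i < d) (v i ord0) ^+ 2).

(* Operator norm of a real matrix; the complex Euclidean space would give the
   same value. *)
Definition mxopnorm (d : nat) (M : 'M[R]_d) : R :=
  sup [set enorm (M *m v) | v in [set v : 'cV[R]_d | enorm v <= 1]].

Definition torus_rel (d : nat) (Theta : 'M[R]_d) (A : cstarAlgType R)
    (u : 'I_d -> A) : Prop :=
  (forall k, unitary (u k)) /\
  forall k l, cmul (u l) (u k) =
    cexp ('i * (Theta k l)%:C) *: cmul (u k) (u l).

(* (A, u) is the universal C*-algebra A_Theta with its generating tuple
   u_Theta; this determines (A, u) up to a unique *-isomorphism. *)
Record nc_torus (d : nat) (Theta : 'M[R]_d) (A : cstarAlgType R)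
    (u : 'I_d -> A) : Prop := {
  nc_torus_rel : torus_rel Theta u;
  nc_torus_gen : cstar_gen u = setT;
  nc_torus_univ : forall (B : cstarAlgType R) (v : 'I_d -> B),
    torus_rel Theta v ->
    exists phi : A -> B, star_hom phi /\ forall k, phi (u k) = v k
}.

End NoncommutativeTori.

Section FockSpaces.
Context {R : realType}.

(* The k-th Hilbert space tensor power of H: a Hilbert space with a total
   family of elementary tensors [tensor v] = v_1 (x) ... (x) v_k.
   Multilinearity of [tensor] follows from the formula for inner products. *)
Record tensorPower (H : hilbertType R) (k : nat) := TensorPower {
  tensor_space :> hilbertType R;
  tensor : ('I_k -> H) -> tensor_space;
  dot_tensor : forall v w,
    dot (tensor v) (tensor w) = \prod_(i < k) dot (v i) (w i);
  tensor_total : closed_span (range tensor) = setT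
}.

(* Image of v_1 (x) ... (x) v_k under the symmetrization projection. *)
Definition sym_tensor (H : hilbertType R) (k : nat) (T : tensorPower H k)
    (v : 'I_k -> H) : T :=
  (k`!%:R)^-1 *: \sum_(s : 'S_k) tensor T (v \o s).

Definition sym_power (H : hilbertType R) (k : nat) (T : tensorPower H k) :
    set T :=
  closed_span (range (sym_tensor T)).
Arguments sym_power {H k} T _.

(* The symmetric Fock space: a Hilbert space that is the orthogonal direct sum
   of (isometric copies of) the symmetric powers, which are embedded by
   [fock_in].  On the symmetric powers [fock_in] is linear by [dot_fock_in];
   its values elsewhere are irrelevant. *)
Record fockSpace (H : hilbertType R) := FockSpace {
  fock_space :> hilbertType R;
  fock_tensor : forall k, tensorPower H k;
  fock_in : forall k, fock_tensor k -> fock_space;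
  dot_fock_in : forall k s t,
    sym_power (fock_tensor k) s -> sym_power (fock_tensor k) t ->
    dot (fock_in s) (fock_in t) = dot s t;
  fock_in_orth : forall j k s t, j != k ->
    sym_power (fock_tensor j) s -> sym_power (fock_tensor k) t ->
    dot (fock_in s) (fock_in t) = 0;
  fock_total :
    closed_span (\bigcup_k (@fock_in k @` sym_power (fock_tensor k))) = setT
}.

Variables (H : hilbertType R) (F : fockSpace H).

Definition tensor_exp (k : nat) (x : H) : fock_tensor F k :=
  tensor (fock_tensor F k) (fun=> x).

Definition exp_vector (x : H) : F :=
  \big[+%R/0]_(0 <= k <oo)
    (((Num.sqrt k`!%:R)^-1)%:C *: fock_in (tensor_exp k x)).

Definition is_weyl (z : H) (W : bop F) : Prop :=
  unitary W /\ forall x, W (exp_vector x) =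
    cexp (- (`|z| ^+ 2 / 2) - dot x z) *: exp_vector (z + x).

(* By totality of the exponential vectors there is only one such operator. *)
Definition weyl (z : H) : bop F := xget 0 [set W | is_weyl z W].

End FockSpaces.

Section Configurations.
Context {R : realType}.

(* J is the inclusion of the Fock space of H into the Fock space of K induced
   by iota : H -> K. *)
Definition fock_inclusion (H K : hilbertType R) (iota : H -> K)
    (FH : fockSpace H) (FK : fockSpace K) (J : FH -> FK) : Prop :=
  isometric J /\ forall k (v : 'I_k -> H),
    J (fock_in (sym_tensor (fock_tensor FH k) v)) =
    fock_in (sym_tensor (fock_tensor FK k) (iota \o v)).

Record weyl_config (d : nat) (Theta Theta' : 'M[R]_d) (H K : hilbertType R)
    (iota : H -> K) (z : 'I_d -> K) (x : 'I_d -> H) : Prop := {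
  wc_iota : isometric iota;
  wc_dimH : has_dim H d;
  wc_dimK : has_dim K (2 * d);
  wc_z_indep : lin_indep z;
  wc_proj : forall k, iota (x k) = orthproj (range iota) (z k);
  wc_x_indep : lin_indep x;
  wc_z_im : forall k l, 2 * complex.Im (dot (z l) (z k)) = Theta' k l;
  wc_x_im : forall k l, 2 * complex.Im (dot (x l) (x k)) = Theta k l;
  wc_y_norm : forall k,
    `|orthproj (orthocompl (range iota)) (z k)| ^+ 2 =
    (2^-1 * mxopnorm (Theta' - Theta))%:C
}.

End Configurations.

(* Main.v *)
(* Weyl operators.  The exponential vectors have the Gram matrix exp <x, y> and
   are total, so a family with the same Gram matrix is the image of e(x) under an
   isometry.  This yields W(z), unitary because W(z) W(-z) = 1, and the relation
   W(z) W(w) = exp(2i Im <z, w>) W(w) W(z), hence (1) and (2).  For (3) both sides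
   are compared on exponential vectors; the constant is exp(|y_k|^2 / 2).  A
   configuration exists because (t I + i M^T) / 2 is positive semidefinite for M
   real antisymmetric and t >= |M|, hence a Gram matrix.

   The inequality is obtained from regular representations instead of Weyl
   operators.  On l2(Z^d), u_k acts by delta_h |-> phase * delta_{h + e_k}; for
   Theta' take its amplification to l2(Z^d) (x) l2(Y).  The isometry
   delta_h |-> delta_h (x) xi_h, where xi_h is the normalized coherent vector of
   sum_j h_j y_j and the y_j have the Gram matrix of M = Theta' - Theta, t = |M|,
   compresses the second to the first up to the factor exp(-t / 4).  These
   representations are faithful: the coefficients of a *-polynomial p are bounded
   by the norm of its image, and their number grows polynomially with the length
   of the words, so the elements (p^* p)^(2^n) give |p(u)| <= |p(U)|; the
   converse inequality is the contractivity of *-homomorphisms. *)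
Require Import Defs.
From HB Require Import structures.
From mathcomp Require Import all_boot all_order all_algebra perm.
From mathcomp Require Import mathcomp_extra boolp classical_sets functions reals ereal.
From mathcomp Require Import topology normedtype sequences exp trigo.
From mathcomp Require Import complex ring lra zify.

Set Implicit Arguments.
Unset Strict Implicit.
Unset Printing Implicit Defensive.

Import Order.TTheory GRing.Theory Num.Theory.
Import numFieldNormedType.Exports.

Local Open Scope classical_set_scope.
Local Open Scope ring_scope.
Local Open Scope complex_scope.

(** * Totality and isometric extensions in Hilbert spaces *)

Section HilbertExtra.
Context {R : realType}.
Implicit Types H K : hilbertType R.

(** [prec] asks for tuples *-isomorphic to the universal ones, so a dilation bounds the constant
    only once both representations are known to be faithful. Shifts make this checkable by
    elementary means: the coefficient of degree g of a *-polynomial is a matrix entry between two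
    basis vectors. The half-phases [phase] are normalized by phase g g = 1, so that in any tuple
    satisfying the relations a word is the scalar [word_phase] times an element depending on its
    degree alone; this is what makes coefficients comparable across representations.

    The constant has one source in both halves: |y_k|^2 = t / 2, where t is the norm of Theta' -
    Theta, and two normalized exponential vectors whose arguments differ by y_k have an overlap of
    modulus exp(- |y_k|^2 / 2) = exp(- t / 4).

    The operator theory stays elementary throughout: Riesz representation, totality, Gram matrices
    and a Neumann series. The spectral theorem enters only for finite matrices, to factor a positive
    semidefinite Gram matrix. *)

Definition adherent (V : completeNormedModType R[i]) (W : set V) (x : V) : Prop :=
  forall e : R, 0 < e -> exists2 y, W y & rnorm (x - y) < e.

Lemma closure_adherent (V : completeNormedModType R[i]) (W : set V) x :
  closure W x <-> adherent W x.
Proof.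
split=> [Wx e e0|Wx B /nbhs_ballP[e /= e0 eB]].
  have e0C : 0 < e%:C by rewrite ltcR.
  have [y [Wy]] := Wx _ (nbhsx_ballx x _ e0C).
  by rewrite -ball_normE /= -rnormE ltcR; exists y.
have eE : (complex.Re e)%:C = e by rewrite RRe_real// gtr0_real.
have [|y Wy xy] := Wx (complex.Re e); first by rewrite -ltcR eE.
by exists y; split=> //; apply: eB; rewrite -ball_normE /= -eE -rnormE ltcR.
Qed.

Lemma closedP_adherent (V : completeNormedModType R[i]) (W : set V) :
  closed W <-> (forall x, adherent W x -> W x).
Proof.
by split=> cW x Wx; apply: cW; move: Wx; rewrite closure_adherent.
Qed.

Lemma rnorm_distC (V : completeNormedModType R[i]) (x y : V) :
  rnorm (x - y) = rnorm (y - x).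
Proof. by rewrite -opprB rnormN. Qed.

Lemma cabs_rnormZ (V : completeNormedModType R[i]) (a : R[i]) (M : R) (x : V) :
  `|a| <= M%:C -> rnorm (a *: x) <= M * rnorm x.
Proof.
move=> aM; rewrite rnormZ ler_wpM2r ?rnorm_ge0//.
by rewrite -lecR RRe_real// normr_real.
Qed.

Lemma normc_real (a : R[i]) : exists2 M : R, 0 <= M & `|a| = M%:C.
Proof.
exists (complex.Re `|a|); last by rewrite RRe_real ?normr_real.
by rewrite -ler0c RRe_real ?normr_real.
Qed.

Lemma norm_realC (a : R) : `|a%:C| = `|a|%:C.
Proof. by rewrite normc_def /= expr0n addr0 sqrtr_sqr. Qed.

Lemma norm_i : `|'i%C : R[i]| = 1.
Proof. by rewrite normc_def /= expr0n expr1n add0r sqrtr1. Qed.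

Lemma norm_le_ReIm (z : R[i]) : `|z| <= (`|complex.Re z| + `|complex.Im z|)%:C.
Proof.
rewrite [in leLHS](complexE z); apply: le_trans (ler_normD _ _) _.
by rewrite normrM norm_i mul1r !norm_realC rmorphD.
Qed.

Lemma rnorm_dist_trans (V : completeNormedModType R[i]) (y x z : V) :
  rnorm (x - z) <= rnorm (x - y) + rnorm (y - z).
Proof. by apply: le_trans (rnormD _ _); rewrite addrA subrK. Qed.

(** The epsilon budget for the stability of approximations under [a *: x + y]; the denominator is
    [M + 1] because [a] may be 0. *)
Lemma rnorm_dist_scaleD (V : completeNormedModType R[i]) (a : R[i]) (M e : R) (x y x' y' : V) :
  0 <= M -> `|a| = M%:C -> 0 < e -> rnorm (x - y) < e / (M + 1) / 2 ->
  rnorm (x' - y') < e / 2 -> rnorm (a *: x + x' - (a *: y + y')) < e.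
Proof.
move=> M0 aM e0 xy xy'; have M1 : 0 < M + 1 by rewrite ltr_wpDl.
rewrite opprD addrACA -scalerBr; apply: le_lt_trans (rnormD _ _) _.
rewrite [ltRHS](splitr e); apply: ler_ltD xy'.
apply: le_trans (cabs_rnormZ (M := M) _ _) _; first by rewrite aM.
apply: le_trans (ler_wpM2l M0 (ltW xy)) _.
rewrite mulrA ler_pM2r// mulrA ler_pdivrMr// mulrC ler_pM2l//.
by rewrite lerDl ler01.
Qed.

Lemma dot_sumr H (I : Type) (s : seq I) (f : I -> H) x :
  dot x (\sum_(i <- s) f i) = \sum_(i <- s) dot x (f i).
Proof. by elim/big_rec2: _ => [|i y z _ <-]; rewrite ?dot0r ?dotDr. Qed.

Lemma dot_suml H (I : Type) (s : seq I) (f : I -> H) x :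
  dot (\sum_(i <- s) f i) x = \sum_(i <- s) dot (f i) x.
Proof. by elim/big_rec2: _ => [|i y z _ <-]; rewrite ?dot0l ?dotDl. Qed.

(** A unimodular factor rotates the inner product onto the nonnegative reals, which reduces the
    complex Cauchy-Schwarz inequality to the one for [rdot]. *)
Lemma rdotZ_phase H (x y : H) : exists2 c : R[i], `|c| = 1 &
  `|dot x y| = (rdot (c *: x) y)%:C.
Proof.
have [c c1 cE] : exists2 c : R[i], `|c| = 1 & `|dot x y| = c * dot x y.
  have [->|d0] := eqVneq (dot x y) 0.
    by exists 1; rewrite ?normr1// normr0 mulr0.
  exists (`|dot x y| / dot x y); last by rewrite divfK.
  by rewrite normrM normrV ?unitfE// normr_id mulfV// normr_eq0.
exists c => //.
rewrite /rdot dotZl -cE RRe_real//; exact: normr_real.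
Qed.

Lemma dot_cauchy H (x y : H) : `|dot x y| <= (rnorm x * rnorm y)%:C.
Proof.
have [c c1 ->] := rdotZ_phase x y; rewrite lecR.
by apply: le_trans (rdot_cauchy _ _) _; rewrite rnormZ c1 mul1r.
Qed.

Lemma complex_small (a : R[i]) (M : R) : 0 <= M ->
  (forall e : R, 0 < e -> `|a| <= (e * M)%:C) -> a = 0.
Proof.
move=> M0 aM; apply/normr0_eq0; have [N N0 aN] := normc_real a.
rewrite aN; congr (_%:C); apply/eqP; rewrite eq_le N0 andbT.
apply/ler_addgt0Pr => e e0; rewrite add0r.
have M1 : 0 < M + 1 by rewrite ltr_wpDl.
have := aM _ (divr_gt0 e0 M1); rewrite aN lecR => /le_trans; apply.
rewrite -mulrA; apply: ler_piMr; first exact: ltW.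
by rewrite mulrC ler_pdivrMr ?mul1r ?lerDl ?ler01.
Qed.

Lemma adherent_dot0 H (x : H) (W : set H) y :
  (forall w, W w -> dot x w = 0) -> adherent W y -> dot x y = 0.
Proof.
move=> xW Wy; apply: (complex_small (rnorm_ge0 x)) => e e0.
have [w Ww yw] := Wy e e0.
have -> : dot x y = dot x (y - w) by rewrite dotDr dotNr (xW w)// subr0.
apply: le_trans (dot_cauchy _ _) _; rewrite lecR mulrC.
by rewrite ler_wpM2r ?rnorm_ge0// ltW.
Qed.

Lemma closed_span_ind H (S : set H) (P : set H) :
  closed P -> P 0 -> (forall a x y, P x -> P y -> P (a *: x + y)) ->
  S `<=` P -> closed_span S `<=` P.
Proof. by move=> cP P0 Pl SP x; apply. Qed.

Lemma closed_span_closed H (S : set H) : closed (closed_span S).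
Proof.
apply/closedP_adherent => x Sx W [cW SW W0 Wl].
move/closedP_adherent: (cW); apply => e e0; have [y Sy xy] := Sx e e0.
by exists y => //; apply: Sy.
Qed.

Lemma closed_span_adherent H (S : set H) x :
  adherent (closed_span S) x -> closed_span S x.
Proof. by move/closedP_adherent: (@closed_span_closed _ S); apply. Qed.

Lemma closed_span_sub H (S : set H) : S `<=` closed_span S.
Proof. by move=> x Sx W [_ SW _ _]; apply: SW. Qed.

Lemma closed_span0 H (S : set H) : closed_span S 0.
Proof. by move=> W []. Qed.

Lemma closed_spanP H (S : set H) a x y :
  closed_span S x -> closed_span S y -> closed_span S (a *: x + y).
Proof. by move=> Sx Sy W WP; case: (WP) => _ _ _; apply; [exact: Sx|exact: Sy]. Qed.

Lemma closed_spanZ H (S : set H) a x : closed_span S x -> closed_span S (a *: x).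
Proof. by move=> Sx; rewrite -[_ *: _]addr0; exact: (closed_spanP a Sx (@closed_span0 _ S)). Qed.

Lemma closed_spanD H (S : set H) x y :
  closed_span S x -> closed_span S y -> closed_span S (x + y).
Proof. by move=> Sx Sy; rewrite -[x]scale1r; exact: (closed_spanP 1 Sx Sy). Qed.

Lemma closed_span_sum H (S : set H) (I : Type) (s : seq I) (P : pred I) (f : I -> H) :
  (forall i, P i -> closed_span S (f i)) -> closed_span S (\sum_(i <- s | P i) f i).
Proof.
move=> Sf; elim/big_rec: _ => [|i x Pi Sx]; first exact: closed_span0.
exact: closed_spanD (Sf _ Pi) Sx.
Qed.

Lemma closed_span_le H (S T : set H) :
  S `<=` closed_span T -> closed_span S `<=` closed_span T.
Proof.
by apply: closed_span_ind; [exact: closed_span_closed|exact: closed_span0|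
  move=> a x y Tx Ty; exact: (closed_spanP a Tx Ty)].
Qed.

(** The vectors orthogonal to [x - y] form a closed subspace containing the total set, hence contain
    [x - y] itself. *)
Lemma total_dot_ext H (S : set H) x y : closed_span S = setT ->
  (forall s, S s -> dot x s = dot y s) -> x = y.
Proof.
move=> St xy; apply/eqP; rewrite -subr_eq0; apply/eqP.
have : closed_span S `<=` [set z | dot (x - y) z = 0].
  apply: closed_span_ind.
  - by apply/closedP_adherent => z Wz; exact: adherent_dot0 Wz.
  - by rewrite /= dot0r.
  - by move=> a z w /= z0 w0; rewrite dotDr dotZr z0 w0 mulr0 addr0.
  - by move=> s Ss /=; rewrite dotDl dotNl xy// subrr.
rewrite St => /(_ (x - y) I)/=; rewrite dot_norm => /eqP.
by rewrite sqrf_eq0 normr_eq0 => /eqP.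
Qed.

(** Lists with repetitions: sums become concatenations and scalings become maps, with no supports to
    normalize. *)
Definition lincomb H (X : Type) (e : X -> H) (s : seq (R[i] * X)) : H :=
  \sum_(p <- s) p.1 *: e p.2.

Lemma dot_lincomb H (X : Type) (e f : X -> H) s t :
  dot (lincomb e s) (lincomb f t) =
  \sum_(p <- s) \sum_(q <- t) p.1 * Num.conj q.1 * dot (e p.2) (f q.2).
Proof.
rewrite /lincomb dot_suml; apply: eq_bigr => p _.
rewrite dot_sumr; apply: eq_bigr => q _.
by rewrite dotZl dotZr mulrA.
Qed.

Lemma lincomb_cat H (X : Type) (e : X -> H) s t :
  lincomb e (s ++ t) = lincomb e s + lincomb e t.
Proof. by rewrite /lincomb big_cat. Qed.

Lemma lincombZ H (X : Type) (e : X -> H) a s :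
  lincomb e [seq (a * p.1, p.2) | p <- s] = a *: lincomb e s.
Proof.
rewrite /lincomb big_map scaler_sumr; apply: eq_bigr => p _ /=.
by rewrite scalerA.
Qed.

Lemma closed_span_lincomb H (X : Type) (e : X -> H) x :
  closed_span (range e) x -> adherent (range (lincomb e)) x.
Proof.
move: x; apply: closed_span_ind.
- apply/closedP_adherent => x xW d d0.
  have d2 : 0 < d / 2 by rewrite divr_gt0.
  have [y yW xy] := xW _ d2; have [z zW yz] := yW _ d2.
  exists z => //; apply: le_lt_trans (rnorm_dist_trans y _ _) _.
  by rewrite [ltRHS](splitr d) ltrD.
- move=> d d0; exists 0; last by rewrite subrr rnorm0.
  by exists [::] => //; rewrite /lincomb big_nil.
- move=> a x y xW yW d d0.
  have [M M0 aM] := normc_real a.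
  have M1 : 0 < M + 1 by rewrite ltr_wpDl.
  have d1 : 0 < d / (M + 1) / 2 by rewrite !divr_gt0.
  have d2 : 0 < d / 2 by rewrite divr_gt0.
  have [_ [s _ <-] xs] := xW _ d1; have [_ [t _ <-] yt] := yW _ d2.
  exists (a *: lincomb e s + lincomb e t).
    by exists ([seq (a * p.1, p.2) | p <- s] ++ t) => //; rewrite lincomb_cat lincombZ.
  exact: rnorm_dist_scaleD M0 aM d0 xs yt.
- move=> _ [x _ <-] d d0; exists (e x); last by rewrite subrr rnorm0.
  by exists [:: (1, x)] => //; rewrite /lincomb big_seq1 scale1r.
Qed.

Lemma lfun0 H K (f : H -> K) : linear f -> f 0 = 0.
Proof. by move=> fl; have := fl (-1) 0 0; rewrite scaler0 addr0 scaleN1r addNr. Qed.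

Lemma lfunB H K (f : H -> K) x y : linear f -> f (x - y) = f x - f y.
Proof. by move=> fl; rewrite -scaleN1r addrC fl scaleN1r addrC. Qed.

Lemma lfunZ H K (f : H -> K) a x : linear f -> f (a *: x) = a *: f x.
Proof. by move=> fl; rewrite -[a *: x]addr0 fl lfun0// addr0. Qed.

(** Approximate preimages of [y] form a Cauchy filter because [W] preserves distances. Stated for
    normed spaces since it is applied to a *-homomorphism. *)
Lemma isometry_range_closed (V1 V2 : completeNormedModType R[i]) (W : V1 -> V2) :
  (forall x y, W (x - y) = W x - W y) -> (forall x, rnorm (W x) = rnorm x) ->
  closed (range W).
Proof.
move=> WB Wn; apply/closedP_adherent => y Wy.
pose F := filter_from [set e : R | 0 < e]
  (fun e => [set x | rnorm (y - W x) < e]).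
have F0 (e : R) : 0 < e -> [set x | rnorm (y - W x) < e] !=set0.
  by move=> /Wy[_ [x _ <-] yx]; exists x.
have FF : ProperFilter F.
  apply: filter_from_proper; last by move=> e; exact: F0.
  apply: filter_from_filter; first by exists 1; exact: ltr01.
  move=> i j /= i0 j0; exists (Num.min i j); first by rewrite lt_min i0.
  by move=> x /=; rewrite lt_min => /andP[].
have close (e : R) x x' : rnorm (y - W x) < e -> rnorm (y - W x') < e ->
    rnorm (x - x') < e + e.
  move=> xe xe'; rewrite -Wn WB.
  apply: le_lt_trans (rnorm_dist_trans y _ _) _.
  by rewrite rnorm_distC ltrD.
have cF : cauchy F.
  apply: cauchy_real => e e0.
  have e2 : 0 < e / 2 by rewrite divr_gt0.
  have [x xe] := F0 _ e2; exists x; exists (e / 2) => // x' xe'.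
  by rewrite /= [ltRHS](splitr e); exact: close.
have [l Fl] := cauchy_filter_lim FF cF.
exists l => //; apply/esym/eqP; rewrite -subr_eq0; apply/eqP.
apply: (@rnorm_small _ _ _ 3) => // e e0.
have [x xe] := F0 _ e0.
have xl : rnorm (x - l) <= e + e.
  by apply: Fl; exists e => // x' xe'; apply/ltW/close.
apply: le_trans (rnorm_dist_trans (W x) _ _) _.
rewrite -WB Wn.
move: xe => /= /ltW xe.
by apply: le_trans (lerD xe xl) _; lra.
Qed.

(** * Isometries determined by equal Gram matrices *)

Section Isometries.
Variables (H K : hilbertType R).

Lemma isometric_rnorm (W : H -> K) x : isometric W -> rnorm (W x) = rnorm x.
Proof.
move=> [_ Wd]; apply/eqP; rewrite -(@eqrXn2 _ 2)// ?rnorm_ge0//.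
by rewrite -!rdotxx /rdot Wd.
Qed.

Variables (X : Type) (e : X -> H) (f : X -> K).
Hypothesis gram : forall x y, dot (f x) (f y) = dot (e x) (e y).

Lemma gram_lincomb s : rnorm (lincomb f s) = rnorm (lincomb e s).
Proof.
apply/eqP; rewrite -(@eqrXn2 _ 2)// ?rnorm_ge0//.
rewrite -!rdotxx /rdot !dot_lincomb; apply/eqP; congr complex.Re.
by do 2![apply: eq_bigr => ? _]; rewrite gram.
Qed.

Lemma gram_lincombB s t :
  rnorm (lincomb f s - lincomb f t) = rnorm (lincomb e s - lincomb e t).
Proof.
by rewrite -[in LHS]scaleN1r -[in RHS]scaleN1r -!lincombZ -!lincomb_cat gram_lincomb.
Qed.

Let graph (h : H) (k : K) : Prop := forall d : R, 0 < d ->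
  exists s, rnorm (h - lincomb e s) < d /\ rnorm (k - lincomb f s) < d.

Let graphP a h k h' k' :
  graph h k -> graph h' k' -> graph (a *: h + h') (a *: k + k').
Proof.
move=> hk hk' d d0.
have [M M0 aM] := normc_real a.
have M1 : 0 < M + 1 by rewrite ltr_wpDl.
have d1 : 0 < d / (M + 1) / 2 by rewrite !divr_gt0.
have d2 : 0 < d / 2 by rewrite divr_gt0.
have [s [hs ks]] := hk _ d1; have [t [ht kt]] := hk' _ d2.
exists ([seq (a * p.1, p.2) | p <- s] ++ t).
rewrite !lincomb_cat !lincombZ.
by split; [exact: rnorm_dist_scaleD M0 aM d0 hs ht|exact: rnorm_dist_scaleD M0 aM d0 ks kt].
Qed.

Let graph_rnorm h k : graph h k -> rnorm k = rnorm h.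
Proof.
move=> hk; apply/eqP; rewrite -subr_eq0 -normr_le0.
apply/ler_addgt0Pr => d d0; rewrite add0r.
have d2 : 0 < d / 2 by rewrite divr_gt0.
have [s [hs ks]] := hk _ d2.
have h1 : rnorm h <= rnorm (h - lincomb e s) + rnorm (lincomb e s).
  by rewrite -{1}[h](subrK (lincomb e s)) rnormD.
have h2 : rnorm (lincomb e s) <= rnorm (h - lincomb e s) + rnorm h.
  by rewrite rnorm_distC -{1}[lincomb e s](subrK h) rnormD.
have h3 : rnorm k <= rnorm (k - lincomb f s) + rnorm (lincomb f s).
  by rewrite -{1}[k](subrK (lincomb f s)) rnormD.
have h4 : rnorm (lincomb f s) <= rnorm (k - lincomb f s) + rnorm k.
  by rewrite rnorm_distC -{1}[lincomb f s](subrK k) rnormD.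
move: h1 h2 h3 h4 hs ks; rewrite gram_lincomb => *.
by rewrite ler_norml; apply/andP; split; lra.
Qed.

(** The images [lincomb f s] of approximations to [h] form a Cauchy filter, since [gram_lincombB]
    transports their mutual distances from [H]. *)
Let graph_ex h : adherent (range (lincomb e)) h -> exists k, graph h k.
Proof.
move=> eh.
pose D (d : R) := [set k | exists2 s, k = lincomb f s & rnorm (h - lincomb e s) < d].
pose F := filter_from [set d : R | 0 < d] D.
have D0 (d : R) : 0 < d -> D d !=set0.
  by move=> /eh[_ [s _ <-] hs]; exists (lincomb f s), s.
have FF : ProperFilter F.
  apply: filter_from_proper; last by move=> d; exact: D0.
  apply: filter_from_filter; first by exists 1; exact: ltr01.
  move=> i j /= i0 j0; exists (Num.min i j); first by rewrite lt_min i0.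
  by move=> _ /= [s ->]; rewrite lt_min => /andP[? ?]; split; exists s.
have close (d : R) k k' : D d k -> D d k' -> rnorm (k - k') < d + d.
  move=> [s -> hs] [t -> ht]; rewrite gram_lincombB.
  by apply: le_lt_trans (rnorm_dist_trans h _ _) _; rewrite rnorm_distC ltrD.
have cF : cauchy F.
  apply: cauchy_real => d d0.
  have d2 : 0 < d / 2 by rewrite divr_gt0.
  have [k dk] := D0 _ d2; exists k; exists (d / 2) => // k' dk'.
  by rewrite /= [ltRHS](splitr d); exact: close.
have [l Fl] := cauchy_filter_lim FF cF.
exists l => d d0.
have d3 : 0 < d / 3 by rewrite divr_gt0.
have [_ [s _ <-] hs] := eh _ d3; exists s; split.
  by apply: lt_le_trans hs _; lra.
rewrite rnorm_distC; apply: (@le_lt_trans _ _ (d / 3 + d / 3)); last by lra.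
by apply: Fl; exists (d / 3) => // k' dk'; apply/ltW/close => //; exists s.
Qed.

(* The graph of the extension is the closure of the set of pairs of
   corresponding linear combinations. *)
Lemma gram_isometry : closed_span (range e) = setT ->
  exists W : H -> K, isometric W /\ forall x, W (e x) = f x.
Proof.
move=> et.
have gex h : exists k, graph h k.
  by apply/graph_ex/closed_span_lincomb; rewrite et.
have [W WP] := choice gex.
have gW h k : graph h k -> k = W h.
  move=> hk; apply/eqP; rewrite -subr_eq0; apply/eqP/rnorm0_eq0.
  have := graphP (-1) (WP h) hk; rewrite !scaleN1r => /graph_rnorm.
  by rewrite addNr rnorm0 addrC.
have Wl : linear W.
  by move=> a x y; apply/esym/gW; exact: graphP.
exists W; split; last first.
  move=> x; apply/esym/gW => d d0; exists [:: (1, x)].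
  by rewrite /lincomb !big_seq1 !scale1r !subrr !rnorm0.
split=> //.
(* Polarization turns preservation of norms into that of real parts; [dotE] expresses the imaginary
   part by [rdot] at ['i *: x]. *)
have Wr x y : rdot (W x) (W y) = rdot x y.
  have Wn := graph_rnorm (WP _).
  have := rdotxx (W (1 *: x + y)); rewrite Wn -rdotxx Wl !scale1r.
  rewrite !rdotDl !rdotDr !rdotxx !Wn (rdotC (W y)) (rdotC y x); lra.
by move=> x y; rewrite !dotE -(lfunZ _ _ Wl) !Wr.
Qed.

End Isometries.

Section BoundedExt.
Variables (H K : hilbertType R).

Lemma total_eq (S : set H) (f g : H -> K) (M N : R) :
  linear f -> linear g -> (forall x, rnorm (f x) <= M * rnorm x) ->
  (forall x, rnorm (g x) <= N * rnorm x) ->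
  closed_span S = setT -> (forall s, S s -> f s = g s) -> f =1 g.
Proof.
move=> fl gl fM gN St fg x.
have : closed_span S `<=` [set z | f z = g z].
  apply: closed_span_ind.
  - apply/closedP_adherent => z Wz; apply/eqP; rewrite -subr_eq0; apply/eqP.
    apply: (@rnorm_small _ _ _ (`|M| + `|N|)); first by rewrite addr_ge0.
    move=> d d0; have [w /= fgw zw] := Wz _ d0.
    have -> : f z - g z = f (z - w) - g (z - w).
      by rewrite (lfunB z w fl) (lfunB z w gl) fgw opprB addrA subrK.
    apply: le_trans (rnormD _ _) _; rewrite rnormN mulrDr lerD//.
      apply: le_trans (fM _) _; rewrite mulrC.
      apply: (@le_trans _ _ (rnorm (z - w) * `|M|)).
        by rewrite ler_wpM2l ?rnorm_ge0 ?ler_norm.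
      by rewrite ler_wpM2r// ltW.
    apply: le_trans (gN _) _; rewrite mulrC.
    apply: (@le_trans _ _ (rnorm (z - w) * `|N|)).
      by rewrite ler_wpM2l ?rnorm_ge0 ?ler_norm.
    by rewrite ler_wpM2r// ltW.
  - by rewrite /= (lfun0 fl) (lfun0 gl).
  - by move=> a y z /= yE zE; rewrite fl gl yE zE.
  - exact: fg.
by rewrite St; apply.
Qed.

End BoundedExt.

Lemma bop_total_eq H (S : set H) (T U : bop H) : closed_span S = setT ->
  (forall s, S s -> T s = U s) -> T = U.
Proof.
move=> St TU; apply: bopP.
by apply: (total_eq (bop_linear T) (bop_linear U) (le_opnorm T) (le_opnorm U) St).
Qed.

Lemma isometric_bounded H (W : H -> H) : isometric W -> bounded_op W.
Proof.
move=> iW; apply: bounded_opP; first by case: iW.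
by exists 1 => x; rewrite mul1r isometric_rnorm.
Qed.

(** Uniqueness: two candidates differ by an element of [S] that is orthogonal to [S], so [xget] can
    only have picked [p]. *)
Lemma orthproj_eq H (S : set H) z p : S 0 ->
  (forall a x y, S x -> S y -> S (a *: x + y)) ->
  S p -> orthocompl S (z - p) -> orthproj S z = p.
Proof.
move=> S0 Sl Sp zp; rewrite /orthproj.
have := @xgetPex _ 0 [set p | S p /\ orthocompl S (z - p)].
case; first by exists p.
set q := xget _ _ => Sq zq.
have Sqp : S (q - p) by rewrite addrC -scaleN1r; exact: Sl.
have : dot (q - p) (q - p) = 0.
  rewrite -{1}[q](subrK z) -addrA dotDl zp// addr0 -opprB dotNl zq// oppr0//.
by rewrite dot_norm => /eqP; rewrite sqrf_eq0 normr_eq0 subr_eq0 => /eqP.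
Qed.

Lemma range_isometric0 H K (iota : H -> K) : isometric iota -> range iota 0.
Proof.
by move=> [il _]; exists 0 => //; exact: lfun0.
Qed.

Lemma range_isometricP H K (iota : H -> K) a x y : isometric iota ->
  range iota x -> range iota y -> range iota (a *: x + y).
Proof. by move=> [il _] [h _ <-] [h' _ <-]; exists (a *: h + h') => //; rewrite il. Qed.

(** Turns [is_compression] into an identity of inner products; every compression below is verified
    in this form. *)
Lemma orthproj_range H K (iota : H -> K) z h : isometric iota ->
  (forall g, dot z (iota g) = dot h g) -> orthproj (range iota) z = iota h.
Proof.
move=> ii zh; apply: orthproj_eq.
- exact: range_isometric0.
- by move=> a x y; exact: range_isometricP.
- by exists h.
- by move=> _ [g _ <-]; rewrite dotDl dotNl zh ii.2 subrr.
Qed.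

(** Riesz representation of the functional g |-> <iota g, z> on [H] gives the preimage of the
    projection. *)
Lemma orthproj_range_ex H K (iota : H -> K) z : isometric iota ->
  exists h, orthproj (range iota) z = iota h /\
    forall g, dot z (iota g) = dot h g.
Proof.
move=> ii.
have [||h hE] := @riesz _ H (fun g => dot (iota g) z) (rnorm z).
- by move=> a x y; rewrite ii.1 dotDl dotZl.
- move=> x; rewrite -rnormE -rmorphM mulrC -(isometric_rnorm _ ii).
  exact: dot_cauchy.
have zh g : dot z (iota g) = dot h g by rewrite dotC hE -dotC.
by exists h; split=> //; exact: orthproj_range.
Qed.

Lemma orthproj_compl_range H K (iota : H -> K) z h : isometric iota ->
  orthproj (range iota) z = iota h -> orthproj (orthocompl (range iota)) z = z - iota h.
Proof.
move=> ii zh.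
have [h' [zh' hE]] := orthproj_range_ex z ii.
have hh' : iota h' = iota h by rewrite -zh'.
apply: orthproj_eq.
- by move=> s _; rewrite dot0l.
- by move=> a x y xS yS s Ss; rewrite dotDl dotZl xS// yS// mulr0 addr0.
- by move=> _ [g _ <-]; rewrite dotDl dotNl -hh' hE ii.2 subrr.
- move=> s sS; rewrite subKr dotC sS ?rmorph0//; by exists h.
Qed.

End HilbertExtra.
(** * The complex exponential series *)

Section ComplexExponential.
Context {R : realType}.
Implicit Types z w : R[i].

Lemma conjE (a b : R) : Num.conj (a +i* b) = a -i* b.
Proof. by []. Qed.

Lemma cexpD z w : cexp (z + w) = cexp z * cexp w.
Proof.
case: z w => [a b] [c d]; rewrite /cexp /= expRD cosD sinD.
rewrite rmorphM /=; simpc; congr (_ +i* _); ring.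
Qed.

Lemma cexp0 : cexp 0 = 1 :> R[i].
Proof. by rewrite /cexp /= expR0 cos0 sin0; simpc. Qed.

Lemma cexpR (a : R) : cexp a%:C = (expR a)%:C.
Proof. by rewrite /cexp /= cos0 sin0; simpc. Qed.

Lemma conj_cexp z : Num.conj (cexp z) = cexp (Num.conj z).
Proof.
case: z => a b; rewrite /cexp; simpc.
by rewrite [in RHS]/= cosN sinN mulrN.
Qed.

Lemma norm_cexp z : `|cexp z| = (expR (complex.Re z))%:C.
Proof.
rewrite /cexp normrM ger0_norm ?ler0c ?expR_ge0//.
by rewrite [X in _ * X]normc_def /= cos2Dsin2 sqrtr1 mulr1.
Qed.

Lemma cexp_imag_norm (t : R) : `|cexp ('i * t%:C)| = 1.
Proof. by rewrite norm_cexp /=; simpc; rewrite expR0. Qed.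

(** Stated over any field so that a single product formula serves real and complex arguments; only
    degrees below [n] occur. *)
Definition exp_sum {F : fieldType} (n : nat) (x : F) : F :=
  \sum_(k < n) x ^+ k / k`!%:R.

(** The products with i + j < n assemble by the binomial theorem; the others are kept as an explicit
    sum, to be estimated termwise. *)
Lemma exp_sumD (F : numFieldType) n (x y : F) :
  exp_sum n x * exp_sum n y = exp_sum n (x + y) +
   \sum_(i < n) \sum_(j < n | (n <= i + j)%N) (x ^+ i / i`!%:R) * (y ^+ j / j`!%:R).
Proof.
rewrite /exp_sum big_distrlr /=.
have -> : \sum_(k < n) (x + y) ^+ k / k`!%:R =
   \sum_(i < n) \sum_(j < n | (i + j < n)%N) (x ^+ i / i`!%:R) * (y ^+ j / j`!%:R).
  transitivity (\sum_(k < n) \sum_(i < n) \sum_(j < n | (i + j == k)%N)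
      (x ^+ i / i`!%:R) * (y ^+ j / j`!%:R)).
    apply: eq_bigr => k _.
    rewrite addrC exprDn mulr_suml.
    rewrite (big_ord_widen n (fun i => y ^+ (k - i) * x ^+ i *+ 'C(k, i) / k`!%:R))//.
    rewrite big_mkcond; apply: eq_bigr => i _; rewrite ltnS.
    case: leqP => ik; last first.
      by rewrite big_pred0// => j; apply/eqP => ijk; rewrite -ijk ltnNge leq_addr in ik.
    have kin : (k - i < n)%N by apply: leq_ltn_trans (leq_subr _ _) _.
    rewrite (big_pred1 (Ordinal kin)) => [|j]; last first.
      by rewrite /= -val_eqE /= -[X in _ == X](subnKC ik) eqn_add2l.
    rewrite /= -(bin_fact ik) !natrM -mulr_natr.
    by field; rewrite !pnatr_eq0 -!lt0n !fact_gt0 bin_gt0 ik.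
  rewrite exchange_big; apply: eq_bigr => i _ /=.
  rewrite (exchange_big_dep (fun j : 'I_n => (i + j < n)%N)) /=; last first.
    by move=> k j _ /eqP ->.
  apply: eq_bigr => j ijn; apply: (big_pred1 (Ordinal ijn)) => k /=.
  by apply/eqP/eqP => [kE|->//]; exact: val_inj.
rewrite -big_split; apply: eq_bigr => i _ /=.
rewrite (bigID (fun j : 'I_n => (i + j < n)%N)) /=; congr (_ + _).
by apply: eq_bigl => j; rewrite -leqNgt.
Qed.

Lemma exp_sum_seriesE (a : R) : (fun n => exp_sum n a) = series (exp_coeff a).
Proof. by apply/funext => n; rewrite /series /= big_mkord. Qed.

Lemma cvg_exp_sum (a : R) : exp_sum n a @[n --> \oo] --> expR a.
Proof. by rewrite exp_sum_seriesE; exact: is_cvg_series_exp_coeff. Qed.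

Lemma exp_sum_real n (a : R) : exp_sum n a%:C = (exp_sum n a)%:C.
Proof.
rewrite /exp_sum rmorph_sum; apply: eq_bigr => k _.
by rewrite rmorphM rmorphXn fmorphV rmorph_nat.
Qed.

Lemma exp_sum_imag n (b : R) :
  exp_sum n ('i * b%:C) = series (cos_coeff b) n +i* series (sin_coeff b) n.
Proof.
rewrite [RHS]complexE /= /series /= !big_mkord !rmorph_sum mulr_sumr -big_split.
apply: eq_bigr => k _ /=; rewrite exprMn.
have -> : 'i%C ^+ k = ((~~ odd k)%:R * (-1) ^+ k./2) +i* ((odd k)%:R * (-1) ^+ k.-1./2) :> R[i].
  rewrite -[in LHS](odd_double_half k) exprD -mul2n exprM sqr_i.
  have -> : (-1) ^+ k./2 = ((-1) ^+ k./2)%:C :> R[i] by rewrite rmorphXn rmorphN1.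
  case: (boolP (odd k)) => ok /=; simpc => //.
  congr (_ +i* _ ^+ _).
  by rewrite -[in RHS](odd_double_half k) ok add1n /= doubleK.
have bk : b%:C ^+ k / k`!%:R = (b ^+ k / k`!%:R)%:C :> R[i].
  by rewrite rmorphM rmorphXn fmorphV rmorph_nat.
by rewrite -mulrA bk /cos_coeff /sin_coeff /=; simpc; rewrite !mulrA.
Qed.

(** Each leftover term has the modulus of the corresponding real term at |a| and |b|. Convergence of
    the complex series is thus reduced to the real exponential, sine and cosine series. *)
Lemma exp_sum_tail n (a b : R) :
  `|exp_sum n (a +i* b) - exp_sum n a%:C * exp_sum n ('i * b%:C)| <=
  (exp_sum n `|a| * exp_sum n `|b| - exp_sum n (`|a| + `|b|))%:C.
Proof.
have -> : a +i* b = a%:C + 'i * b%:C by rewrite [LHS]complexE.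
rewrite !exp_sumD opprD addNKr normrN addrAC subrr add0r.
rewrite rmorph_sum; apply: le_trans (ler_norm_sum _ _ _) _; apply: ler_sum => i _.
rewrite rmorph_sum; apply: le_trans (ler_norm_sum _ _ _) _; apply: ler_sum => j _.
rewrite !rmorphM !fmorphV !rmorphXn !rmorph_nat !normrM !normrV ?unitfE ?pnatr_eq0 -?lt0n ?fact_gt0//.
rewrite !normrX normrM !normr_nat.
by rewrite !norm_realC norm_i mul1r.
Qed.

Lemma exp_sum_cvg z (e : R) : 0 < e ->
  exists N, forall n, (N <= n)%N -> `|exp_sum n z - cexp z| <= e%:C.
Proof.
case: z => a b e0.
have h1 := @cvg_exp_sum a; have h2 : series (cos_coeff b) n @[n --> \oo] --> cos b.
  by rewrite cos.unlock; exact: is_cvg_series_cos_coeff.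
have h3 : series (sin_coeff b) n @[n --> \oo] --> sin b.
  by rewrite sin.unlock; exact: is_cvg_series_sin_coeff.
have h4 : exp_sum n `|a| * exp_sum n `|b| - exp_sum n (`|a| + `|b|) @[n --> \oo] --> 0.
  rewrite -[X in _ --> X](subrr (expR (`|a| + `|b|))) [X in _ --> X - _]expRD.
  by apply: cvgB; [|exact: cvg_exp_sum]; apply: cvgM; exact: cvg_exp_sum.
have h5 : exp_sum n a * series (cos_coeff b) n @[n --> \oo] --> expR a * cos b.
  exact: cvgM.
have h6 : exp_sum n a * series (sin_coeff b) n @[n --> \oo] --> expR a * sin b.
  exact: cvgM.
have e3 : 0 < e / 3 by rewrite divr_gt0.
move/cvgrPdist_le/(_ _ e3) : h4 => h4.
move/cvgrPdist_le/(_ _ e3) : h5 => h5.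
move/cvgrPdist_le/(_ _ e3) : h6 => h6.
have [N _ NP] := filterI h4 (filterI h5 h6).
exists N => n /NP[/= h7 [h8 h9]].
rewrite -(subrK (exp_sum n a%:C * exp_sum n ('i * b%:C)) (exp_sum n _)) -addrA.
apply: le_trans (ler_normD _ _) _.
have -> : e = e / 3 + (e / 3 + e / 3) by field.
rewrite rmorphD; apply: lerD.
  apply: le_trans (exp_sum_tail _ _ _) _; rewrite lecR.
  by rewrite -normrN sub0r opprK in h7; exact: le_trans (ler_norm _) h7.
have -> : exp_sum n a%:C * exp_sum n ('i * b%:C) - cexp (a +i* b) =
    (exp_sum n a * series (cos_coeff b) n - expR a * cos b) +i*
    (exp_sum n a * series (sin_coeff b) n - expR a * sin b).
  by rewrite exp_sum_real exp_sum_imag /cexp /=; simpc.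
apply: le_trans (norm_le_ReIm _) _.
by rewrite lecR lerD//= distrC.
Qed.

End ComplexExponential.
(** * Exponential vectors in Fock space *)

Section SignPolarization.
Variables (F : comNzRingType) (k : nat) (b : 'I_k -> 'I_k -> F).

(** The sum factors over j, with exponent 1 plus the number of preimages of j under f. If f misses
    some j, the two signs at j cancel; if f is injective, it is bijective and each factor is a sum
    of two squares of signs. *)
Lemma sign_sum (f : {ffun 'I_k -> 'I_k}) :
  \sum_(e : {ffun 'I_k -> bool}) (\prod_j (-1) ^+ e j) * \prod_i (-1) ^+ e (f i) =
  (2 ^ k)%:R *+ injectiveb f :> F.
Proof.
transitivity (\sum_(e : {ffun 'I_k -> bool})
    \prod_j ((-1) ^+ e j * \prod_(i | f i == j) (-1) ^+ e j : F)).
  apply: eq_bigr => e _; rewrite big_split /=; congr (_ * _).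
  rewrite (partition_big f xpredT)//=; apply: eq_bigr => j _.
  by apply: eq_bigr => i /eqP ->.
rewrite -(bigA_distr_bigA (fun j (c : bool) =>
  (-1) ^+ c * \prod_(i | f i == j) (-1) ^+ c)).
have [finj|finj] := boolP (injectiveb f).
  rewrite mulr1n natrX -[X in _ ^+ X](card_ord k) -prodr_const.
  apply: eq_bigr => j _; rewrite big_bool /=.
  rewrite (big_pred1 (invF (injectiveP _ finj) j)) => [|i /=]; last first.
    by apply/eqP/eqP => [<-|->]; rewrite ?invF_f ?f_invF.
  rewrite (big_pred1 (invF (injectiveP _ finj) j)) => [|i /=]; last first.
    by apply/eqP/eqP => [<-|->]; rewrite ?invF_f ?f_invF.
  by rewrite !expr1 !expr0 mulrNN !mulr1.
rewrite mulr0n; have [j jf] : exists j, j \notin codom f.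
  apply/existsP; apply: contraNT finj => /existsPn fs.
  apply/card_uniqP; rewrite size_codom; apply: eq_card => j.
  by rewrite inE; move: (fs j); rewrite negbK.
have fj : (fun i => f i == j) =1 xpred0.
  by move=> i; apply: contraNF jf => /eqP <-; exact: codom_f.
rewrite (bigD1 j)//= big_bool /= !(big_pred0 _ _ _ _ fj).
by rewrite expr1 expr0 !mulr1 addNr mul0r.
Qed.

(* Glynn's formula for the permanent.  For a Gram matrix it expresses a
   symmetrized tensor by tensor powers. *)
Lemma permanent_polarization :
  \sum_(e : {ffun 'I_k -> bool}) (\prod_j (-1) ^+ e j) *
     \prod_i \sum_j (-1) ^+ e j * b j i =
  (2 ^ k)%:R * \sum_(s : 'S_k) \prod_i b (s i) i.
Proof.
transitivity (\sum_(f : {ffun 'I_k -> 'I_k}) (\prod_i b (f i) i) *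
   ((2 ^ k)%:R *+ injectiveb f)).
  transitivity (\sum_(e : {ffun 'I_k -> bool}) \sum_(f : {ffun 'I_k -> 'I_k})
      (\prod_i b (f i) i) * ((\prod_j (-1) ^+ e j) * \prod_i (-1) ^+ e (f i))).
    apply: eq_bigr => e _.
    rewrite (bigA_distr_bigA (fun i j => (-1) ^+ e j * b j i)) mulr_sumr.
    apply: eq_bigr => f _.
    have -> : \big[*%R/1]_i ((-1) ^+ e (f i) * b (f i) i) =
        (\prod_i (-1) ^+ e (f i)) * \prod_i b (f i) i by rewrite -big_split.
    by rewrite mulrA mulrC.
  rewrite exchange_big; apply: eq_bigr => f _ /=.
  by rewrite -mulr_sumr sign_sum.
rewrite (bigID (fun f : {ffun 'I_k -> 'I_k} => injectiveb f)) /= addrC big1 ?add0r; last first.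
  by move=> f /negPf ->; rewrite mulr0n mulr0.
(* The injective maps of ['I_k] to itself are the underlying functions of the permutations. *)
rewrite (reindex (@pval _)) /=; last first.
  pose in_Sk := insubd (1%g : 'S_k).
  by exists in_Sk => /= f Uf; first apply: val_inj; exact: insubdK.
rewrite mulr_sumr; apply: eq_big => [s|s _]; first by rewrite (valP s).
by rewrite (valP s) mulr1n mulrC pvalE.
Qed.

End SignPolarization.
Section FockTheory.
Context {R : realType}.
Variables (H : hilbertType R) (F : fockSpace H).
Local Notation T k := (fock_tensor F k).

Lemma sym_powerP k (a : R[i]) (s t : T k) :
  sym_power s -> sym_power t -> sym_power (a *: s + t).
Proof. exact: (closed_spanP a). Qed.

Lemma sym_power0 k : sym_power (0 : T k).
Proof. exact: (@closed_span0 _ _ (range (sym_tensor (T k)))). Qed.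

(** The defect [D] of linearity is orthogonal to every [fock_in w] with [w] symmetric, and is itself
    a combination of such vectors. *)
Lemma fock_inP k (a : R[i]) (s t : T k) : sym_power s -> sym_power t ->
  fock_in (a *: s + t) = a *: fock_in s + fock_in t :> F.
Proof.
move=> Ss St; have Sst := sym_powerP a Ss St.
apply/eqP; rewrite -subr_eq0; apply/eqP.
set D := fock_in _ - _.
have DE (w : T k) : sym_power w -> dot D (fock_in w) = 0.
  move=> Sw; rewrite /D dotDl dotNl dotDl dotZl !dot_fock_in//.
  by rewrite dotDl dotZl subrr.
have : dot D D = 0.
  by rewrite {2}/D dotDr dotNr dotDr dotZr !DE// mulr0 addr0 subrr.
by rewrite dot_norm => /eqP; rewrite sqrf_eq0 normr_eq0 => /eqP.
Qed.

Lemma fock_in0 k : fock_in (0 : T k) = 0 :> F.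
Proof.
have S0 := @sym_power0 k.
by have := fock_inP (-1) S0 S0; rewrite scaler0 addr0 scaleN1r addNr.
Qed.

Lemma fock_inZ k (a : R[i]) (s : T k) : sym_power s ->
  fock_in (a *: s) = a *: fock_in s :> F.
Proof.
have S0 := @sym_power0 k.
by move=> Ss; have := fock_inP a Ss S0; rewrite !addr0 fock_in0 addr0.
Qed.

Lemma fock_in_sum k (I : finType) (a : I -> R[i]) (s : I -> T k) :
  (forall i, sym_power (s i)) ->
  fock_in (\sum_i a i *: s i) = \sum_i a i *: fock_in (s i) :> F.
Proof.
move=> Ss.
suff [] : sym_power (\sum_i a i *: s i) /\
  fock_in (\sum_i a i *: s i) = \sum_i a i *: fock_in (s i) :> F by [].
elim/big_rec2: _ => [|i x y _ [Sx xE]].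
  by rewrite fock_in0; split=> //; exact: sym_power0.
by split; [exact: sym_powerP|rewrite fock_inP// xE].
Qed.

Lemma fock_in_dist k (s t : T k) : sym_power s -> sym_power t ->
  rnorm (fock_in s - fock_in t : F) = rnorm (s - t).
Proof.
move=> Ss St.
have Sst : sym_power (s - t) by rewrite addrC -scaleN1r; exact: sym_powerP.
have -> : fock_in s - fock_in t = fock_in (s - t) :> F.
  by rewrite [s - t]addrC -(scaleN1r t) (fock_inP (-1) St Ss) scaleN1r addrC.
apply/eqP; rewrite -(@eqrXn2 _ 2)// ?rnorm_ge0//.
by rewrite -!rdotxx /rdot dot_fock_in.
Qed.

Lemma sym_power_sym_tensor k v : sym_power (sym_tensor (T k) v).
Proof. by apply: (@closed_span_sub _ _ (range (sym_tensor (T k)))); exists v. Qed.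

Lemma sym_tensor_const k x : sym_tensor (T k) (fun=> x) = tensor_exp F k x.
Proof.
rewrite /sym_tensor (_ : \sum_(s : 'S_k) _ = tensor_exp F k x *+ k`!); last first.
  by rewrite (eq_bigr (fun=> tensor_exp F k x))// -card_Sn -sumr_const; apply: eq_bigl.
rewrite -[tensor_exp F k x *+ _](@scaler_nat R[i]) scalerA mulVf ?scale1r//.
Qed.

Lemma sym_power_tensor_exp k x : sym_power (tensor_exp F k x).
Proof. by rewrite -sym_tensor_const; exact: sym_power_sym_tensor. Qed.

Lemma dot_tensor_exp k x y : dot (tensor_exp F k x) (tensor_exp F k y) = dot x y ^+ k.
Proof. by rewrite dot_tensor prodr_const card_ord. Qed.

Lemma tensor_expZ k (a : R[i]) x : tensor_exp F k (a *: x) = a ^+ k *: tensor_exp F k x.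
Proof.
apply: (total_dot_ext (tensor_total (T k))) => _ [w _ <-].
rewrite dotZl !dot_tensor; under eq_bigr do rewrite dotZl.
by rewrite big_split prodr_const card_ord.
Qed.

(** All degrees share one index type, so that [gram_isometry] applies to the whole Fock space at
    once. *)
Lemma fock_sym_total : closed_span (range (fun p : {k & 'I_k -> H} =>
  fock_in (sym_tensor (T (tag p)) (tagged p)) : F)) = setT.
Proof.
rewrite -subTset -(fock_total F); apply: closed_span_le => _ [k _ [t St <-]].
set E := closed_span _.
(* The predicate includes [sym_power t] because linearity and isometry of [fock_in] are available
   only there. *)
suff : closed_span (range (sym_tensor (T k))) `<=`
  [set t | sym_power t /\ E (fock_in t)] by move=> /(_ _ St)[].
apply: closed_span_ind.
- apply/closedP_adherent => x Wx.
  have Sx : sym_power x.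
    apply: (@closed_span_adherent _ _ (range (sym_tensor (T k)))) => e e0.
    by have [y [Sy _] xy] := Wx _ e0; exists y.
  split=> //; apply: (@closed_span_adherent _ F) => e e0.
  have [y [Sy Ey] xy] := Wx _ e0; exists (fock_in y) => //.
  by rewrite fock_in_dist.
- by split; [exact: sym_power0|rewrite fock_in0; exact: closed_span0].
- move=> a x y [Sx Ex] [Sy Ey]; split; first exact: sym_powerP.
  by rewrite fock_inP//; exact: (closed_spanP a Ex Ey).
- move=> _ [v _ <-]; split; first exact: sym_power_sym_tensor.
  by apply: (@closed_span_sub _ F); exists (Tagged (fun k => 'I_k -> H) v).
Qed.

Definition exp_term k (x : H) : F :=
  ((Num.sqrt k`!%:R)^-1)%:C *: fock_in (tensor_exp F k x).

Definition exp_partial n (x : H) : F := \sum_(0 <= k < n) exp_term k x.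

Lemma dot_exp_term j k x y :
  dot (exp_term j x) (exp_term k y) = dot x y ^+ k / k`!%:R *+ (j == k).
Proof.
rewrite /exp_term dotZl dotZr.
have [<-{k}|jk] := eqVneq j k; last first.
  rewrite fock_in_orth ?mulr0n ?mulr0//; exact: sym_power_tensor_exp.
rewrite dot_fock_in ?dot_tensor_exp; try exact: sym_power_tensor_exp.
rewrite mulrA mulrC mulr1n; congr (_ * _).
rewrite -[Num.conj _]/(_^-1 +i* - 0) oppr0 -rmorphM -invfM -expr2 sqr_sqrtr//.
by rewrite fmorphV rmorph_nat.
Qed.

Lemma dot_exp_partial n x y :
  dot (exp_partial n x) (exp_partial n y) = exp_sum n (dot x y).
Proof.
rewrite /exp_partial dot_suml big_mkord; apply: eq_bigr => j _.
rewrite dot_sumr big_mkord (bigD1 j)//= dot_exp_term eqxx mulr1n big1 ?addr0//.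
by move=> k kj; rewrite dot_exp_term eq_sym val_eqE (negPf kj).
Qed.

Lemma rnorm_exp_partialB m n x : (m <= n)%N ->
  rnorm (exp_partial n x - exp_partial m x) ^+ 2 =
  exp_sum n (rnorm x ^+ 2) - exp_sum m (rnorm x ^+ 2).
Proof.
move=> mn; rewrite -rdotxx /rdot /exp_partial.
have -> : \sum_(0 <= k < n) exp_term k x - \sum_(0 <= k < m) exp_term k x =
    \sum_(m <= k < n) exp_term k x.
  by apply/eqP; rewrite subr_eq addrC; apply/eqP; exact: big_cat_nat.
rewrite dot_suml; under eq_big_nat => j /andP[mj jn].
  rewrite dot_sumr (bigD1_seq j) ?mem_index_iota ?mj ?jn ?iota_uniq//=.
  rewrite dot_exp_term eqxx mulr1n big1_seq ?addr0; last first.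
    by move=> k /andP[kj _]; rewrite dot_exp_term eq_sym (negPf kj).
  rewrite dot_norm -rnormE -rmorphXn -rmorphXn -(rmorph_nat (real_complex R)) -fmorphV -rmorphM.
  over.
rewrite -rmorph_sum /= /exp_sum -!(big_mkord xpredT (fun k => (rnorm x ^+ 2) ^+ k / k`!%:R)).
by apply/esym/eqP; rewrite subr_eq addrC; apply/eqP; exact: big_cat_nat.
Qed.

Lemma exp_sum_le_expR n (a : R) : 0 <= a -> exp_sum n a <= expR a.
Proof.
move=> a0; have := @cvg_exp_sum R a.
rewrite exp_sum_seriesE => h; rewrite -[exp_sum n a]/((fun n => exp_sum n a) n) exp_sum_seriesE.
have := nondecreasing_cvgn_le _ (cvgP _ h) n; rewrite (cvg_lim _ h)//; apply.
by apply: nondecreasing_series => k _ _; exact: exp_coeff_ge0.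
Qed.

Lemma exp_partial_cauchy x (e : R) : 0 < e ->
  exists N, forall m n, (N <= m)%N -> (m <= n)%N ->
    rnorm (exp_partial n x - exp_partial m x) <= e.
Proof.
move=> e0; have e2 : 0 < e ^+ 2 by rewrite exprn_gt0.
have := @cvg_exp_sum R (rnorm x ^+ 2).
move=> /cvgrPdist_le/(_ _ e2)[N _ NP]; exists N => m n Nm mn.
rewrite -(@ler_pXn2r _ 2)// ?nnegrE ?rnorm_ge0 ?(ltW e0)//.
rewrite rnorm_exp_partialB//.
have n0 : 0 <= rnorm x ^+ 2 by rewrite exprn_ge0 ?rnorm_ge0.
apply: le_trans (NP m Nm).
rewrite ger0_norm ?subr_ge0 ?exp_sum_le_expR//.
by rewrite lerB ?exp_sum_le_expR.
Qed.

Lemma exp_vector_cvg x (e : R) : 0 < e -> exists N, forall n, (N <= n)%N ->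
  rnorm (exp_partial n x - exp_vector F x) <= e.
Proof.
move=> e0; set u := fun n => exp_partial n x.
have cu : cvg (u @ \oo).
  apply/cauchy_cvgP; apply: cauchy_real => d d0.
  have d2 : 0 < d / 2 by rewrite divr_gt0.
  have [N NP] := exp_partial_cauchy x d2; exists (u N); exists N => // n /= Nn.
  rewrite rnorm_distC; apply: le_lt_trans (NP N n _ _) _ => //.
  by rewrite ltr_pdivrMr// mulrDr mulr1 ltrDl.
have e0C : 0 < e%:C by rewrite ltcR.
have [N _ NP] := (@fcvgrPdist_lt _ _ _ _ _).1 cu _ e0C.
exists N => n /NP /=; rewrite -rnormE ltcR rnorm_distC.
exact: ltW.
Qed.

Lemma rnorm_exp_partial_le n x : rnorm (exp_partial n x) <= Num.sqrt (expR (rnorm x ^+ 2)).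
Proof.
have n0 : 0 <= rnorm x ^+ 2 by rewrite exprn_ge0 ?rnorm_ge0.
rewrite -(@ler_pXn2r _ 2)// ?nnegrE ?rnorm_ge0 ?sqrtr_ge0//.
rewrite sqr_sqrtr ?expR_ge0// -(rdotxx (exp_partial n x)) /rdot dot_exp_partial dot_norm -rnormE.
by rewrite -rmorphXn exp_sum_real exp_sum_le_expR.
Qed.

Lemma dot_exp_vector x y : dot (exp_vector F x) (exp_vector F y) = cexp (dot x y).
Proof.
pose M := Num.sqrt (expR (rnorm x ^+ 2)) + rnorm (exp_vector F y) + 1.
have M0 : 0 <= M by rewrite /M !addr_ge0 ?sqrtr_ge0 ?rnorm_ge0.
apply/eqP; rewrite -subr_eq0; apply/eqP; apply: (complex_small M0) => e e0.
have [N1 h1] := exp_vector_cvg x e0; have [N2 h2] := exp_vector_cvg y e0.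
have [N3 h3] := exp_sum_cvg (dot x y) e0.
pose n := maxn N1 (maxn N2 N3).
have {}h1 := h1 n (leq_maxl _ _).
have {}h2 : rnorm (exp_partial n y - exp_vector F y) <= e.
  by apply: h2; rewrite !leq_max leqnn orbT.
have {}h3 : `|exp_sum n (dot x y) - cexp (dot x y)| <= e%:C.
  by apply: h3; rewrite !leq_max leqnn !orbT.
set a := exp_vector F x in h1 *; set b := exp_vector F y in M M0 h2 *.
have -> : dot a b - cexp (dot x y) = - dot (exp_partial n x - a) b -
   dot (exp_partial n x) (exp_partial n y - b) + (exp_sum n (dot x y) - cexp (dot x y)).
  by rewrite -dot_exp_partial dotDl dotDr !dotNl !dotNr; ring.
apply: le_trans (ler_normD _ _) _.
rewrite /M !mulrDr mulr1 rmorphD lerD//.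
apply: le_trans (ler_normD _ _) _; rewrite !normrN addrC.
rewrite rmorphD lerD//; apply: le_trans (dot_cauchy _ _) _; rewrite lecR.
  by rewrite mulrC ler_pM ?rnorm_ge0 ?rnorm_exp_partial_le.
by rewrite ler_wpM2r ?rnorm_ge0.
Qed.

Lemma exp_partial_recr n x : exp_partial n.+1 x = exp_partial n x + exp_term n x.
Proof. by rewrite /exp_partial big_nat_recr. Qed.

Lemma exp_termZ k (t : R) x : exp_term k (t%:C *: x) = (t ^+ k)%:C *: exp_term k x.
Proof.
rewrite /exp_term tensor_expZ fock_inZ; last exact: sym_power_tensor_exp.
by rewrite !scalerA -rmorphXn mulrC.
Qed.

Lemma rnormZ_real (V : completeNormedModType R[i]) (t : R) (x : V) :
  0 <= t -> rnorm (t%:C *: x) = t * rnorm x.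
Proof. by move=> t0; rewrite rnormZ ger0_norm ?ler0c. Qed.

(** For t <= 1, the squared norm of the term of degree i >= k at [t x] is at most t^(2k) times that
    at [x]. *)
Lemma exp_vector_tail k x (t : R) : 0 < t -> t <= 1 ->
  rnorm (exp_vector F (t%:C *: x) - exp_partial k (t%:C *: x)) <=
  t ^+ k * Num.sqrt (expR (rnorm x ^+ 2)).
Proof.
move=> t0 t1; set y := t%:C *: x.
have n0 : 0 <= rnorm x ^+ 2 by rewrite exprn_ge0 ?rnorm_ge0.
apply/ler_addgt0Pr => e e0; have [N NP] := exp_vector_cvg y e0.
pose n := maxn N k.
apply: le_trans (rnorm_dist_trans (exp_partial n y) _ _) _.
rewrite addrC lerD//; last first.
  by rewrite rnorm_distC; apply: NP; exact: leq_maxl.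
have kn : (k <= n)%N by exact: leq_maxr.
rewrite -(@ler_pXn2r _ 2)// ?nnegrE ?rnorm_ge0 ?mulr_ge0 ?sqrtr_ge0 ?exprn_ge0 ?(ltW t0)//.
rewrite rnorm_exp_partialB// exprMn sqr_sqrtr ?expR_ge0//.
rewrite /y (rnormZ_real x (ltW t0)) exprMn.
rewrite /exp_sum -!(big_mkord xpredT (fun k => (t ^+ 2 * rnorm x ^+ 2) ^+ k / k`!%:R)).
rewrite lerBlDl (big_cat_nat (leq0n k) kn) /= lerD2l.
apply: (@le_trans _ _ (\sum_(k <= i < n) (t ^+ k) ^+ 2 * ((rnorm x ^+ 2) ^+ i / i`!%:R))).
  apply: ler_sum_nat => i /andP[ki _].
  rewrite exprMn mulrA; apply: ler_wpM2r; first by rewrite invr_ge0.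
  apply: ler_wpM2r; first exact: exprn_ge0.
  rewrite -exprM mulnC exprM.
  by rewrite ler_wiXn2l ?exprn_ge0 ?exprn_ile1 ?(ltW t0).
rewrite -mulr_sumr ler_wpM2l ?exprn_ge0 ?(ltW t0)//.
apply: le_trans (exp_sum_le_expR n n0).
rewrite /exp_sum -(big_mkord xpredT (fun k => (rnorm x ^+ 2) ^+ k / k`!%:R)).
rewrite [leRHS](big_cat_nat (leq0n k) kn) /= lerDr sumr_ge0// => i _.
by rewrite divr_ge0 ?(exprn_ge0 _ n0).
Qed.

(* The k-th tensor power of x is, up to a scalar, the limit as t tends to 0 of
   the k-th Taylor remainder of t |-> e(t x) divided by t^k. *)
Lemma fock_tensor_exp_span k x :
  closed_span (range (exp_vector F)) (fock_in (tensor_exp F k x)).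
Proof.
set W := closed_span _.
elim/ltn_ind: k x => k IH x.
(* By induction the Taylor terms of degree below [k] may be subtracted without leaving the span. *)
have partW y : W (exp_partial k y).
  rewrite /exp_partial big_mkord; apply: closed_span_sum => j _.
  by apply: closed_spanZ; exact: IH.
suff Wk : W (exp_term k x).
  have -> : fock_in (tensor_exp F k x) = (Num.sqrt k`!%:R)%:C *: exp_term k x.
    by rewrite /exp_term scalerA -rmorphM mulfV ?rmorph1 ?scale1r.
  exact: closed_spanZ.
apply: closed_span_adherent => e e0.
pose C := Num.sqrt (expR (rnorm x ^+ 2)).
have C0 : 0 <= C by exact: sqrtr_ge0.
(* The remainder after degree [k] is at most t^(k+1) C; division by t^k leaves t C, which is less
   than [e]. *)
pose t := Num.min 1 (e / (C + 1)).
have C1 : 0 < C + 1 by rewrite ltr_wpDl.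
have t0 : 0 < t by rewrite lt_min ltr01 divr_gt0.
have t1 : t <= 1 by rewrite ge_min lexx.
exists ((t ^- k)%:C *: (exp_vector F (t%:C *: x) - exp_partial k (t%:C *: x))).
  apply: closed_spanZ; rewrite addrC -scaleN1r; apply: closed_spanP; first exact: partW.
  by apply: closed_span_sub; exists (t%:C *: x).
have -> : exp_term k x = (t ^- k)%:C *: exp_term k (t%:C *: x).
  by rewrite exp_termZ scalerA -rmorphM mulVf ?rmorph1 ?scale1r// expf_neq0 ?gt_eqF.
rewrite -scalerBr opprB addrA (addrC (exp_term _ _)) -exp_partial_recr rnormZ_real; last first.
  by rewrite invr_ge0 exprn_ge0 ?ltW.
rewrite mulrC ltr_pdivrMr ?exprn_gt0// rnorm_distC.
apply: le_lt_trans (exp_vector_tail _ _ _ _) _ => //.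
rewrite -/C exprSr -mulrA [e * _]mulrC ltr_pM2l ?exprn_gt0//.
apply: (@le_lt_trans _ _ (e / (C + 1) * C)).
  by rewrite ler_wpM2r// ge_min lexx orbT.
by rewrite -mulrA gtr_pMr// mulrC ltr_pdivrMr// mul1r ltrDl ltr01.
Qed.

(** Tested against elementary tensors, both sides become the two forms of a permanent in
    [permanent_polarization]. *)
Lemma sym_tensor_polarization k (v : 'I_k -> H) :
  sym_tensor (T k) v = \sum_(e : {ffun 'I_k -> bool})
    (((2 ^ k * k`!)%:R)^-1 * \prod_j (-1) ^+ e j) *:
      tensor_exp F k (\sum_j (-1) ^+ e j *: v j).
Proof.
apply: (total_dot_ext (tensor_total (T k))) => _ [w _ <-].
rewrite /sym_tensor dotZl !dot_suml.
rewrite (eq_bigr (fun s : 'S_k => \prod_i dot (v (s i)) (w i))); last first.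
  by move=> s _; rewrite dot_tensor.
transitivity (((2 ^ k * k`!)%:R)^-1 * \sum_(e : {ffun 'I_k -> bool})
  (\prod_j (-1) ^+ e j) * \prod_i \sum_j (-1) ^+ e j * dot (v j) (w i)); last first.
  rewrite mulr_sumr; apply: eq_bigr => e _; rewrite dotZl -mulrA dot_tensor.
  congr (_ * (_ * _)); apply: eq_bigr => i _.
  by rewrite dot_suml; apply: eq_bigr => j _; rewrite dotZl.
rewrite permanent_polarization mulrA; congr (_ * _).
rewrite natrM invfM mulrAC mulVf ?mul1r//.
Qed.

Lemma exp_vector_total : closed_span (range (exp_vector F)) = setT.
Proof.
rewrite -subTset -fock_sym_total; apply: closed_span_le => _ [[k v] _ <-] /=.
rewrite sym_tensor_polarization fock_in_sum => [|e]; last exact: sym_power_tensor_exp.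
by apply: closed_span_sum => e _; apply: closed_spanZ; exact: fock_tensor_exp_span.
Qed.

End FockTheory.
(** * Weyl operators *)

Section Unitaries.
Context {R : realType}.
Variable H : hilbertType R.

(** For an isometry with right inverse W', <W x, y> = <W x, W W' y> = <x, W' y>, so the right
    inverse is the adjoint. *)
Lemma unitary_isometric (W W' : bop H) :
  (forall x y, dot (W x) (W y) = dot x y) -> (forall x, W (W' x) = x) ->
  unitary W /\ star W = W'.
Proof.
move=> Wd WW'.
have aW : bop_adj W = W'.
  by apply: bop_adj_uniq => x y; rewrite -{1}[y]WW' Wd.
split; last exact: aW.
split; last by rewrite /star/= aW; apply: bopP => x; exact: WW'.
apply: bopP => x; apply: dot_ext => y.
by rewrite /cmul /star /= -bop_adjP Wd.
Qed.

Lemma isometric_bop (W : H -> H) : isometric W -> exists T : bop H, forall x, T x = W x.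
Proof.
by move=> /isometric_bounded bW; exists (Bop (asboolT bW : W \in @bop_pred _ H)).
Qed.

End Unitaries.

Section Weyl.
Context {R : realType}.
Variables (H : hilbertType R) (F : fockSpace H).

Definition weyl_factor (z x : H) : R[i] := cexp (- (`|z| ^+ 2 / 2) - dot x z).

Lemma half_sqr_norm (z : H) : `|z| ^+ 2 / 2 = (rnorm z ^+ 2 / 2)%:C.
Proof. by rewrite -rnormE rmorphM rmorphXn fmorphV rmorph_nat. Qed.

Lemma conj_real (a : R) : Num.conj a%:C = a%:C :> R[i].
Proof. by rewrite -[LHS]/(a +i* - 0) oppr0. Qed.

Lemma weyl_isometry_ex z : exists T : bop F,
  (forall x y, dot (T x) (T y) = dot x y) /\
  forall x, T (exp_vector F x) = weyl_factor z x *: exp_vector F (z + x).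
Proof.
have [||W [iW WE]] := @gram_isometry _ F F _ (exp_vector F)
    (fun x => weyl_factor z x *: exp_vector F (z + x)).
- move=> x y; rewrite dotZl dotZr !dot_exp_vector /weyl_factor conj_cexp -!cexpD.
  congr cexp; rewrite !dotDl !dotDr rmorphB rmorphN /= -dotC half_sqr_norm conj_real.
  rewrite dot_norm -rnormE.
  have -> : (rnorm z)%:C ^+ 2 = (rnorm z ^+ 2 / 2)%:C + (rnorm z ^+ 2 / 2)%:C.
    by rewrite -rmorphD -rmorphXn; congr (_%:C); field.
  ring.
- exact: exp_vector_total.
have [T TW] := isometric_bop iW; exists T; split=> [x y|x]; rewrite !TW ?WE//.
by case: iW => _ ->.
Qed.

Lemma is_weyl_ex z : exists W : bop F, is_weyl z W.
Proof.
have [W [Wd WE]] := weyl_isometry_ex z.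
have [W' [W'd W'E]] := weyl_isometry_ex (- z).
exists W; split=> //.
have WW' : forall x, W (W' x) = x.
  have : bop_mul W W' = bop_one F.
    apply: (bop_total_eq (exp_vector_total F)) => _ [x _ <-] /=.
    rewrite W'E linearZ /= WE scalerA addrA subrr add0r -cexpD.
    rewrite normrN dotNr dotDl dotNl dot_norm opprK.
    set a := `|z| ^+ 2; set b := dot x z.
    have -> : - (a / 2) + b + (- (a / 2) - (- a + b)) = 0 by field.
    by rewrite cexp0 scale1r.
  by move=> E x; have := congr1 (fun T : bop F => T x) E.
by have [] := unitary_isometric Wd WW'.
Qed.

Lemma weylP z : is_weyl z (weyl F z).
Proof. by have [W WP] := is_weyl_ex z; exact: (xgetPex 0 (ex_intro _ W WP)). Qed.

Lemma weyl_exp z x :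
  weyl F z (exp_vector F x) = weyl_factor z x *: exp_vector F (z + x).
Proof. by have [_] := weylP z; apply. Qed.

Lemma weyl_comm z w : cmul (weyl F z) (weyl F w) =
  cexp (dot z w - dot w z) *: cmul (weyl F w) (weyl F z).
Proof.
apply: (bop_total_eq (exp_vector_total F)) => _ [x _ <-].
rewrite bopZE /cmul /= !weyl_exp !linearZ /= !weyl_exp !scalerA.
rewrite (addrCA w z); congr (_ *: _).
rewrite /weyl_factor -!cexpD; congr cexp; rewrite !dotDl; ring.
Qed.

Lemma weyl_torus (d : nat) (Theta : 'M[R]_d) (z : 'I_d -> H) :
  (forall k l, 2 * complex.Im (dot (z l) (z k)) = Theta k l) ->
  torus_rel Theta (fun k => weyl F (z k)).
Proof.
move=> zT; split=> [k|k l]; first by have [] := weylP (z k).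
rewrite weyl_comm; congr (cexp _ *: _).
rewrite -zT (dotC (z l) (z k)); case: (dot (z l) (z k)) => a b.
rewrite conjE; apply/eqP; rewrite eq_complex /=.
by apply/andP; split; apply/eqP; ring.
Qed.

End Weyl.

(** * Inclusions of Fock spaces and compressions of Weyl operators *)

Section WeylCompression.
Context {R : realType}.
Variables (H K : hilbertType R) (iota : H -> K).
Hypothesis iota_iso : isometric iota.
Variables (FH : fockSpace H) (FK : fockSpace K).

Lemma fock_inclusion_ex : exists J : FH -> FK, fock_inclusion iota J.
Proof.
pose e (p : {k & 'I_k -> H}) : FH := fock_in (sym_tensor (fock_tensor FH (tag p)) (tagged p)).
pose f (p : {k & 'I_k -> H}) : FK :=
  fock_in (sym_tensor (fock_tensor FK (tag p)) (iota \o tagged p)).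
have [||J [iJ JE]] := @gram_isometry _ FH FK _ e f.
- move=> [j v] [k w]; rewrite /e /f /=.
  have [jk|jk] := eqVneq j k; last first.
    by rewrite !fock_in_orth//; exact: sym_power_sym_tensor.
  subst k; rewrite !dot_fock_in; try exact: sym_power_sym_tensor.
  rewrite /sym_tensor !dotZl !dotZr; congr (_ * (_ * _)).
  rewrite !dot_suml; apply: eq_bigr => s _; rewrite !dot_sumr; apply: eq_bigr => t _.
  by rewrite !dot_tensor; apply: eq_bigr => i _; exact: iota_iso.2.
- exact: fock_sym_total.
by exists J; split=> // k v; exact: (JE (Tagged (fun k => 'I_k -> H) v)).
Qed.

Variable J : FH -> FK.
Hypothesis JP : fock_inclusion iota J.

(** [J] is prescribed on symmetrized tensors only, hence on partial sums of the exponential series;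
    continuity gives the limit. *)
Lemma fock_inclusion_exp x : J (exp_vector FH x) = exp_vector FK (iota x).
Proof.
have [iJ JE] := JP.
have Jpart n : J (exp_partial FH n x) = exp_partial FK n (iota x).
  elim: n => [|n IH]; first by rewrite /exp_partial !big_geq// (lfun0 iJ.1).
  rewrite !exp_partial_recr addrC -[X in X + _]scale1r iJ.1 scale1r IH addrC; congr (_ + _).
  rewrite /exp_term (lfunZ _ _ iJ.1) -!sym_tensor_const JE.
  by [].
apply/eqP; rewrite -subr_eq0; apply/eqP; apply: (@rnorm_small _ _ _ 2) => // e e0.
have [N1 h1] := exp_vector_cvg FH x e0.
have [N2 h2] := exp_vector_cvg FK (iota x) e0.
apply: le_trans (rnorm_dist_trans (exp_partial FK (maxn N1 N2) (iota x)) _ _) _.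
rewrite mulr_natr mulr2n lerD//; last by apply: h2; exact: leq_maxr.
rewrite -Jpart -(lfunB _ _ iJ.1) (isometric_rnorm _ iJ) rnorm_distC.
by apply: h1; exact: leq_maxl.
Qed.

(** The hypothesis says that [iota x] is the projection of [z], so |z|^2 - |x|^2 is the squared norm
    of the orthogonal component: the constant is the ratio of the two Gaussian factors in the Weyl
    operators. *)
Lemma weyl_compression (z : K) (x : H) :
  (forall g, dot z (iota g) = dot x g) ->
  is_compression J (weyl FH x)
    ((expR ((rnorm z ^+ 2 - rnorm x ^+ 2) / 2))%:C *: weyl FK z).
Proof.
move=> zx h; have [iJ _] := JP.
set c := expR _; apply/esym/orthproj_range => // g.
have EE w y : dot (weyl FK z (J (exp_vector FH w))) (J (exp_vector FH y)) =
    c^-1%:C * dot (weyl FH x (exp_vector FH w)) (exp_vector FH y).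
  rewrite !fock_inclusion_exp !weyl_exp !dotZl !dot_exp_vector.
  rewrite /c -expRN -cexpR /weyl_factor -!cexpD; congr cexp.
  rewrite !dotDl iota_iso.2 zx !half_sqr_norm.
  rewrite (dotC z (iota w)) zx -dotC -mulNr opprB mulrBl rmorphB; ring.
(* The identity [EE] is extended from exponential vectors one argument at a time; passing to
   adjoints makes the first argument accessible to [total_dot_ext]. *)
have E1 f y : dot (weyl FK z (J f)) (J (exp_vector FH y)) =
    dot (c^-1%:C *: weyl FH x f) (exp_vector FH y).
  have [k [_ kE]] := orthproj_range_ex (bop_adj (weyl FK z) (J (exp_vector FH y))) iJ.
  rewrite bop_adjP dotC kE -dotC dotZl bop_adjP -[c^-1%:C]conj_real -dotZr.
  congr (dot f _); apply: (total_dot_ext (exp_vector_total FH)) => _ [w _ <-].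
  by rewrite -kE bop_adjP' dotC EE rmorphM /= conj_real -dotC dotZl bop_adjP'.
have [k [_ kE]] := orthproj_range_ex (weyl FK z (J h)) iJ.
have -> : weyl FH x h = c%:C *: k.
  suff -> : k = c^-1%:C *: weyl FH x h.
    by rewrite scalerA -rmorphM mulfV ?rmorph1 ?scale1r// gt_eqF ?expR_gt0.
  apply: (total_dot_ext (exp_vector_total FH)) => _ [y _ <-].
  by rewrite -kE E1.
by rewrite bopZE !dotZl kE.
Qed.


End WeylCompression.
(** * Sums over infinite index sets and the Hilbert space l2 *)

Section NonnegSums.
Context {R : realType}.

(** Unordered summation: the finite index sets are duplicate-free lists, and [X] need not be
    countable. *)
Definition nsummable (X : eqType) (h : X -> R) : Prop :=
  exists M, forall s, uniq s -> \sum_(x <- s) h x <= M.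

Definition nsum (X : eqType) (h : X -> R) : R :=
  sup [set \sum_(x <- s) h x | s in [set s | uniq s]].

Lemma sum_perm_le (X : eqType) (h : X -> R) (s t : seq X) :
  perm_eq s t -> \sum_(x <- s) h x <= \sum_(x <- t) h x.
Proof. by move=> st; rewrite (perm_big _ st). Qed.

Section OneIndex.
Variable X : eqType.
Implicit Types (h k : X -> R) (s : seq X).

Lemma nsum_ge h s : nsummable h -> uniq s -> \sum_(x <- s) h x <= nsum h.
Proof.
move=> [M hM] us; apply: sup_upper_bound; last by exists s.
split; first by exists (\sum_(x <- s) h x), s.
by exists M => _ [t ut <-]; exact: hM.
Qed.

Lemma nsum_le h M : (forall s, uniq s -> \sum_(x <- s) h x <= M) -> nsum h <= M.
Proof.
move=> hM; apply: ge_sup; first by exists (\sum_(x <- [::]) h x), [::].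
by move=> _ [s us <-]; exact: hM.
Qed.

Lemma nsum_ge0 h : nsummable h -> 0 <= nsum h.
Proof. by move=> hS; have := nsum_ge hS (isT : uniq [::]); rewrite big_nil. Qed.

Lemma nsum_term_le h x : nsummable h -> h x <= nsum h.
Proof. by move=> hS; have := nsum_ge hS (isT : uniq [:: x]); rewrite big_seq1. Qed.

Lemma nsum_adh h (e : R) : nsummable h -> 0 < e ->
  exists2 s, uniq s & nsum h - e < \sum_(x <- s) h x.
Proof.
move=> [M hM] e0.
have hs : has_sup [set \sum_(x <- s) h x | s in [set s | uniq s]].
  split; first by exists (\sum_(x <- [::]) h x), [::].
  by exists M => _ [t ut <-]; exact: hM.
by have [_ [s us <-] ?] := sup_adherent e0 hs; exists s.
Qed.

Lemma nsummable_dom h k : (forall x, h x <= k x) -> nsummable k -> nsummable h.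
Proof.
move=> hk [M kM]; exists M => s us; apply: le_trans (kM s us).
by apply: ler_sum.
Qed.

Lemma nsummableD h k : nsummable h -> nsummable k -> nsummable (fun x => h x + k x).
Proof.
move=> [M hM] [N kN]; exists (M + N) => s us; rewrite big_split.
by rewrite lerD ?hM ?kN.
Qed.

Lemma nsummableZ h (a : R) : 0 <= a -> nsummable h -> nsummable (fun x => a * h x).
Proof.
move=> a0 [M hM]; exists (a * M) => s us; rewrite -mulr_sumr.
by rewrite ler_wpM2l// hM.
Qed.

Lemma nsummable0 : nsummable (fun _ : X => 0 : R).
Proof. by exists 0 => s _; rewrite big1. Qed.

Lemma nsum_mono h k : (forall x, h x <= k x) -> nsummable k -> nsum h <= nsum k.
Proof.
move=> hk kS; apply: nsum_le => s us; apply: le_trans (nsum_ge kS us).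
by apply: ler_sum.
Qed.

(** Provides a common enlargement of two finite index sets without decreasing a nonnegative sum. *)
Lemma sum_catl_undup (h : X -> R) s t : (forall x, 0 <= h x) -> uniq s ->
  \sum_(x <- s) h x <= \sum_(x <- undup (s ++ t)) h x.
Proof.
move=> h0 us; rewrite [leRHS](bigID [in s]) /= -[leLHS]addr0 lerD ?sumr_ge0//.
rewrite -[leRHS]big_filter; apply: sum_perm_le; apply: uniq_perm => //.
  by rewrite filter_uniq// undup_uniq.
by move=> x; rewrite mem_filter mem_undup mem_cat; case: (x \in s).
Qed.

Lemma nsumD h k : (forall x, 0 <= h x) -> (forall x, 0 <= k x) ->
  nsummable h -> nsummable k -> nsum (fun x => h x + k x) = nsum h + nsum k.
Proof.
move=> h0 k0 hS kS; apply/eqP; rewrite eq_le; apply/andP; split.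
  by apply: nsum_le => s us; rewrite big_split lerD ?nsum_ge.
apply/ler_addgt0Pr => e e0; have e2 : 0 < e / 2 by rewrite divr_gt0.
have [s us hs] := nsum_adh hS e2; have [t ut kt] := nsum_adh kS e2.
have hs' := sum_catl_undup t h0 us.
have kt' : \sum_(x <- t) k x <= \sum_(x <- undup (s ++ t)) k x.
  apply: le_trans (sum_catl_undup s k0 ut) _; apply: sum_perm_le; apply: uniq_perm.
  - exact: undup_uniq.
  - exact: undup_uniq.
  - by move=> x; rewrite !mem_undup !mem_cat orbC.
have := nsum_ge (nsummableD hS kS) (undup_uniq (s ++ t)); rewrite big_split /=.
lra.
Qed.

Lemma nsumZ h (a : R) : 0 <= a -> nsummable h -> nsum (fun x => a * h x) = a * nsum h.
Proof.
rewrite le_eqVlt => /orP[/eqP<- _|a0 hS].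
  rewrite mul0r; apply/eqP; rewrite eq_le; apply/andP; split.
    by apply: nsum_le => s _; rewrite big1// => x _; rewrite mul0r.
  by apply: nsum_ge0; exists 0 => s _; rewrite big1// => x _; rewrite mul0r.
have aS := nsummableZ (ltW a0) hS.
apply/eqP; rewrite eq_le; apply/andP; split.
  by apply: nsum_le => s us; rewrite -mulr_sumr ler_pM2l// nsum_ge.
rewrite -ler_pdivlMl//; apply: nsum_le => s us.
by rewrite ler_pdivlMl// mulr_sumr nsum_ge.
Qed.

Lemma nsum0 : nsum (fun _ : X => 0 : R) = 0.
Proof.
apply/eqP; rewrite eq_le (nsum_ge0 nsummable0) andbT.
by apply: nsum_le => s _; rewrite big1.
Qed.

Lemma nsum_eq0 h : (forall x, 0 <= h x) -> nsummable h -> nsum h = 0 -> forall x, h x = 0.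
Proof.
by move=> h0 hS hz x; apply/eqP; rewrite eq_le h0 andbT -hz nsum_term_le.
Qed.

(* A difference of two nonnegative sums, so that additivity follows from [nsumD]. *)
Definition asummable h := nsummable (fun x => `|h x|).
Definition tsum h := nsum (fun x => `|h x| + h x) - nsum (fun x => `|h x|).

Lemma normDl_ge0 (a : R) : 0 <= `|a| + a.
Proof. by rewrite -(lerD2r (- a)) addrK add0r -normrN ler_norm. Qed.

Lemma asummable_pos h : asummable h -> nsummable (fun x => `|h x| + h x).
Proof.
move=> hS; apply: nsummable_dom (nsummableD hS hS) => x /=.
by rewrite lerD2l ler_norm.
Qed.

(** Any decomposition into nonnegative summable parts computes [tsum], not only the one in its
    definition; linearity follows from this. *)
Lemma tsum_sub h k : (forall x, 0 <= h x) -> (forall x, 0 <= k x) ->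
  nsummable h -> nsummable k -> tsum (fun x => h x - k x) = nsum h - nsum k.
Proof.
move=> h0 k0 hS kS.
have aS : asummable (fun x => h x - k x).
  apply: nsummable_dom (nsummableD hS kS) => x.
  by apply: le_trans (ler_normB _ _) _; rewrite !ger0_norm.
have pS := asummable_pos aS.
apply/eqP; rewrite subr_eq addrAC eq_sym subr_eq; apply/eqP.
rewrite -nsumD// -nsumD//; last by move=> x; exact: normDl_ge0.
by congr nsum; apply/funext => x; ring.
Qed.

Lemma tsum_nsum h : (forall x, 0 <= h x) -> nsummable h -> tsum h = nsum h.
Proof.
move=> h0 hS; have := tsum_sub h0 (fun=> lexx 0) hS nsummable0.
by rewrite nsum0 subr0 => <-; congr tsum; apply/funext => x; rewrite subr0.
Qed.

Lemma asummableZ h a : asummable h -> asummable (fun x => a * h x).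
Proof.
move=> hS; apply: nsummable_dom (nsummableZ (normr_ge0 a) hS) => x.
by rewrite normrM.
Qed.

Lemma tsumD h k : asummable h -> asummable k ->
  tsum (fun x => h x + k x) = tsum h + tsum k.
Proof.
move=> hS kS; have hS' := asummable_pos hS; have kS' := asummable_pos kS.
have -> : (fun x => h x + k x) =
   (fun x => ((`|h x| + h x) + (`|k x| + k x)) - (`|h x| + `|k x|)).
  by apply/funext => x; ring.
have h0 x := normDl_ge0 (h x); have k0 x := normDl_ge0 (k x).
have E1 := nsumD h0 k0 hS' kS'.
have E2 := nsumD (fun x => normr_ge0 (h x)) (fun x => normr_ge0 (k x)) hS kS.
rewrite tsum_sub.
- by rewrite E1 E2 /tsum; ring.
- by move=> x; rewrite addr_ge0.
- by move=> x; rewrite addr_ge0.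
- exact: nsummableD hS' kS'.
- exact: nsummableD hS kS.
Qed.

Lemma tsumN h : asummable h -> tsum (fun x => - h x) = - tsum h.
Proof.
move=> hS; have hS' := asummable_pos hS.
have -> : (fun x => - h x) = (fun x => `|h x| - (`|h x| + h x)).
  by apply/funext => x; ring.
by rewrite tsum_sub//; [rewrite /tsum opprB|move=> x; exact: normDl_ge0].
Qed.

Lemma tsumZ h a : asummable h -> tsum (fun x => a * h x) = a * tsum h.
Proof.
wlog a0 : a / 0 <= a => [wl hS|hS].
  have [a0|a0] := leP 0 a; first exact: wl.
  have -> : (fun x => a * h x) = (fun x => - (- a * h x)).
    by apply/funext => x; ring.
  rewrite tsumN; last exact: asummableZ.
  by rewrite wl// ?oppr_ge0 ?(ltW a0)// mulNr opprK.
have hS' := asummable_pos hS.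
have -> : (fun x => a * h x) = (fun x => a * (`|h x| + h x) - a * `|h x|).
  by apply/funext => x; ring.
have E1 := nsumZ a0 hS'; have E2 := nsumZ a0 hS.
rewrite tsum_sub.
- by rewrite E1 E2 /tsum; ring.
- by move=> x; rewrite mulr_ge0 ?normDl_ge0.
- by move=> x; rewrite mulr_ge0.
- exact: nsummableZ a0 hS'.
- exact: nsummableZ a0 hS.
Qed.

(** Links unordered sums to limits along an exhaustion of the index set, the form in which
    exponential series are evaluated later. *)
Lemma tsum_lim h (s : nat -> seq X) (e : R) : asummable h ->
  (forall n, uniq (s n)) ->
  (forall x, exists N, forall n, (N <= n)%N -> x \in s n) -> 0 < e ->
  exists N, forall n, (N <= n)%N -> `|\sum_(x <- s n) h x - tsum h| <= e.
Proof.
move=> hS us sx e0.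
have pos k : (forall x, 0 <= k x) -> nsummable k -> forall d, 0 < d ->
    exists N, forall n, (N <= n)%N -> `|\sum_(x <- s n) k x - nsum k| <= d.
  move=> k0 kS d d0; have [t ut kt] := nsum_adh kS d0.
  have [N NP] : exists N, forall n, (N <= n)%N -> {subset t <= s n}.
    elim: t {ut kt} => [|x t [N NP]]; first by exists 0%N.
    have [M MP] := sx x; exists (maxn M N) => n; rewrite geq_max => /andP[Mn Nn] y.
    by rewrite inE => /orP[/eqP->|/NP]; [exact: MP|exact].
  exists N => n Nn; rewrite distrC ger0_norm ?subr_ge0 ?nsum_ge//.
  rewrite lerBlDr -lerBlDl; apply: le_trans (ltW kt) _.
  apply: le_trans (sum_catl_undup (s n) k0 ut) _; apply: sum_perm_le; apply: uniq_perm => //.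
    exact: undup_uniq.
  move=> x; rewrite mem_undup mem_cat; apply/orP/idP => [[/(NP n Nn)//|//]|].
  by right.
have hS' := asummable_pos hS; have e2 : 0 < e / 2 by rewrite divr_gt0.
have [N1 h1] := pos _ (fun x => normDl_ge0 (h x)) hS' _ e2.
have [N2 h2] := pos _ (fun x => normr_ge0 (h x)) hS _ e2.
exists (maxn N1 N2) => n; rewrite geq_max => /andP[n1 n2].
rewrite /tsum.
have -> : \sum_(x <- s n) h x = \sum_(x <- s n) (`|h x| + h x) - \sum_(x <- s n) `|h x|.
  by rewrite -sumrB; apply: eq_bigr => x _; ring.
have aux (a b c d : R) : a - b - (c - d) = (a - c) - (b - d) by ring.
rewrite aux; apply: le_trans (ler_normB _ _) _.
by rewrite [leRHS](splitr e) lerD ?h1 ?h2.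
Qed.

End OneIndex.

Section Reindexing.
Variables (X : eqType) (sg tau : X -> X).
Hypotheses (sgK : cancel sg tau) (tauK : cancel tau sg).

Lemma nsummable_reindex (h : X -> R) : nsummable h -> nsummable (h \o sg).
Proof.
move=> [M hM]; exists M => s us.
by have := hM (map sg s); rewrite big_map map_inj_uniq; [apply|exact: can_inj sgK].
Qed.

Lemma nsum_reindex_le (h : X -> R) : nsummable h -> nsum (h \o sg) <= nsum h.
Proof.
move=> hS; apply: nsum_le => s us.
have := @nsum_ge _ h (map sg s) hS.
by rewrite big_map map_inj_uniq; [apply|exact: can_inj sgK].
Qed.
End Reindexing.

Lemma nsum_reindex (X : eqType) (sg tau : X -> X) (h : X -> R) :
  cancel sg tau -> cancel tau sg -> nsummable h -> nsum (h \o sg) = nsum h.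
Proof.
move=> sgK tauK hS; apply/eqP; rewrite eq_le (nsum_reindex_le sgK)//=.
have := nsum_reindex_le tauK (nsummable_reindex sgK hS).
by congr (nsum _ <= _); apply/funext => x /=; rewrite tauK.
Qed.

Lemma tsum_reindex (X : eqType) (sg tau : X -> X) (h : X -> R) :
  cancel sg tau -> cancel tau sg -> asummable h -> tsum (h \o sg) = tsum h.
Proof.
move=> sgK tauK hS; rewrite /tsum.
rewrite -(nsum_reindex sgK tauK hS).
by rewrite -(nsum_reindex sgK tauK (asummable_pos hS)).
Qed.

Section Products.
Variables X Y : eqType.
Implicit Type h : X * Y -> R.

Lemma nsummable_slice h x : nsummable h -> nsummable (fun y => h (x, y)).
Proof.
move=> [M hM]; exists M => s us; have := hM [seq (x, y) | y <- s].
by rewrite big_map map_inj_uniq; [apply|move=> y y' []].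
Qed.

Lemma nsum_finite_sum (I : Type) (s : seq I) (h : I -> Y -> R) :
  (forall i y, 0 <= h i y) -> (forall i, nsummable (h i)) ->
  nsummable (fun y => \sum_(i <- s) h i y) /\
  nsum (fun y => \sum_(i <- s) h i y) = \sum_(i <- s) nsum (h i).
Proof.
move=> h0 hS; elim: s => [|i s [sS sE]].
  have -> : (fun y => \sum_(i <- [::]) h i y) = (fun=> 0).
    by apply/funext => y; rewrite big_nil.
  split; first exact: nsummable0.
  by rewrite big_nil nsum0.
have -> : (fun y => \sum_(j <- i :: s) h j y) = (fun y => h i y + \sum_(j <- s) h j y).
  by apply/funext => y; rewrite big_cons.
split; first exact: nsummableD.
by rewrite nsumD// ?big_cons ?sE// => y; exact: sumr_ge0.
Qed.

Lemma sum_slices_le h (s : seq X) : (forall p, 0 <= h p) -> nsummable h -> uniq s ->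
  \sum_(x <- s) nsum (fun y => h (x, y)) <= nsum h.
Proof.
move=> h0 hS us.
have [_ <-] := @nsum_finite_sum _ s (fun x y => h (x, y)) (fun x y => h0 (x, y))
   (fun x => nsummable_slice x hS).
apply: nsum_le => t ut; rewrite exchange_big /=.
rewrite -(big_allpairs_dep (h := fun (x : X) (y : Y) => (x, y)) (r1 := s) (r2 := fun=> t) (F := h)) /=.
by apply: nsum_ge => //; apply: allpairs_uniq => // -[x y] [x' y'] _ _ [-> ->].
Qed.

(** Tonelli: a finite set of pairs lies in the rectangle spanned by its two projections, and a
    finite rectangle can be summed by rows. *)
Lemma nsummable_prod h : (forall p, 0 <= h p) ->
  (forall x, nsummable (fun y => h (x, y))) ->
  nsummable (fun x => nsum (fun y => h (x, y))) ->
  nsummable h /\ nsum h <= nsum (fun x => nsum (fun y => h (x, y))).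
Proof.
move=> h0 hY hX.
suff bnd s : uniq s -> \sum_(p <- s) h p <= nsum (fun x => nsum (fun y => h (x, y))).
  by split; [exists (nsum (fun x => nsum (fun y => h (x, y))))|exact: nsum_le].
move=> us; set a := undup [seq p.1 | p <- s]; set b := undup [seq p.2 | p <- s].
apply: (@le_trans _ _ (\sum_(x <- a) \sum_(y <- b) h (x, y))).
  rewrite -(big_allpairs_dep (h := fun (x : X) (y : Y) => (x, y)) (r1 := a) (r2 := fun=> b) (F := h)) /=.
  set ab := [seq _ | x <- _, y <- _].
  have uab : uniq ab.
    by apply: allpairs_uniq; rewrite ?undup_uniq// => -[x y] [x' y'] _ _ [-> ->].
  apply: le_trans (sum_catl_undup ab h0 us) _; apply: sum_perm_le; apply: uniq_perm => //.
    exact: undup_uniq.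
  move=> [x y]; rewrite mem_undup mem_cat; apply/orP/idP => [[xys|//]|]; last by right.
  apply/allpairsP; exists (x, y); split=> //=; rewrite mem_undup; apply/mapP.
    by exists (x, y).
  by exists (x, y).
apply: (@le_trans _ _ (\sum_(x <- a) nsum (fun y => h (x, y)))).
  by apply: ler_sum => x _; apply: nsum_ge; rewrite ?undup_uniq.
by apply: nsum_ge; rewrite ?undup_uniq.
Qed.

Lemma nsum_prod h : (forall p, 0 <= h p) -> nsummable h ->
  nsummable (fun x => nsum (fun y => h (x, y))) /\
  nsum h = nsum (fun x => nsum (fun y => h (x, y))).
Proof.
move=> h0 hS.
have hX : nsummable (fun x => nsum (fun y => h (x, y))).
  by exists (nsum h) => s us; exact: sum_slices_le.
split=> //; apply/eqP; rewrite eq_le; apply/andP; split; last first.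
  by apply: nsum_le => s us; exact: sum_slices_le.
by have [] := nsummable_prod h0 (fun x => nsummable_slice x hS) hX.
Qed.

Lemma tsum_prod h : asummable h ->
  tsum h = tsum (fun x => tsum (fun y => h (x, y))).
Proof.
move=> hS; have hS' := asummable_pos hS.
have [S1 E1] := nsum_prod (fun p => normr_ge0 (h p)) hS.
have [S2 E2] := nsum_prod (fun p => normDl_ge0 (h p)) hS'.
rewrite {1}/tsum E1 E2 -tsum_sub//.
  move=> x; apply: nsum_ge0; exact: (nsummable_slice x hS').
move=> x; apply: nsum_ge0; exact: (nsummable_slice x hS).
Qed.

End Products.
End NonnegSums.

(** * Complex sums and square-summable functions *)

Section ComplexSums.
Context {R : realType}.

Definition nsq (z : R[i]) : R := complex.Re z ^+ 2 + complex.Im z ^+ 2.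

Lemma nsqE z : (nsq z)%:C = `|z| ^+ 2.
Proof. exact: add_Re2_Im2. Qed.

Lemma nsq_ge0 z : 0 <= nsq z.
Proof. by rewrite addr_ge0 ?sqr_ge0. Qed.

Lemma nsqM z w : nsq (z * w) = nsq z * nsq w.
Proof. by apply: complexI; rewrite rmorphM /= !nsqE normrM exprMn. Qed.

Lemma nsq_mul_conj z : z * Num.conj z = (nsq z)%:C.
Proof. by rewrite nsqE sqr_normc. Qed.

(** Young's inequality with a free weight: t = 1 gives the crude factor 2, the optimal t gives the
    triangle inequality in l2. *)
Lemma nsqD_le z w (t : R) : 0 < t -> nsq (z + w) <= (1 + t) * nsq z + (1 + t^-1) * nsq w.
Proof.
move=> t0; case: z w => [a b] [c d]; rewrite /nsq /=.
have aux (u v : R) : (u + v) ^+ 2 <= (1 + t) * u ^+ 2 + (1 + t^-1) * v ^+ 2.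
  rewrite -subr_ge0.
  have -> : (1 + t) * u ^+ 2 + (1 + t^-1) * v ^+ 2 - (u + v) ^+ 2 = t^-1 * (t * u - v) ^+ 2.
    by field; rewrite gt_eqF.
  by rewrite mulr_ge0 ?sqr_ge0// invr_ge0 ltW.
have := aux a c; have := aux b d; lra.
Qed.

Lemma nsq0_eq0 z : nsq z = 0 -> z = 0.
Proof.
by move=> z0; apply/normr0_eq0/eqP; rewrite -sqrf_eq0 -nsqE z0.
Qed.

Section OneIndex.
Variable X : eqType.
Implicit Types a b f g : X -> R[i].

Definition casummable a := asummable (fun x => complex.Re (a x)) /\
  asummable (fun x => complex.Im (a x)).
Definition csum a := tsum (fun x => complex.Re (a x)) +i* tsum (fun x => complex.Im (a x)).

Lemma csumD a b : casummable a -> casummable b ->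
  csum (fun x => a x + b x) = csum a + csum b.
Proof.
move=> [a1 a2] [b1 b2]; rewrite /csum; simpc; rewrite -!tsumD//.
by congr (_ +i* _); congr tsum; apply/funext => x; case: (a x); case: (b x).
Qed.

Lemma csumZ c a : casummable a -> csum (fun x => c * a x) = c * csum a.
Proof.
case: c => c1 c2 [a1 a2]; have c2a := asummableZ c2 a2.
rewrite /csum; simpc; rewrite -!tsumZ// -!tsumN//.
rewrite -!tsumD; try by apply: asummableZ.
- by congr (_ +i* _); congr tsum; apply/funext => x; case: (a x) => u v; simpc.
- have := asummableZ (-1) (asummableZ c2 a2).
  by congr asummable; apply/funext => x; rewrite mulN1r.
Qed.

Lemma csum_conj a : casummable a -> csum (fun x => Num.conj (a x)) = Num.conj (csum a).
Proof.
move=> [a1 a2]; rewrite /csum conjE -tsumN//.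
by congr (_ +i* _); congr tsum; apply/funext => x; case: (a x).
Qed.

Lemma csum_real (h : X -> R) : (forall x, 0 <= h x) -> nsummable h ->
  csum (fun x => (h x)%:C) = (nsum h)%:C.
Proof.
move=> h0 hS; rewrite /csum /= !tsum_nsum//; last exact: nsummable0.
by rewrite nsum0.
Qed.

Definition sq_summable f := nsummable (fun x => nsq (f x)).

Lemma sq_summableP f g c : sq_summable f -> sq_summable g ->
  sq_summable (fun x => c * f x + g x).
Proof.
move=> fS gS.
have h := nsummableD (nsummableZ (ler0n _ 2) (nsummableZ (nsq_ge0 c) fS)) (nsummableZ (ler0n _ 2) gS).
apply: nsummable_dom h => x /=; have := nsqD_le (c * f x) (g x) (@ltr01 R).
by rewrite nsqM invr1.
Qed.

Lemma casummable_dot f g : sq_summable f -> sq_summable g ->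
  casummable (fun x => f x * Num.conj (g x)).
Proof.
move=> fS gS; have fgS := nsummableD fS gS.
split; apply: nsummable_dom fgS => x; case: (f x) (g x) => [p q] [r s];
  rewrite /nsq conjE /=; have := sqr_ge0 (p - r); have := sqr_ge0 (p + r);
  have := sqr_ge0 (q - s); have := sqr_ge0 (q + s);
  have := sqr_ge0 (p - s); have := sqr_ge0 (p + s);
  have := sqr_ge0 (q - r); have := sqr_ge0 (q + r);
  have := sqr_ge0 p; have := sqr_ge0 q;
  have := sqr_ge0 r; have := sqr_ge0 s; rewrite ler_norml;
  move=> *; apply/andP; split; nra.
Qed.

Lemma csum_dot_self f : sq_summable f ->
  csum (fun x => f x * Num.conj (f x)) = (nsum (fun x => nsq (f x)))%:C.
Proof.
move=> fS; rewrite -csum_real//; last by move=> x; exact: nsq_ge0.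
by congr csum; apply/funext => x; rewrite nsq_mul_conj.
Qed.

Lemma csum_lim a (s : nat -> seq X) (e : R) : casummable a ->
  (forall n, uniq (s n)) ->
  (forall x, exists N, forall n, (N <= n)%N -> x \in s n) -> 0 < e ->
  exists N, forall n, (N <= n)%N -> `|\sum_(x <- s n) a x - csum a| <= e%:C.
Proof.
move=> [a1 a2] us sx e0; have e2 : 0 < e / 2 by rewrite divr_gt0.
have [N1 h1] := tsum_lim a1 us sx e2; have [N2 h2] := tsum_lim a2 us sx e2.
exists (maxn N1 N2) => n; rewrite geq_max => /andP[n1 n2].
apply: le_trans (norm_le_ReIm _) _.
have ReS : complex.Re (\sum_(x <- s n) a x - csum a) =
  \sum_(x <- s n) complex.Re (a x) - tsum (fun x => complex.Re (a x)).
  by rewrite raddfB /= raddf_sum.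
have ImS : complex.Im (\sum_(x <- s n) a x - csum a) =
  \sum_(x <- s n) complex.Im (a x) - tsum (fun x => complex.Im (a x)).
  by rewrite raddfB /= raddf_sum.
rewrite ReS ImS lecR [leRHS](splitr e).
by rewrite lerD ?h1 ?h2.
Qed.

End OneIndex.

Lemma csum_reindex (X : eqType) (sg tau : X -> X) (a : X -> R[i]) :
  cancel sg tau -> cancel tau sg -> casummable a -> csum (a \o sg) = csum a.
Proof.
move=> sgK tauK [a1 a2]; rewrite /csum.
by rewrite -(tsum_reindex sgK tauK a1) -(tsum_reindex sgK tauK a2).
Qed.

Lemma csum_prod (X Y : eqType) (a : X * Y -> R[i]) : casummable a ->
  csum a = csum (fun x => csum (fun y => a (x, y))).
Proof. by move=> [a1 a2]; rewrite /csum (tsum_prod a1) (tsum_prod a2). Qed.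

End ComplexSums.

(** * The Hilbert space l2 over an arbitrary index set *)

Section L2.
Context {R : realType}.

Definition l2_pred (X : eqType) : {pred X -> R[i]^o} := [pred f | `[< sq_summable f >]].

Record l2 (X : eqType) : Type := L2 {
  l2_fun :> X -> R[i]^o;
  _ : l2_fun \in @l2_pred X
}.

HB.instance Definition _ X := [isSub for @l2_fun X].
HB.instance Definition _ X := [Choice of l2 X by <:].

Variable X : eqType.
Implicit Types f g h : l2 X.

Lemma l2P f : sq_summable f.
Proof. by case: f => f /= /asboolP. Qed.

Lemma l2_ext f g : f =1 g -> f = g.
Proof. by move=> fg; apply: val_inj; apply: funext. Qed.

Lemma l2_submod : submod_closed (@l2_pred X).
Proof.
split; rewrite ?inE.
  by apply: nsummable_dom (nsummable0 X) => x; rewrite /nsq /= expr0n addr0.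
move=> a f g; rewrite !inE => fS gS; exact: sq_summableP.
Qed.

HB.instance Definition _ := GRing.isSubmodClosed.Build _ _ (@l2_pred X) l2_submod.
HB.instance Definition _ := [SubChoice_isSubLmodule of l2 X by <:].

Lemma l2DE f g x : (f + g) x = f x + g x. Proof. by []. Qed.
Lemma l2ZE (a : R[i]) f x : (a *: f) x = a * f x. Proof. by []. Qed.
Definition l2sq f : R := nsum (fun x => nsq (f x)).
Definition l2norm f : R[i] := (Num.sqrt (l2sq f))%:C.

Lemma l2sq_ge0 f : 0 <= l2sq f.
Proof. by apply: nsum_ge0; exact: l2P. Qed.

Lemma l2normD f g : l2norm (f + g) <= l2norm f + l2norm g.
Proof.
rewrite /l2norm -rmorphD lecR.
set A := Num.sqrt (l2sq f); set B := Num.sqrt (l2sq g).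
have A0 : 0 <= A by exact: sqrtr_ge0.
have B0 : 0 <= B by exact: sqrtr_ge0.
have AE : l2sq f = A ^+ 2 by rewrite sqr_sqrtr ?l2sq_ge0.
have BE : l2sq g = B ^+ 2 by rewrite sqr_sqrtr ?l2sq_ge0.
suff : l2sq (f + g) <= (A + B) ^+ 2.
  move=> h; rewrite -(ger0_norm (addr_ge0 A0 B0)) -sqrtr_sqr.
  by rewrite ler_sqrt// sqr_ge0.
have key (t : R) : 0 < t -> l2sq (f + g) <= (1 + t) * A ^+ 2 + (1 + t^-1) * B ^+ 2.
  move=> t0; rewrite -AE -BE.
  have t1 : 0 <= 1 + t by rewrite addr_ge0 ?ler01// ltW.
  have t2 : 0 <= 1 + t^-1 by rewrite addr_ge0 ?ler01// invr_ge0 ltW.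
  have fS := l2P f; have gS := l2P g.
  rewrite /l2sq -!nsumZ// -nsumD; try exact: nsummableZ.
  - apply: nsum_mono => [x|]; first exact: nsqD_le.
    by apply: nsummableD; exact: nsummableZ.
  - by move=> x; rewrite mulr_ge0 ?nsq_ge0.
  - by move=> x; rewrite mulr_ge0 ?nsq_ge0.
have [A00|A1] := eqVneq A 0.
  apply/ler_addgt0Pr => e e0; rewrite A00 add0r.
  pose t := (B ^+ 2 + 1) / e.
  have t0 : 0 < t by rewrite divr_gt0// ltr_wpDl ?sqr_ge0.
  apply: le_trans (key _ t0) _; rewrite A00 expr0n mulr0 add0r mulrDl mul1r lerD2l.
  rewrite /t invf_div mulrAC ler_pdivrMr ?ltr_wpDl ?sqr_ge0//.
  by rewrite ler_pM2l// lerDl.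
have [B00|B1] := eqVneq B 0.
  apply/ler_addgt0Pr => e e0; rewrite B00 addr0.
  pose t := e / (A ^+ 2 + 1).
  have t0 : 0 < t by rewrite divr_gt0// ltr_wpDl ?sqr_ge0.
  apply: le_trans (key _ t0) _; rewrite B00 expr0n mulr0 addr0 mulrDl mul1r lerD2l.
  rewrite /t mulrAC ler_pdivrMr ?ltr_wpDl ?sqr_ge0//.
  by rewrite ler_pM2l// lerDl.
(* At t = B / A the bound [key] equals (A + B)^2. *)
have t0 : 0 < B / A by rewrite divr_gt0 ?lt_def ?A1 ?B1.
apply: le_trans (key _ t0) _.
rewrite le_eqVlt; apply/orP; left; apply/eqP.
by field; rewrite A1 B1.
Qed.

Lemma l2normZ (a : R[i]) f : l2norm (a *: f) = `|a| * l2norm f.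
Proof.
rewrite /l2norm; have -> : l2sq (a *: f) = nsq a * l2sq f.
  rewrite /l2sq -nsumZ ?nsq_ge0//; last exact: l2P.
  by congr nsum; apply/funext => x; rewrite -nsqM.
by rewrite sqrtrM ?nsq_ge0// rmorphM /= normc_def.
Qed.

Lemma l2norm0_eq0 f : l2norm f = 0 -> f = 0.
Proof.
move=> /complexI/eqP; rewrite sqrtr_eq0 => f0.
have {}f0 : l2sq f = 0 by apply/eqP; rewrite eq_le f0 l2sq_ge0.
apply: l2_ext => x; apply: nsq0_eq0.
exact: (nsum_eq0 (fun x => nsq_ge0 (f x)) (l2P f) f0).
Qed.

HB.instance Definition _ :=
  Lmodule_isNormed.Build R[i] (l2 X) l2normD l2normZ l2norm0_eq0.

Lemma l2_ballE f (e : R) g : 0 <= e -> ball f e%:C g = (l2sq (f - g) < e ^+ 2).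
Proof.
move=> e0; rewrite -ball_normE /ball_ /= [`|_|]/(l2norm _) ltcR.
by rewrite -[in RHS](sqr_sqrtr (l2sq_ge0 _)) ltr_pXn2r// ?nnegrE ?sqrtr_ge0.
Qed.

(* The limit is the supremum of the eventual lower bounds of phi. *)
Lemma real_filter_lim (F : set_system (l2 X)) (phi : l2 X -> R) :
  ProperFilter F ->
  (forall e : R, 0 < e -> exists f, F [set g | `|phi f - phi g| <= e]) ->
  exists l, forall f (e : R), F [set g | `|phi f - phi g| <= e] -> `|phi f - l| <= e.
Proof.
move=> FF cF; pose S := [set r | F [set g | r <= phi g]].
have Sub f e r : F [set g | `|phi f - phi g| <= e] -> S r -> r <= phi f + e.
  move=> Ff Sr; have [g [/= fg rg]] := filter_ex (filterI Ff Sr).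
  by apply: le_trans rg _; move: fg; rewrite ler_norml => /andP[]; lra.
have Sin f e : F [set g | `|phi f - phi g| <= e] -> S (phi f - e).
  move=> Ff; apply: filterS Ff => g /=; rewrite ler_norml => /andP[]; lra.
have [f0 Ff0] := cF 1 ltr01.
have Ss : has_sup S.
  split; first by exists (phi f0 - 1); exact: Sin.
  by exists (phi f0 + 1) => r; exact: Sub.
exists (sup S) => f e Ff; rewrite ler_norml; apply/andP; split.
  have : sup S <= phi f + e by apply: ge_sup => [|r]; [case: Ss|exact: Sub].
  lra.
by have := sup_upper_bound Ss (Sin _ _ Ff); lra.
Qed.

Lemma l2_complete (F : set_system (l2 X)) : ProperFilter F -> cauchy F -> cvg F.
Proof.
move=> FF cF.
have FB (e : R) : 0 < e -> exists f, F [set g | l2sq (f - g) < e].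
  move=> e0; have s0 : 0 < Num.sqrt e by rewrite sqrtr_gt0.
  have s0C : 0 < (Num.sqrt e)%:C by rewrite ltcR.
  move: cF => /cauchyP/(_ _ s0C)[f Ff]; exists f.
  by apply: filterS Ff => g; rewrite l2_ballE ?ltW// sqr_sqrtr// ltW.
have coord x f g : nsq (f x - g x) <= l2sq (f - g).
  exact: (nsum_term_le x (l2P (f - g))).
(* [p] is instantiated with the real and the imaginary part; this gives the coordinatewise
   limits. *)
have crd (p : R[i] -> R) x : (forall z w, p (z - w) = p z - p w) ->
    (forall z, `|p z| ^+ 2 <= nsq z) -> exists l, forall d : R, 0 < d ->
    F [set g | `|p (g x) - l| <= d].
  move=> pB pn.
  have step (d : R) : 0 < d -> exists f, F [set g | `|p (f x) - p (g x)| <= d].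
    move=> d0; have d2 : 0 < d ^+ 2 by rewrite exprn_gt0.
    have [f Ff] := FB _ d2; exists f; apply: filterS Ff => g /= fg.
    rewrite -pB -(@ler_pXn2r _ 2)// ?nnegrE ?normr_ge0 ?(ltW d0)//.
    by apply: le_trans (pn _) _; apply: le_trans (coord _ _ _) _; exact: ltW.
  have [l lP] := real_filter_lim FF step; exists l => d d0.
  have d2 : 0 < d / 2 by rewrite divr_gt0.
  have [f Ff] := step _ d2; have fl := lP _ _ Ff; apply: filterS Ff => g /= fg.
  have -> : p (g x) - l = (p (f x) - l) - (p (f x) - p (g x)) by ring.
  by apply: le_trans (ler_normB _ _) _; rewrite [leRHS](splitr d) lerD.
have zx x : exists z : R[i], forall d : R, 0 < d -> F [set g | nsq (g x - z) <= d].
  have [z w|z|a aP] := @crd (@complex.Re R) x.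
  - by case: z w => [? ?] [? ?].
  - by rewrite real_normK ?num_real// /nsq lerDl sqr_ge0.
  have [z w|z|b bP] := @crd (@complex.Im R) x.
  - by case: z w => [? ?] [? ?].
  - by rewrite real_normK ?num_real// /nsq lerDr sqr_ge0.
  exists (a +i* b) => d d0.
  have d2 : 0 < Num.sqrt (d / 2) by rewrite sqrtr_gt0 divr_gt0.
  apply: filterS (filterI (aP _ d2) (bP _ d2)) => g [/=]; case: (g x) => u v /= ua vb.
  have sq (w : R) : `|w| <= Num.sqrt (d / 2) -> w ^+ 2 <= d / 2.
    move=> h; rewrite -(@sqr_sqrtr _ (d / 2)) ?divr_ge0 ?(ltW d0)//.
    by rewrite -real_normK ?num_real// ler_pXn2r// ?nnegrE ?sqrtr_ge0.
  by rewrite /nsq /= [leRHS](splitr d) lerD// sq.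
have [z zP] := choice zx.
have zs (s : seq X) (d : R) : 0 < d -> F [set g | \sum_(x <- s) nsq (g x - z x) <= d].
  elim: s d => [|x s IH] d d0.
    by apply: filterS filterT => g _ /=; rewrite big_nil ltW.
  have d2 : 0 < d / 2 by rewrite divr_gt0.
  apply: filterS (filterI (zP x _ d2) (IH _ d2)) => g [/= h1 h2].
  by rewrite big_cons [leRHS](splitr d) lerD.
(* A single [g] is close both to [f] in l2 and to the limit on the finite set [s]; hence 2 e + 2
   e. *)
have fz (e : R) f : 0 < e -> F [set g | l2sq (f - g) < e] ->
    forall s, uniq s -> \sum_(x <- s) nsq (f x - z x) <= 4 * e.
  move=> e0 Ff s us; have [g [/= fg gz]] := filter_ex (filterI Ff (zs s _ e0)).
  have fg' : \sum_(x <- s) nsq (f x - g x) <= e.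
    by apply: le_trans (ltW fg); exact: (nsum_ge (l2P (f - g)) us).
  apply: (@le_trans _ _ (2 * \sum_(x <- s) nsq (f x - g x) + 2 * \sum_(x <- s) nsq (g x - z x))).
    rewrite !mulr_sumr -big_split; apply: ler_sum => x _ /=.
    have := nsqD_le (f x - g x) (g x - z x) (@ltr01 R).
    by rewrite addrA subrK invr1.
  lra.
have zl2 : z \in @l2_pred X.
  rewrite inE; have [f Ff] := FB 1 ltr01.
  have fzS : sq_summable (fun x => f x - z x).
    by exists (4 * 1) => s us; exact: fz us.
  have := sq_summableP (-1) fzS (l2P f); congr sq_summable.
  by apply/funext => x; ring.
pose Z := L2 zl2.
apply/cvg_ex; exists Z; apply/cvgrPdist_lt => e e0.
have eE : (complex.Re e)%:C = e by rewrite RRe_real// gtr0_real.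
have d0 : 0 < complex.Re e by rewrite -ltcR eE.
(* With c = e^2 / 20, the final estimate is 2 (4 c) + 2 c = 10 c = e^2 / 2. *)
have c0 : 0 < complex.Re e ^+ 2 / 20 by rewrite divr_gt0 ?exprn_gt0.
have [f Ff] := FB _ c0; apply: filterS (Ff) => g /= fg.
have : ball Z (complex.Re e)%:C g; last by rewrite eE -ball_normE.
rewrite l2_ballE; last exact: ltW.
apply: (@le_lt_trans _ _ (10 * (complex.Re e ^+ 2 / 20))); last by lra.
apply: nsum_le => s us.
have fg' : \sum_(x <- s) nsq (f x - g x) <= complex.Re e ^+ 2 / 20.
  by apply: le_trans (ltW fg); exact: (nsum_ge (l2P (f - g)) us).
have fz' := fz _ _ c0 Ff s us.
apply: (@le_trans _ _ (2 * \sum_(x <- s) nsq (f x - z x) + 2 * \sum_(x <- s) nsq (f x - g x))).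
  rewrite !mulr_sumr -big_split; apply: ler_sum => x _ /=.
  have := nsqD_le (- (f x - z x)) (f x - g x) (@ltr01 R).
  rewrite -[- _]mulN1r nsqM [nsq (-1)](_ : _ = 1) ?mul1r ?invr1; last first.
    by rewrite /nsq /= oppr0 expr0n addr0 sqrrN expr1n.
  by have -> : -1 * (f x - z x) + (f x - g x) = z x - g x by ring.
lra.
Qed.

HB.instance Definition _ := Uniform_isComplete.Build (l2 X) l2_complete.

Definition l2dot f g : R[i] := csum (fun x => f x * Num.conj (g x)).

Lemma l2dotDl f g h : l2dot (f + g) h = l2dot f h + l2dot g h.
Proof.
rewrite /l2dot -csumD; try by apply: casummable_dot; exact: l2P.
by congr csum; apply/funext => x; rewrite l2DE mulrDl.
Qed.

Lemma l2dotZl (a : R[i]) f g : l2dot (a *: f) g = a * l2dot f g.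
Proof.
rewrite /l2dot -csumZ; last by apply: casummable_dot; exact: l2P.
by congr csum; apply/funext => x; rewrite l2ZE mulrA.
Qed.

Lemma l2dotC f g : l2dot g f = Num.conj (l2dot f g).
Proof.
rewrite /l2dot -csum_conj; last by apply: casummable_dot; exact: l2P.
by congr csum; apply/funext => x; rewrite rmorphM /= conjCK mulrC.
Qed.

Lemma l2dot_norm f : l2dot f f = `|f| ^+ 2.
Proof.
rewrite /l2dot csum_dot_self; last exact: l2P.
by rewrite [`|f|]/(l2norm f) /l2norm -rmorphXn sqr_sqrtr// l2sq_ge0.
Qed.

HB.instance Definition _ := isHilbert.Build R (l2 X) l2dotDl l2dotZl l2dotC l2dot_norm.

Lemma l2_dotE f g : dot f g = csum (fun x => f x * Num.conj (g x)).
Proof. by []. Qed.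

End L2.

(** * Basis vectors, monomial operators and amplifications on l2 *)

Section L2Operators.
Context {R : realType}.

Lemma nsum_single (X : eqType) (h : X -> R) x0 : (forall x, 0 <= h x) ->
  (forall x, x != x0 -> h x = 0) -> nsummable h /\ nsum h = h x0.
Proof.
move=> h0 hx; have bnd s : uniq s -> \sum_(x <- s) h x <= h x0.
  move=> us; have [xs|xs] := boolP (x0 \in s).
    rewrite (bigD1_seq x0)//= big1 ?addr0// => x xx0; exact: hx.
  rewrite big1_seq// => x /andP[_ xin]; apply: hx.
  by apply: contraNneq xs => <-.
have hS : nsummable h by exists (h x0).
split=> //; apply/eqP; rewrite eq_le nsum_le//=.
exact: nsum_term_le.
Qed.

Lemma csum_single (X : eqType) (a : X -> R[i]) x0 :
  (forall x, x != x0 -> a x = 0) -> csum a = a x0.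
Proof.
move=> ax.
have ts (h : X -> R) : (forall x, x != x0 -> h x = 0) -> tsum h = h x0.
  move=> hx; rewrite /tsum.
  have [_ ->] := @nsum_single X (fun x => `|h x| + h x) x0 (fun x => normDl_ge0 (h x))
    (fun x xx0 => etrans (congr1 (fun u => `|u| + u) (hx x xx0)) (etrans (addr0 _) (normr0 _))).
  have [_ ->] := @nsum_single X (fun x => `|h x|) x0 (fun x => normr_ge0 (h x))
    (fun x xx0 => etrans (congr1 (fun u => `|u|) (hx x xx0)) (normr0 _)).
  by ring.
rewrite /csum !ts; first by case: (a x0).
  by move=> x /ax ->.
by move=> x /ax ->.
Qed.

Section Delta.
Variable X : eqType.

Lemma l2_delta_subproof (x0 : X) : (fun x => (x == x0)%:R : R[i]^o) \in @l2_pred R X.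
Proof.
rewrite inE; have [|x xx0|S _] := @nsum_single X (fun x => nsq ((x == x0)%:R : R[i])) x0.
- by move=> x; exact: nsq_ge0.
- by rewrite (negPf xx0) /nsq /= expr0n addr0.
- exact: S.
Qed.

Definition l2_delta (x0 : X) : l2 X := L2 (l2_delta_subproof x0).

Lemma dot_delta (f : l2 X) x0 : dot f (l2_delta x0) = f x0.
Proof.
rewrite l2_dotE (@csum_single _ _ x0) => [|x /negPf xx0] /=.
  by rewrite eqxx rmorph1 mulr1.
by rewrite xx0 rmorph0 mulr0.
Qed.

End Delta.

Section MonomialOperators.
Variables (X : eqType) (sg tau : X -> X) (w : X -> R[i]).
Hypotheses (sgK : cancel sg tau) (tauK : cancel tau sg) (w1 : forall x, `|w x| = 1).

Lemma monomial_nsq x z : nsq (w x * z) = nsq z.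
Proof.
rewrite nsqM (_ : nsq (w x) = 1) ?mul1r//.
by apply: complexI; rewrite nsqE w1 expr1n.
Qed.

Lemma monomial_subproof (f : l2 X) : (fun x => w x * f (tau x) : R[i]^o) \in @l2_pred R X.
Proof.
rewrite inE; have := nsummable_reindex tauK (l2P f).
by congr nsummable; apply/funext => x; rewrite /= monomial_nsq.
Qed.

Definition monomial_fun (f : l2 X) : l2 X := L2 (monomial_subproof f).

Lemma monomial_isometric : isometric monomial_fun.
Proof.
split=> [a f g|f g].
  by apply: l2_ext => x; rewrite !l2DE !l2ZE /= mulrDr mulrCA.
have S := casummable_dot (l2P f) (l2P g).
rewrite !l2_dotE -(csum_reindex tauK sgK S); congr csum; apply/funext => x /=.
rewrite rmorphM /= mulrACA nsq_mul_conj (_ : nsq (w x) = 1) ?mul1r//.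
by apply: complexI; rewrite nsqE w1 expr1n.
Qed.

Lemma monomial_ex : exists T : bop (l2 X),
  (forall f x, T f x = w x * f (tau x)) /\ (forall f g, dot (T f) (T g) = dot f g).
Proof.
have [T TE] := isometric_bop monomial_isometric; exists T.
by split=> [f x|f g]; rewrite !TE//; case: monomial_isometric => _ ->.
Qed.

End MonomialOperators.

Lemma monomial_unitary (X : eqType) (sg tau : X -> X) (w : X -> R[i]) :
  cancel sg tau -> cancel tau sg -> (forall x, `|w x| = 1) ->
  exists T : bop (l2 X), [/\ unitary T,
    (forall f x, T f x = w x * f (tau x)) &
    (forall f x, star T f x = Num.conj (w (sg x)) * f (sg x))].
Proof.
move=> sgK tauK w1; have [T [TE Td]] := monomial_ex sgK tauK w1.
have w2 x : `|Num.conj (w (sg x))| = 1 by rewrite norm_conjC w1.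
have [T' [T'E _]] := monomial_ex tauK sgK w2.
have TT' f : T (T' f) = f.
  apply: l2_ext => x; rewrite TE T'E tauK mulrA nsq_mul_conj.
  rewrite (_ : nsq (w x) = 1) ?mul1r//.
  by apply: complexI; rewrite nsqE w1 expr1n.
have [uT sT] := unitary_isometric Td TT'.
by exists T; split=> // f x; rewrite sT T'E.
Qed.

Section Amplification.
Variables (X Y : eqType).

(** Fubini in the form used for compressions to an amplification: it suffices to compare inner
    products on each fibre. *)
Lemma dot_l2_prod (F G : @l2 R (prod X Y)) (f g : @l2 R X) :
  (forall x, csum (fun y => F (x, y) * Num.conj (G (x, y))) = f x * Num.conj (g x)) ->
  dot F G = dot f g.
Proof.
move=> FG; rewrite !l2_dotE (csum_prod (casummable_dot (l2P F) (l2P G))).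
by congr csum; apply/funext => x; exact: FG.
Qed.

Variable xi : X -> @l2 R Y.
Hypothesis xi1 : forall x, dot (xi x) (xi x) = 1.

Lemma amplify_subproof (f : @l2 R X) : (fun p => f p.1 * xi p.1 p.2 : R[i]^o) \in @l2_pred R (prod X Y).
Proof.
rewrite inE.
have E x : nsum (fun y => nsq (f x * xi x y)) = nsq (f x).
  transitivity (nsum (fun y => nsq (f x) * nsq (xi x y))).
    by congr nsum; apply/funext => y; rewrite nsqM.
  rewrite nsumZ ?nsq_ge0//; last exact: l2P.
  rewrite [X in _ * X](_ : _ = 1) ?mulr1//; apply: complexI.
  by rewrite -csum_dot_self; [exact: xi1|exact: l2P].
have [|||S _] := @nsummable_prod R X Y (fun p => nsq (f p.1 * xi p.1 p.2)).
- by move=> p; exact: nsq_ge0.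
- move=> x; have := nsummableZ (nsq_ge0 (f x)) (l2P (xi x)).
  by congr nsummable; apply/funext => y; rewrite nsqM.
- by have := l2P f; congr nsummable; apply/funext => x; rewrite E.
- exact: S.
Qed.

Definition amplify (f : @l2 R X) : @l2 R (prod X Y) := L2 (amplify_subproof f).

Lemma amplify_isometric : isometric amplify.
Proof.
split=> [a f g|f g].
  by apply: l2_ext => p; rewrite !l2DE !l2ZE /= mulrDl mulrA.
apply: dot_l2_prod => x /=.
transitivity (csum (fun y => (f x * Num.conj (g x)) * (xi x y * Num.conj (xi x y)))).
  by congr csum; apply/funext => y; rewrite rmorphM /= mulrACA.
rewrite csumZ; last by apply: casummable_dot; exact: l2P.
by rewrite -l2_dotE xi1 mulr1.
Qed.

End Amplification.

Section FiniteIndex.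
Variable T : finType.

Lemma l2_fin_subproof (f : T -> R[i]^o) : f \in @l2_pred R T.
Proof.
rewrite inE; exists (\sum_(x <- enum T) nsq (f x)) => s us.
apply: le_trans (sum_catl_undup (enum T) (fun x => nsq_ge0 (f x)) us) _.
apply: sum_perm_le; apply: uniq_perm; rewrite ?undup_uniq ?enum_uniq// => x.
by rewrite mem_undup mem_cat mem_enum orbT.
Qed.

Definition l2_fin (f : T -> R[i]) : @l2 R T := L2 (l2_fin_subproof f).

Lemma dot_l2_fin (f g : @l2 R T) : dot f g = \sum_x f x * Num.conj (g x).
Proof.
apply/eqP; rewrite -subr_eq0; apply/eqP; apply: (@complex_small _ _ 1) => // e e0.
have S := casummable_dot (l2P f) (l2P g).
have [|x|N NP] := csum_lim (s := fun=> enum T) S _ _ e0.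
- by move=> _; exact: enum_uniq.
- by exists 0%N => n _; rewrite mem_enum.
rewrite mulr1 distrC -big_enum; exact: (NP N (leqnn N)).
Qed.

Lemma has_dim_l2 n : #|T| = n -> has_dim (@l2 R T) n.
Proof.
move=> <-{n}; exists (fun i => l2_delta (enum_val i)); split=> [a a0 i|f].
  have := dot0l (l2_delta (enum_val i)); rewrite -a0 dot_suml (bigD1 i)//= dotZl dot_delta /=.
  rewrite eqxx mulr1 big1 ?addr0// => j ji; rewrite dotZl dot_delta /=.
  by rewrite (inj_eq enum_val_inj) eq_sym (negPf ji) mulr0.
exists (fun i => f (enum_val i)); apply: l2_ext => x; rewrite -!dot_delta dot_suml.
rewrite (bigD1 (enum_rank x))//= dotZl !dot_delta /= enum_rankK eqxx mulr1.
rewrite big1 ?addr0// => j jx; rewrite dotZl dot_delta /=.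
by rewrite -[x]enum_rankK (inj_eq enum_val_inj) eq_sym (negPf jx) mulr0.
Qed.

End FiniteIndex.
End L2Operators.
(** * Vectors with prescribed inner products *)

Section GramFactorization.
Context {R : realType}.
Variable d : nat.
Implicit Types (M : 'M[R]_d) (v : 'cV[R]_d).

Definition sqn v : R := \sum_(i < d) (v i ord0) ^+ 2.

Lemma sqn_ge0 v : 0 <= sqn v.
Proof. by apply: sumr_ge0 => i _; exact: sqr_ge0. Qed.

Lemma enorm_sqn v : enorm v ^+ 2 = sqn v.
Proof. by rewrite sqr_sqrtr ?sqn_ge0. Qed.

Lemma enorm_ge0 v : 0 <= enorm v. Proof. exact: sqrtr_ge0. Qed.

Lemma sqnZ (a : R) v : sqn (a *: v) = a ^+ 2 * sqn v.
Proof. by rewrite /sqn mulr_sumr; apply: eq_bigr => i _; rewrite !mxE exprMn. Qed.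

Lemma enormZ (a : R) v : enorm (a *: v) = `|a| * enorm v.
Proof. by rewrite /enorm -!/(sqn _) sqnZ sqrtrM ?sqr_ge0// sqrtr_sqr. Qed.

Lemma mxopnorm_has_sup M :
  has_sup [set enorm (M *m v) | v in [set v : 'cV[R]_d | enorm v <= 1]].
Proof.
have e0 : enorm (0 : 'cV[R]_d) = 0 by rewrite -[0](scale0r (0 : 'cV[R]_d)) enormZ normr0 mul0r.
split; first by exists (enorm (M *m 0)), 0 => //=; rewrite e0.
exists (Num.sqrt (\sum_i (\sum_j `|M i j|) ^+ 2)) => _ [v /= v1 <-].
rewrite ler_sqrt; last by apply: sumr_ge0 => i _; exact: sqr_ge0.
apply: ler_sum => i _; rewrite mxE -real_normK ?num_real//.
rewrite ler_pXn2r// ?nnegrE ?sumr_ge0//.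
apply: le_trans (ler_norm_sum _ _ _) _; apply: ler_sum => j _.
rewrite normrM ler_piMr// -(@ler_pXn2r _ 2)// ?nnegrE// real_normK ?num_real//.
rewrite expr1n; apply: (@le_trans _ _ (sqn v)).
  by rewrite /sqn (bigD1 j)//= lerDl sumr_ge0// => k _; exact: sqr_ge0.
by rewrite -enorm_sqn exprn_ile1 ?enorm_ge0.
Qed.

Lemma mxopnorm_ge0 M : 0 <= mxopnorm M.
Proof.
have [[x Mx] _] := mxopnorm_has_sup M; have [v _ vx] := Mx.
apply: le_trans (sup_upper_bound (mxopnorm_has_sup M) Mx).
by rewrite -vx enorm_ge0.
Qed.

Lemma le_mxopnorm M v : enorm (M *m v) <= mxopnorm M * enorm v.
Proof.
have [v0|v0] := eqVneq (enorm v) 0.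
  have -> : v = 0.
    apply/matrixP => i j; rewrite ord1 mxE; apply/eqP.
    have /eqP := congr1 (fun x => x ^+ 2) v0; rewrite enorm_sqn expr0n /=.
    rewrite psumr_eq0 => [/allP/(_ i)|k _]; last exact: sqr_ge0.
    by rewrite mem_index_enum sqrf_eq0; apply.
  by rewrite mulmx0 -{1}[0](scale0r (0 : 'cV[R]_d)) enormZ normr0 mul0r mulr_ge0 ?mxopnorm_ge0 ?enorm_ge0.
have pv : 0 < enorm v by rewrite lt_def v0 enorm_ge0.
rewrite -ler_pdivrMr//; apply: (sup_upper_bound (mxopnorm_has_sup M)).
exists ((enorm v)^-1 *: v).
  by rewrite /= enormZ ger0_norm ?invr_ge0 ?enorm_ge0// mulVf.
by rewrite -scalemxAr enormZ ger0_norm ?invr_ge0 ?enorm_ge0// mulrC.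
Qed.

Lemma mxopnormN M : mxopnorm (- M) = mxopnorm M.
Proof.
rewrite /mxopnorm; congr sup; apply/seteqP; split=> _ [v v1 <-]; exists v => //;
  by rewrite mulNmx -scaleN1r enormZ normrN1 mul1r.
Qed.

Lemma mxopnormB M N : mxopnorm (M - N) = mxopnorm (N - M).
Proof. by rewrite -mxopnormN opprB. Qed.

(* AM-GM: [2 u w <= t u^2 + w^2 / t] with [t = mxopnorm M]. *)
Lemma bilinear_le M (a b : 'cV[R]_d) :
  2 * \sum_k \sum_l a k ord0 * M k l * b l ord0 <= mxopnorm M * (sqn a + sqn b).
Proof.
set t := mxopnorm M; have t0 : 0 <= t by exact: mxopnorm_ge0.
have Mb : sqn (M *m b) <= t ^+ 2 * sqn b.
  rewrite -!enorm_sqn -exprMn ler_pXn2r// ?nnegrE ?enorm_ge0 ?mulr_ge0 ?enorm_ge0//.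
  exact: le_mxopnorm.
have -> : \sum_k \sum_l a k ord0 * M k l * b l ord0 = \sum_k a k ord0 * (M *m b) k ord0.
  apply: eq_bigr => k _; rewrite mxE mulr_sumr; apply: eq_bigr => l _; exact/esym/mulrA.
(* The case t = 0 is separate because the weights below involve 1 / t; there [M *m b] vanishes. *)
have [t00|t1] := eqVneq t 0.
  rewrite t00 mul0r mulr_sumr sumr_le0// => k _.
  have : sqn (M *m b) == 0.
    by rewrite eq_le sqn_ge0 andbT; move: Mb; rewrite t00 expr0n mul0r.
  rewrite psumr_eq0 => [/allP/(_ k)|j _]; last exact: sqr_ge0.
  by rewrite mem_index_enum sqrf_eq0 => /(_ isT)/eqP ->; rewrite !mulr0.
have pt : 0 < t by rewrite lt_def t1.
apply: (@le_trans _ _ (t * sqn a + t^-1 * sqn (M *m b))).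
  rewrite /sqn !mulr_sumr -big_split; apply: ler_sum => k _ /=.
  set u := a k ord0; set w := (M *m b) k ord0.
  have : 0 <= t^-1 * (t * u - w) ^+ 2 by rewrite mulr_ge0 ?sqr_ge0// invr_ge0.
  have -> : t^-1 * (t * u - w) ^+ 2 = t * u ^+ 2 + t^-1 * w ^+ 2 - 2 * (u * w).
    by field.
  lra.
rewrite mulrDr lerD2l -(ler_pM2l pt) mulrA mulfV// mul1r mulrA -expr2.
exact: Mb.
Qed.

Lemma sum_complexE (I : Type) (s : seq I) (f g : I -> R) :
  \sum_(i <- s) (f i +i* g i) = (\sum_(i <- s) f i) +i* (\sum_(i <- s) g i).
Proof. by elim: s => [|i s IH]; rewrite ?big_nil// !big_cons IH. Qed.

(* Entry (l, k) of the Gram matrix [(t I + i M^T) / 2], which is positive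
   semidefinite as soon as t bounds the norm of M. *)
Definition gram_entry (t : R) M (l k : 'I_d) : R[i] :=
  (t *+ (l == k) / 2) +i* (M k l / 2).

Lemma antisymmetric_sum0 M (c : 'I_d -> 'I_d -> R) : antisymmetric_mx M ->
  (forall k l, c k l = c l k) -> \sum_l \sum_k M k l * c k l = 0.
Proof.
move=> aM cs; set S := \sum_l _.
have : S = - S.
  rewrite {1}/S exchange_big /= /S -sumrN; apply: eq_bigr => l _.
  rewrite -sumrN; apply: eq_bigr => k _.
  have := congr1 (fun N : 'M[R]_d => N k l) aM; rewrite !mxE => ->.
  by rewrite cs mulNr.
by move=> h; lra.
Qed.

(** With v = a + i b, the imaginary part pairs the antisymmetric [M] with a symmetric kernel and
    vanishes; the two cross terms in the real part coincide up to sign, which gives the factor 2. *)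
Lemma gram_form t M (v : 'I_d -> R[i]) : antisymmetric_mx M ->
  \sum_l \sum_k v l * Num.conj (v k) * gram_entry t M l k =
  ((t * (\sum_l nsq (v l)) -
   2 * \sum_k \sum_l complex.Re (v k) * M k l * complex.Im (v l)) / 2)%:C.
Proof.
move=> aM.
pose a l := complex.Re (v l); pose b l := complex.Im (v l).
have aE k l : M k l = - M l k.
  by have := congr1 (fun N : 'M[R]_d => N l k) aM; rewrite !mxE.
pose X l k := t *+ (l == k) / 2 * (a l * a k + b l * b k) - M k l / 2 * (b l * a k - a l * b k).
pose Y l k := t *+ (l == k) / 2 * (b l * a k - a l * b k) + M k l / 2 * (a l * a k + b l * b k).
have pt l k : v l * Num.conj (v k) * gram_entry t M l k = X l k +i* Y l k.
  rewrite /X /Y /a /b /gram_entry; case: (v l) (v k) => [x y] [z w].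
  by rewrite conjE; simpc => /=; congr (_ +i* _); ring.
transitivity ((\sum_l \sum_k X l k) +i* (\sum_l \sum_k Y l k)).
  rewrite -sum_complexE; apply: eq_bigr => l _.
  by rewrite -sum_complexE; apply: eq_bigr => k _; exact: pt.
rewrite /X /Y.
have diag (c : 'I_d -> 'I_d -> R) : \sum_l \sum_k t *+ (l == k) / 2 * c l k =
    t / 2 * \sum_l c l l.
  rewrite mulr_sumr; apply: eq_bigr => l _; rewrite (bigD1 l)//= eqxx mulr1n.
  by rewrite big1 ?addr0// => k kl; rewrite eq_sym (negPf kl) mulr0n !mul0r.
have -> : \sum_l \sum_k (t *+ (l == k) / 2 * (b l * a k - a l * b k) +
    M k l / 2 * (a l * a k + b l * b k)) = 0.
  under eq_bigr do rewrite big_split.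
  rewrite big_split /= (diag (fun l k => b l * a k - a l * b k)) big1 ?mulr0 ?add0r.
    under eq_bigr do under eq_bigr do rewrite -mulrA.
    by apply: (antisymmetric_sum0 aM) => k l; ring.
  by move=> l _; ring.
congr (_ +i* _).
under eq_bigr do rewrite big_split.
rewrite big_split /= (diag (fun l k => a l * a k + b l * b k)).
rewrite mulrBl mulrAC; congr (_ * _ + _).
rewrite mulrAC mulfV ?mul1r//.
under eq_bigr do rewrite sumrN.
rewrite sumrN; congr (- _).
have -> : \sum_l \sum_k M k l / 2 * (b l * a k - a l * b k) =
   2^-1 * (\sum_l \sum_k M k l * (a k * b l)) - 2^-1 * \sum_l \sum_k M k l * (a l * b k).
  rewrite !mulr_sumr -sumrB; apply: eq_bigr => l _.
  rewrite !mulr_sumr -sumrB; apply: eq_bigr => k _; ring.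
have -> : \sum_l \sum_k M k l * (a l * b k) = - \sum_l \sum_k M k l * (a k * b l).
  rewrite exchange_big -sumrN; apply: eq_bigr => l _; rewrite -sumrN.
  by apply: eq_bigr => k _; rewrite aE mulNr.
rewrite exchange_big /=.
have -> : \sum_k \sum_l M k l * (a k * b l) =
   \sum_k \sum_l complex.Re (v k) * M k l * complex.Im (v l).
  by do 2![apply: eq_bigr => ? _]; rewrite /a /b; ring.
by field.
Qed.

(** Positivity for t = |M|, used to factor the Gram matrix, and strict positivity for t > |M|, used
    for linear independence. *)
Lemma gram_form_ge t M (v : 'I_d -> R[i]) : antisymmetric_mx M ->
  ((t - mxopnorm M) / 2 * \sum_l nsq (v l))%:C <=
  \sum_l \sum_k v l * Num.conj (v k) * gram_entry t M l k.
Proof.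
move=> aM; rewrite gram_form// lecR.
have := bilinear_le M (\col_k complex.Re (v k)) (\col_k complex.Im (v k)).
have -> : sqn (\col_k complex.Re (v k)) + sqn (\col_k complex.Im (v k)) = \sum_l nsq (v l).
  by rewrite -big_split; apply: eq_bigr => l _; rewrite !mxE.
have -> : \sum_k \sum_l (\col_j complex.Re (v j)) k ord0 * M k l * (\col_j complex.Im (v j)) l ord0
  = \sum_k \sum_l complex.Re (v k) * M k l * complex.Im (v l).
  by do 2![apply: eq_bigr => ? _]; rewrite !mxE.
lra.
Qed.

End GramFactorization.
Section GramVectors.
Context {R : realType}.
Local Open Scope sesquilinear_scope.

(** The matrix is Hermitian, hence unitarily diagonalizable; its eigenvalues are values of the form
    at the rows of [P], so they have square roots, and these scale the conjugated eigenvector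
    entries. *)
Lemma gram_factor (d : nat) (t : R) (M : 'M[R]_d) :
  antisymmetric_mx M -> mxopnorm M <= t ->
  exists y : 'I_d -> 'I_d -> R[i], forall l k,
    \sum_i y l i * Num.conj (y k i) = gram_entry t M l k.
Proof.
move=> aM Mt; pose A : 'M[R[i]]_d := \matrix_(l, k) gram_entry t M l k.
have Ah : A ^t* = A.
  apply/matrixP => l k; rewrite !mxE /gram_entry [LHS]conjE eq_sym.
  by have := congr1 (fun N : 'M[R]_d => N l k) aM; rewrite !mxE => ->; rewrite mulNr.
have An : A \is normalmx by apply/normalmxP; rewrite Ah.
set P := spectralmx A; set D := spectral_diag A.
have Pu : P \is unitarymx by exact: spectral_unitarymx.
have AE : A = P ^t* *m diag_mx D *m P.
  rewrite -(invmx_unitary Pu); exact: (elimT (@orthomx_spectralP _ _ A) An).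
have DE i : D 0 i = \sum_l \sum_k P i l * Num.conj (P i k) * gram_entry t M l k.
  have -> : D 0 i = (P *m A *m P ^t*) i i.
    rewrite AE !mulmxA (unitarymxP Pu) mul1mx -mulmxA (unitarymxP Pu) mulmx1.
    by rewrite mxE eqxx mulr1n.
  rewrite mxE exchange_big /=; apply: eq_bigr => k _.
  rewrite mxE mulr_suml; apply: eq_bigr => l _.
  by rewrite !mxE mulrAC.
have D0 i : 0 <= D 0 i.
  rewrite DE; apply: le_trans (gram_form_ge t (fun l => P i l) aM).
  rewrite ler0c mulr_ge0 ?divr_ge0 ?subr_ge0//.
  by apply: sumr_ge0 => l _; exact: nsq_ge0.
have [r rP] : exists r : 'I_d -> R, forall i, 0 <= r i /\ D 0 i = (r i)%:C.
  exists (fun i => complex.Re (D 0 i)) => i; have Dr := RRe_real (ger0_real (D0 i)).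
  by split; rewrite ?Dr// -ler0c Dr.
exists (fun l i => Num.conj (P i l) * (Num.sqrt (r i))%:C) => l k.
have -> : gram_entry t M l k = A l k by rewrite mxE.
rewrite AE -mulmxA mxE; apply: eq_bigr => i _.
rewrite mul_diag_mx !mxE rmorphM /= conjCK conj_real (rP i).2.
have rs : (Num.sqrt (r i))%:C * (Num.sqrt (r i))%:C = (r i)%:C.
  by rewrite -rmorphM -expr2 sqr_sqrtr ?(rP i).1.
by rewrite mulrACA rs -mulrA [P i k * _]mulrC.
Qed.

Lemma gram_entry_im (d : nat) (t : R) (M : 'M[R]_d) l k :
  2 * complex.Im (gram_entry t M l k) = M k l.
Proof. by rewrite /gram_entry /= mulrCA mulfV ?mulr1. Qed.

Lemma gram_entry_diag (d : nat) (t : R) (M : 'M[R]_d) k :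
  antisymmetric_mx M -> gram_entry t M k k = (t / 2)%:C.
Proof.
move=> aM; have := congr1 (fun N : 'M[R]_d => N k k) aM; rewrite !mxE => Mkk.
by rewrite /gram_entry eqxx mulr1n (_ : M k k = 0) ?mul0r//; lra.
Qed.

Lemma weyl_config_ex (d : nat) (Theta Theta' : 'M[R]_d) :
  antisymmetric_mx Theta -> antisymmetric_mx Theta' ->
  exists (H K : hilbertType R) (iota : H -> K) (z : 'I_d -> K) (x : 'I_d -> H),
    weyl_config Theta Theta' iota z x.
Proof.
move=> aT aT'.
have aD : antisymmetric_mx (Theta' - Theta).
  by rewrite /antisymmetric_mx linearB /= aT aT' opprB opprK addrC.
(* The slack 1 makes the Gram matrix of the x_k positive definite, so that they are independent. No
   slack is allowed in t', because |y_k|^2 has to be exactly t' / 2. *)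
pose t := mxopnorm Theta + 1; pose t' := mxopnorm (Theta' - Theta).
have Tt : mxopnorm Theta <= t by rewrite lerDl.
have [x0 xE] := gram_factor aT Tt; have [y0 yE] := gram_factor aD (lexx t').
pose H := @l2 R 'I_d; pose K := @l2 R ('I_d * bool)%type.
pose x k : H := l2_fin (x0 k).
(* Two copies of C^d: [false] carries [H] and the x_k, [true] carries the y_k. The Gram matrices
   add, and so do their imaginary parts Theta and Theta' - Theta. *)
pose z k : K := l2_fin (fun p => if p.2 then y0 k p.1 else x0 k p.1).
pose xi (_ : 'I_d) : @l2 R bool := l2_delta false.
have xi1 i : dot (xi i) (xi i) = 1 by rewrite dot_delta.
pose iota : H -> K := amplify xi1.
have ii : isometric iota by exact: amplify_isometric.
have dotK (f g : K) : dot f g = \sum_i (f (i, true) * Num.conj (g (i, true)) +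
    f (i, false) * Num.conj (g (i, false))).
  rewrite dot_l2_fin; transitivity (\sum_i \sum_b f (i, b) * Num.conj (g (i, b))).
    by rewrite pair_bigA; apply: eq_bigr => -[].
  by apply: eq_bigr => i _; rewrite big_bool.
have xx l k : dot (x l) (x k) = gram_entry t Theta l k by rewrite dot_l2_fin xE.
have zz l k : dot (z l) (z k) = gram_entry t' (Theta' - Theta) l k + gram_entry t Theta l k.
  by rewrite dotK /= big_split xE yE.
have zg k g : dot (z k) (iota g) = dot (x k) g.
  rewrite dotK dot_l2_fin; apply: eq_bigr => i _ /=.
  by rewrite mulr0 rmorph0 mulr0 add0r mulr1.
have proj k : orthproj (range iota) (z k) = iota (x k) by exact: orthproj_range.
have xind : lin_indep x.
  move=> a ax; have := gram_form_ge t a aT.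
  have -> : \sum_l \sum_k a l * Num.conj (a k) * gram_entry t Theta l k = 0.
    transitivity (dot (\sum_l a l *: x l) (\sum_l a l *: x l)); last by rewrite ax dot0l.
    rewrite dot_suml; apply: eq_bigr => l _; rewrite dot_sumr; apply: eq_bigr => k _.
    by rewrite dotZl dotZr xx mulrA.
  rewrite lecR /t addrC addKr => h i; apply: nsq0_eq0.
  have n0 j : 0 <= nsq (a j) by exact: nsq_ge0.
  apply/eqP; rewrite eq_le n0 andbT; apply: (@le_trans _ _ (\sum_l nsq (a l))).
    by rewrite (bigD1 i)//= lerDl sumr_ge0.
  lra.
exists H, K, iota, z, x; split=> //.
- by apply: has_dim_l2; rewrite card_ord.
- by apply: has_dim_l2; rewrite card_prod card_ord card_bool mulnC.
- move=> a az; apply: xind; apply: l2_ext => i.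
  rewrite -!dot_delta dot0l dot_suml.
  have := dot0l (l2_delta (i, false) : K); rewrite -az dot_suml => {2}<-.
  by apply: eq_bigr => k _; rewrite !dotZl !dot_delta.
- by move=> k l; rewrite zz raddfD mulrDr !gram_entry_im !mxE subrK.
- by move=> k l; rewrite xx gram_entry_im.
- move=> k; rewrite (orthproj_compl_range ii (proj k)) -dot_norm.
  have -> : dot (z k - iota (x k)) (z k - iota (x k)) = gram_entry t' (Theta' - Theta) k k.
    rewrite dotDl !dotDr !dotNl !dotNr zg (dotC (z k) (iota (x k))) zg -dotC ii.2 zz xx.
    ring.
  by rewrite gram_entry_diag// mulrC.
Qed.

End GramVectors.
(** * Words and *-polynomials in the generators of a torus *)

Section TorusWords.
Context {R : realType}.
Variables (d : nat) (Theta : 'M[R]_d).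
Hypothesis aT : antisymmetric_mx Theta.
Implicit Types g h : 'rV[int]_d.

(** The indices of [Theta] are crossed so that the value at (e_l, e_k) is theta_(k,l), as in the
    relation for u_l u_k. *)
Definition twist g h : R := \sum_j \sum_k Theta j k * (g 0 k)%:~R * (h 0 j)%:~R.

Lemma twistDl g g' h : twist (g + g') h = twist g h + twist g' h.
Proof.
rewrite /twist -big_split; apply: eq_bigr => j _; rewrite -big_split.
by apply: eq_bigr => k _; rewrite mxE intrD mulrDr mulrDl.
Qed.

Lemma twistDr g h h' : twist g (h + h') = twist g h + twist g h'.
Proof.
rewrite /twist -big_split; apply: eq_bigr => j _; rewrite -big_split.
by apply: eq_bigr => k _; rewrite mxE intrD mulrDr.
Qed.

Lemma twistC g h : twist g h = - twist h g.
Proof.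
rewrite /twist exchange_big -sumrN; apply: eq_bigr => k _; rewrite -sumrN.
apply: eq_bigr => j _; have := congr1 (fun N : 'M[R]_d => N k j) aT; rewrite !mxE => ->.
ring.
Qed.

Lemma twistxx g : twist g g = 0.
Proof. by have := twistC g g; lra. Qed.

Lemma twistNl g h : twist (- g) h = - twist g h.
Proof.
apply/eqP; rewrite -subr_eq0 opprK -twistDl addNr /twist; apply/eqP.
by rewrite big1// => j _; rewrite big1// => k _; rewrite mxE mulr0 mul0r.
Qed.

Lemma twistNr g h : twist g (- h) = - twist g h.
Proof. by rewrite twistC twistNl opprK twistC. Qed.

Definition unitv (k : 'I_d) : 'rV[int]_d := delta_mx 0 k.

Lemma twist_unitv l k : twist (unitv l) (unitv k) = Theta k l.
Proof.
rewrite /twist (bigD1 k)//= [X in _ + X]big1 ?addr0; last first.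
  by move=> j jk; rewrite big1// => i _; rewrite !mxE (negPf jk) !mulr0.
rewrite (bigD1 l)//= big1 ?addr0; last first.
  by move=> i il; rewrite !mxE (negPf il) mulr0 mul0r.
by rewrite !mxE !eqxx !mulr1.
Qed.

(** A bicharacter whose square is the commutation factor. Halving the exponent is what makes
    inverses, conjugates and exchanged arguments all agree. *)
Definition phase g h : R[i] := cexp ('i * (twist g h / 2)%:C).

Lemma phaseDl g g' h : phase (g + g') h = phase g h * phase g' h.
Proof. by rewrite /phase -cexpD twistDl mulrDl rmorphD mulrDr. Qed.

Lemma phaseDr g h h' : phase g (h + h') = phase g h * phase g h'.
Proof. by rewrite /phase -cexpD twistDr mulrDl rmorphD mulrDr. Qed.

Lemma phase0l g : phase 0 g = 1.
Proof.
rewrite /phase (_ : twist 0 g = 0) ?mul0r ?mulr0 ?cexp0//.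
by have := twistDl 0 0 g; rewrite addr0; lra.
Qed.

Lemma norm_phase g h : `|phase g h| = 1. Proof. exact: cexp_imag_norm. Qed.

Lemma phase_neq0 g h : phase g h != 0.
Proof. by rewrite -normr_eq0 norm_phase oner_eq0. Qed.

Lemma phaseC g h : phase g h * phase h g = 1.
Proof.
by rewrite /phase -cexpD (twistC h g) mulNr rmorphN mulrN subrr cexp0.
Qed.

Lemma phaseNl g h : phase (- g) h = phase h g.
Proof. by rewrite /phase twistNl twistC opprK. Qed.

Lemma phaseNr g h : phase g (- h) = phase h g.
Proof. by rewrite /phase twistNr twistC opprK. Qed.

Lemma phasexx g : phase g g = 1.
Proof. by rewrite /phase twistxx mul0r mulr0 cexp0. Qed.

Lemma phase_conj g h : Num.conj (phase g h) = phase h g.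
Proof.
rewrite /phase conj_cexp twistC; congr cexp.
rewrite rmorphM /= conj_real mulNr rmorphN mulrN -mulNr; congr (_ * _).
by rewrite conjE; simpc.
Qed.

(* [(k, true)] stands for the k-th generator, [(k, false)] for its adjoint. *)
Definition letter := ('I_d * bool)%type.
Definition letter_deg (a : letter) : 'rV[int]_d := if a.2 then unitv a.1 else - unitv a.1.
Definition letter_inv (a : letter) : letter := (a.1, ~~ a.2).
Definition word_deg (w : seq letter) : 'rV[int]_d := \sum_(a <- w) letter_deg a.

(** The scalar between a word and the symmetrically ordered monomial of its degree. *)
Fixpoint word_phase (w : seq letter) : R[i] :=
  if w is a :: w' then phase (letter_deg a) (word_deg w') * word_phase w' else 1.

Lemma word_deg_cons a w : word_deg (a :: w) = letter_deg a + word_deg w.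
Proof. by rewrite /word_deg big_cons. Qed.

Lemma word_deg_perm w w' : perm_eq w w' -> word_deg w = word_deg w'.
Proof. by move=> ww'; rewrite /word_deg (perm_big _ ww'). Qed.

Lemma letter_deg_inv a : letter_deg (letter_inv a) = - letter_deg a.
Proof. by case: a => k [] /=; rewrite /letter_deg /= ?opprK. Qed.

Lemma norm_word_phase w : `|word_phase w| = 1.
Proof.
by elim: w => [|a w IH] /=; rewrite ?normr1// normrM norm_phase IH mulr1.
Qed.

Lemma word_phase_neq0 w : word_phase w != 0.
Proof. by rewrite -normr_eq0 norm_word_phase oner_eq0. Qed.

Lemma letter_deg_count a (k : 'I_d) : letter_deg a 0 k =
  (a == (k, true))%:Z - (a == (k, false))%:Z.
Proof.
case: a => j b; rewrite /letter_deg !xpair_eqE (eq_sym j) !(eq_sym b) /=.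
by case: b => /=; rewrite !mxE ?eqxx /=; case: (k == j).
Qed.

Lemma word_deg_count w k : word_deg w 0 k =
  (count_mem (k, true) w)%:Z - (count_mem (k, false) w)%:Z.
Proof.
elim: w => [|a w IH]; first by rewrite /word_deg big_nil mxE.
rewrite word_deg_cons mxE IH letter_deg_count /= !PoszD; ring.
Qed.

Section Evaluation.
Variables (B : cstarAlgType R) (v : 'I_d -> B).
Hypothesis vT : torus_rel Theta v.

Definition letter_ev (a : letter) : B := if a.2 then v a.1 else star (v a.1).
Definition word_ev (w : seq letter) : B := foldr (fun a x => cmul (letter_ev a) x) cone w.

Lemma cmul_star_comm (x y : B) (q : R[i]) : unitary y -> q != 0 ->
  cmul x y = q *: cmul y x -> cmul x (star y) = q^-1 *: cmul (star y) x.
Proof.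
move=> [y1 y2] q0 xy.
have : cmul (star y) (cmul (cmul x y) (star y)) = q *: cmul x (star y).
  by rewrite xy cmulZl cmulZr -cmulA cmulA y1 cmul1l.
rewrite -cmulA y2 cmul1r => ->.
by rewrite scalerA mulVf// scale1r.
Qed.

Lemma star1 : star cone = cone :> B.
Proof. by rewrite -[LHS]cmul1l -[X in cmul X _]starK -starM cmul1l starK. Qed.

Lemma unitary_star (x : B) : unitary x -> unitary (star x).
Proof. by move=> [x1 x2]; split; rewrite starK. Qed.

Lemma letter_unitary a : unitary (letter_ev a).
Proof.
by case: a => k []; rewrite /letter_ev /=; [|apply: unitary_star]; exact: vT.1.
Qed.

Lemma letter_comm a b : cmul (letter_ev a) (letter_ev b) =
  phase (letter_deg a) (letter_deg b) ^+ 2 *: cmul (letter_ev b) (letter_ev a).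
Proof.
have base l k : cmul (v l) (v k) = phase (unitv l) (unitv k) ^+ 2 *: cmul (v k) (v l).
  rewrite vT.2; congr (_ *: _); rewrite /phase expr2 -cexpD twist_unitv -mulrDr -rmorphD.
  by congr (cexp (_ * _%:C)); field.
have inv g h : (phase g h ^+ 2)^-1 = phase h g ^+ 2.
  rewrite -exprVn; congr (_ ^+ 2); apply: (mulfI (phase_neq0 g h)).
  by rewrite phaseC mulfV ?phase_neq0.
have q0 g h : phase g h ^+ 2 != 0 by rewrite expf_neq0 ?phase_neq0.
have right l (b0 : letter) : cmul (v l) (letter_ev b0) =
    phase (unitv l) (letter_deg b0) ^+ 2 *: cmul (letter_ev b0) (v l).
  case: b0 => k []; rewrite /letter_ev /letter_deg /=; first exact: base.
  by rewrite (cmul_star_comm (vT.1 k) (q0 _ _) (base l k)) inv phaseNr.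
case: a => l []; first exact: right.
have E : cmul (letter_ev b) (v l) = phase (letter_deg b) (unitv l) ^+ 2 *: cmul (v l) (letter_ev b).
  by rewrite right scalerA -exprMn phaseC expr1n scale1r.
have := cmul_star_comm (vT.1 l) (q0 _ _) E; rewrite inv => E'.
rewrite /letter_ev /letter_deg /= -/(letter_ev b) -/(letter_deg b) E' scalerA -exprMn.
by rewrite phaseNl phaseC expr1n scale1r.
Qed.

Lemma letter_ev_inv a : cmul (letter_ev a) (letter_ev (letter_inv a)) = cone.
Proof.
case: a => k []; rewrite /letter_ev /letter_inv /=; first by have [_ ->] := vT.1 k.
by have [-> _] := vT.1 k.
Qed.

(* A word divided by its phase: this depends only on the degree of the word
   ([word_nf_deg]). *)
Definition word_nf (w : seq letter) : B := (word_phase w)^-1 *: word_ev w.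

Lemma word_nf_cons a w : word_nf (a :: w) =
  (phase (letter_deg a) (word_deg w))^-1 *: cmul (letter_ev a) (word_nf w).
Proof. by rewrite /word_nf /= cmulZr scalerA invfM. Qed.

Lemma word_evE w : word_ev w = word_phase w *: word_nf w.
Proof. by rewrite /word_nf scalerA mulfV ?scale1r// word_phase_neq0. Qed.

Lemma word_nf_swap a b w : word_nf [:: a, b & w] = word_nf [:: b, a & w].
Proof.
rewrite !word_nf_cons !cmulZr !cmulA letter_comm cmulZl !scalerA; congr (_ *: _).
rewrite !word_deg_cons !phaseDr.
have n0 g h := phase_neq0 g h; have := phaseC (letter_deg a) (letter_deg b).
move: (phase (letter_deg a) (letter_deg b)) (phase (letter_deg b) (letter_deg a))
  (n0 (letter_deg a) (letter_deg b)) (n0 (letter_deg b) (letter_deg a)) => p q p0 q0 pq.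
move: (phase (letter_deg a) (word_deg w)) (phase (letter_deg b) (word_deg w))
  (n0 (letter_deg a) (word_deg w)) (n0 (letter_deg b) (word_deg w)) => r s r0 s0.
have -> : q = p^-1 by apply: (mulfI p0); rewrite pq mulfV.
by field; rewrite p0 r0 s0 word_phase_neq0.
Qed.

Lemma word_nf_cancel a w : word_nf [:: a, letter_inv a & w] = word_nf w.
Proof.
rewrite !word_nf_cons word_deg_cons letter_deg_inv !cmulZr cmulA letter_ev_inv cmul1l.
rewrite scalerA phaseDr phaseNr phaseNl phasexx mul1r.
by rewrite scalerA mulrA -[X in (X * _) *: _]invfM phaseC invr1 mul1r.
Qed.

Lemma word_nf_congr a w w' : word_deg w = word_deg w' -> word_nf w = word_nf w' ->
  word_nf (a :: w) = word_nf (a :: w').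
Proof. by move=> dw nw; rewrite !word_nf_cons dw nw. Qed.

Lemma word_nf_move a w w' : word_nf (w ++ a :: w') = word_nf (a :: w ++ w').
Proof.
elim: w => [//|b w IH] /=; rewrite -word_nf_swap.
apply: word_nf_congr => //.
by apply: word_deg_perm; rewrite -cat1s perm_catCA.
Qed.

Lemma word_nf_perm w w' : perm_eq w w' -> word_nf w = word_nf w'.
Proof.
elim: w w' => [|a w IH] w' ww'; first by move: ww'; rewrite perm_sym => /perm_nilP ->.
have aw' : a \in w' by rewrite -(perm_mem ww') mem_head.
case/splitPr: aw' ww' => p q apq; rewrite word_nf_move.
have wpq : perm_eq w (p ++ q).
  by rewrite -(perm_cons a) (perm_trans apq)// -cat1s perm_catCA.
by apply: word_nf_congr; [exact: word_deg_perm|exact: IH].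
Qed.

(** Induction on the total length. The first letter [a] either occurs in the other word, and is
    stripped from both, or meets its inverse in its own word, and cancels; one of these must happen,
    by the sign of the degree in the coordinate of [a]. *)
Lemma word_nf_deg w w' : word_deg w = word_deg w' -> word_nf w = word_nf w'.
Proof.
have [n] := ubnP (size w + size w'); elim: n w w' => // n IH.
have main a w w' : (size (a :: w) + size w' < n.+1)%N -> word_deg (a :: w) = word_deg w' ->
    word_nf (a :: w) = word_nf w'.
  move=> sz dw; have [aw'|aw'] := boolP (a \in w').
    have pw' := perm_to_rem aw'; rewrite (word_nf_perm pw').
    have dr : word_deg w = word_deg (rem a w').
      apply: (addrI (letter_deg a)).
      by rewrite -!word_deg_cons dw; exact: word_deg_perm.
    apply: word_nf_congr => //; apply: IH => //.
    by move: sz; rewrite (perm_size pw') /= addSn addnS ltnS; exact: ltnW.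
  have [aw|aw] := boolP (letter_inv a \in w).
    have pw := perm_to_rem aw.
    have -> : word_nf (a :: w) = word_nf (rem (letter_inv a) w).
      rewrite -[RHS](word_nf_cancel a); apply: word_nf_perm.
      by rewrite perm_cons.
    apply: IH; first by move: sz; rewrite /= (perm_size pw) /= !addSn ltnS; exact: ltnW.
    rewrite -dw word_deg_cons (word_deg_perm pw) word_deg_cons letter_deg_inv.
    by rewrite addrA subrr add0r.
  (* For a = (k, true), the left word has no inverse of [a], so its degree at k is at least 1; the
     right word has no [a], so its degree at k is at most 0. The case [false] is symmetric. *)
  exfalso; have := congr1 (fun g : 'rV[int]_d => g 0 a.1) dw.
  rewrite word_deg_cons mxE !word_deg_count letter_deg_count.
  move: aw aw'; rewrite -!has_pred1 !has_count -!leqNgt !leqn0.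
  by case: (a) => k []; rewrite /letter_inv /= !xpair_eqE !eqxx /= => /eqP-> /eqP->; lia.
move=> [|a w] w' sz dw; last exact: main.
case: w' sz dw => [//|a w'] sz dw; apply/esym/main => //.
by rewrite addnC.
Qed.

End Evaluation.
End TorusWords.

(** * Norm estimates in C*-algebras *)

Section CStarNorm.
Context {R : realType}.
Variable A : cstarAlgType R.
Implicit Types x y : A.

Lemma rnorm_cmul x y : rnorm (cmul x y) <= rnorm x * rnorm y.
Proof. by rewrite -lecR rmorphM /= !rnormE cmul_norm. Qed.

Lemma cstar_rnorm x : rnorm (cmul (star x) x) = rnorm x ^+ 2.
Proof. by apply: complexI; rewrite rmorphXn /= !rnormE cstar_norm. Qed.

Lemma rnorm_star_le x : rnorm x <= rnorm (star x).
Proof.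
have [->|x0] := eqVneq (rnorm x) 0; first exact: rnorm_ge0.
have px : 0 < rnorm x by rewrite lt_def x0 rnorm_ge0.
by rewrite -(ler_pM2r px) -expr2 -cstar_rnorm rnorm_cmul.
Qed.

Lemma rnorm_star x : rnorm (star x) = rnorm x.
Proof.
apply/eqP; rewrite eq_le rnorm_star_le andbT.
by have := rnorm_star_le (star x); rewrite starK.
Qed.

(** Only an upper bound: in the zero algebra the unit has norm 0. *)
Lemma unitary_rnorm_le1 x : unitary x -> rnorm x <= 1.
Proof.
move=> [x1 _]; have one : rnorm (cone : A) <= 1.
  have [->|n0] := eqVneq (rnorm (cone : A)) 0; first exact: ler01.
  have := cstar_rnorm (cone : A); rewrite star1 cmul1l => E.
  have pn : 0 < rnorm (cone : A) by rewrite lt_def n0 rnorm_ge0.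
  by rewrite -(ler_pM2l pn) mulr1 -expr2 -E.
rewrite -(@ler_pXn2r _ 2)// ?nnegrE ?rnorm_ge0//.
by rewrite expr1n -cstar_rnorm x1.
Qed.

Lemma cmul_sumr x (I : Type) (s : seq I) (f : I -> A) :
  cmul x (\sum_(i <- s) f i) = \sum_(i <- s) cmul x (f i).
Proof.
elim: s => [|i s IH]; last by rewrite !big_cons cmulDr IH.
by rewrite !big_nil -[X in cmul x X](scale0r (0 : A)) cmulZr scale0r.
Qed.

Lemma cmul_suml x (I : Type) (s : seq I) (f : I -> A) :
  cmul (\sum_(i <- s) f i) x = \sum_(i <- s) cmul (f i) x.
Proof.
elim: s => [|i s IH]; last by rewrite !big_cons cmulDl IH.
by rewrite !big_nil -[X in cmul X x](scale0r (0 : A)) cmulZl scale0r.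
Qed.

Lemma star_sum (I : Type) (s : seq I) (f : I -> A) :
  star (\sum_(i <- s) f i) = \sum_(i <- s) star (f i).
Proof.
elim: s => [|i s IH]; last by rewrite !big_cons starD IH.
by rewrite !big_nil -[X in star X](scale0r (0 : A)) starZ rmorph0 scale0r.
Qed.

Lemma rnorm_sum (I : Type) (s : seq I) (f : I -> A) :
  rnorm (\sum_(i <- s) f i) <= \sum_(i <- s) rnorm (f i).
Proof.
elim: s => [|i s IH]; first by rewrite !big_nil rnorm0.
by rewrite !big_cons; apply: le_trans (rnormD _ _) _; rewrite lerD2l.
Qed.

End CStarNorm.

Section RealGrowth.
Context {R : realType}.

Lemma expr_unbounded (r M : R) : 1 < r -> exists n, M <= r ^+ n.
Proof.
move=> r1; have e0 : 0 < r - 1 by rewrite subr_gt0.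
have bern n : 1 + n%:R * (r - 1) <= r ^+ n.
  elim: n => [|n IH]; first by rewrite mul0r addr0 expr0.
  rewrite exprS; apply: le_trans (ler_wpM2l (ltW (lt_trans ltr01 r1)) IH).
  have : 0 <= n%:R * ((r - 1) * (r - 1)) by rewrite mulr_ge0// mulr_ge0 ?ltW.
  rewrite -natr1; lra.
pose n := Num.truncn (`|M| / (r - 1)); exists n.+1.
apply: le_trans (bern _); apply: le_trans (ler_norm M) _.
have : `|M| / (r - 1) < n.+1%:R by rewrite truncnS_gt// divr_ge0// ltW.
by rewrite ltr_pdivrMr//; lra.
Qed.

(* The estimate up to a polynomial factor improves itself, by taking roots. *)
Lemma power_trick (a b : R) (L d : nat) : 0 <= a -> 0 <= b ->
  (forall n, a ^+ (2 ^ n) <= ((2 * (L * 2 ^ n) + 1) ^ d)%:R * b ^+ (2 ^ n)) -> a <= b.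
Proof.
move=> a0 b0 ab; rewrite leNgt; apply/negP => ba.
have [b00|b1] := eqVneq b 0.
  have := ab 0%N; rewrite b00 expr1 mulr0 => a1.
  by move: ba; rewrite b00 ltNge a1.
have pb : 0 < b by rewrite lt_def b1.
pose r := a / b; have r1 : 1 < r by rewrite ltr_pdivlMr// mul1r.
pose K : R := ((2 * L + 1) ^ d)%:R; pose D : R := (2 ^ d)%:R.
have D1 : 1 <= D by rewrite ler1n expn_gt0.
(* A polynomial of degree [d] in 2^n is only exponential in n, whereas the left side is doubly
   exponential. *)
have rb n : r ^+ (2 ^ n) <= K * D ^+ n.
  rewrite /r expr_div_n ler_pdivrMr ?exprn_gt0//; apply: le_trans (ab n) _.
  rewrite ler_wpM2r ?exprn_ge0// /K /D -natrX -natrM ler_nat.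
  have -> : ((2 ^ d) ^ n = (2 ^ n) ^ d)%N by rewrite -!expnM mulnC.
  rewrite -expnMn; case: (d) => [//|k]; rewrite leq_exp2r//.
  have : (0 < 2 ^ n)%N by rewrite expn_gt0.
  by move: (2 ^ n)%N => m; nia.
have r0 : 0 < r by exact: lt_trans ltr01 r1.
(* For this [m], (2 D)^n <= r^(2^m n) <= r^(2^(n + m)) <= K D^(n + m), hence 2^n <= K D^m for all n,
   which is absurd. *)
have [m mP] := expr_unbounded (2 * D) r1.
have {mP} mP : 2 * D <= r ^+ (2 ^ m).
  by apply: le_trans mP _; rewrite ler_weXn2l ?(ltW r1)// ltnW// ltn_expl.
have D0 : 0 < D by exact: lt_le_trans ltr01 D1.
have [n nP] := expr_unbounded (K * D ^+ m + 1) (ltr1n R 2).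
suff : 2 ^+ n <= K * D ^+ m by lra.
rewrite -(ler_pM2r (exprn_gt0 n D0)) -mulrA -exprD addnC -exprMn.
apply: le_trans (rb (n + m)%N).
rewrite expnD mulnC exprM; apply: (@le_trans _ _ ((r ^+ (2 ^ m)) ^+ n)).
  by rewrite lerXn2r// ?nnegrE ?mulr_ge0 ?exprn_ge0 ?(ltW r0) ?(ltW D0).
by rewrite ler_weXn2l ?exprn_ege1 ?(ltW r1)// ltnW// ltn_expl.
Qed.
End RealGrowth.

(** * Coefficients, growth of degrees and norm domination *)

Section TorusPolynomials.
Context {R : realType}.
Variables (d : nat) (Theta : 'M[R]_d).
Hypothesis aT : antisymmetric_mx Theta.

(* *-polynomials in the generators, as lists of coefficients and words *)
Definition poly_t := seq (R[i] * seq (letter d)).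

Definition poly_ev (B : cstarAlgType R) (v : 'I_d -> B) (p : poly_t) : B :=
  \sum_(q <- p) q.1 *: word_ev v q.2.

(** The coefficient after words of equal degree are merged into one symmetrically ordered monomial;
    words are weighted by their phase for this reason. *)
Definition poly_coef (p : poly_t) (g : 'rV[int]_d) : R[i] :=
  \sum_(q <- p | word_deg q.2 == g) q.1 * word_phase Theta q.2.

Definition poly_degs (p : poly_t) : seq 'rV[int]_d :=
  undup [seq word_deg q.2 | q <- p].

Definition poly_mul (p q : poly_t) : poly_t :=
  [seq (a.1 * b.1, a.2 ++ b.2) | a <- p, b <- q].

Definition word_star (w : seq (letter d)) : seq (letter d) := rev (map (@letter_inv d) w).

Definition poly_star (p : poly_t) : poly_t :=
  [seq (Num.conj a.1, word_star a.2) | a <- p].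

(** Repeated squaring rather than powers: the C*-identity gives the norm of p^(2^n) exactly when p
    is self-adjoint. *)
Definition poly_sq (p : poly_t) (n : nat) : poly_t := iter n (fun q => poly_mul q q) p.

Definition poly_size_le (L : nat) (p : poly_t) : Prop :=
  forall q, q \in p -> (size q.2 <= L)%N.

Section Evaluation.
Variables (B : cstarAlgType R) (v : 'I_d -> B).

Lemma word_ev_cat w w' : word_ev v (w ++ w') = cmul (word_ev v w) (word_ev v w').
Proof. by elim: w => [|a w IH] /=; rewrite ?cmul1l// IH cmulA. Qed.

Lemma poly_ev_mul p q : poly_ev v (poly_mul p q) = cmul (poly_ev v p) (poly_ev v q).
Proof.
rewrite /poly_ev /poly_mul big_allpairs_dep cmul_suml; apply: eq_bigr => a _.
rewrite cmul_sumr; apply: eq_bigr => b _ /=.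
by rewrite word_ev_cat cmulZl cmulZr scalerA.
Qed.

Lemma letter_ev_star a : letter_ev v (letter_inv a) = star (letter_ev v a).
Proof. by case: a => k []; rewrite /letter_ev /= ?starK. Qed.

Lemma word_ev_star w : word_ev v (word_star w) = star (word_ev v w).
Proof.
elim: w => [|a w IH]; first by rewrite /= star1.
rewrite /word_star /= rev_cons -cats1 word_ev_cat -/(word_star w) IH starM.
by rewrite /= letter_ev_star cmul1r.
Qed.

Lemma poly_ev_star p : poly_ev v (poly_star p) = star (poly_ev v p).
Proof.
rewrite /poly_ev /poly_star big_map star_sum; apply: eq_bigr => a _ /=.
by rewrite word_ev_star starZ.
Qed.

Lemma poly_ev_sq_star p n : star (poly_ev v p) = poly_ev v p ->
  star (poly_ev v (poly_sq p n)) = poly_ev v (poly_sq p n).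
Proof.
by move=> sp; elim: n => [//|n IH]; rewrite /poly_sq iterS poly_ev_mul starM IH.
Qed.

Lemma rnorm_poly_sq p n : star (poly_ev v p) = poly_ev v p ->
  rnorm (poly_ev v (poly_sq p n)) = rnorm (poly_ev v p) ^+ (2 ^ n).
Proof.
move=> sp; elim: n => [|n IH]; first by rewrite expr1.
rewrite /poly_sq iterS poly_ev_mul -[X in cmul X _](poly_ev_sq_star n sp) cstar_rnorm.
by rewrite IH -exprM expnSr.
Qed.

Hypothesis vT : torus_rel Theta v.

Lemma rnorm_word_ev w : rnorm (word_ev v w) <= 1.
Proof.
elim: w => [|a w IH] /=.
  by apply: unitary_rnorm_le1; split; rewrite star1 cmul1l.
apply: le_trans (rnorm_cmul _ _) _; rewrite mulr_ile1 ?rnorm_ge0//.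
apply: unitary_rnorm_le1; exact: (letter_unitary vT).
Qed.

Lemma rnorm_word_nf w : rnorm (word_nf Theta v w) <= 1.
Proof.
rewrite /word_nf rnormZ normrV ?unitfE ?word_phase_neq0// norm_word_phase invr1 mul1r.
exact: rnorm_word_ev.
Qed.

Lemma poly_evE p : exists nf : 'rV[int]_d -> B, (forall g, rnorm (nf g) <= 1) /\
  poly_ev v p = \sum_(g <- poly_degs p) poly_coef p g *: nf g.
Proof.
(* Some word represents each degree that occurs; by [word_nf_deg] its choice is immaterial. *)
pose nf g := word_nf Theta v (xget [::] [set w | word_deg w = g]).
exists nf; split=> [g|]; first exact: rnorm_word_nf.
have nfE w : word_ev v w = word_phase Theta w *: nf (word_deg w).
  rewrite (word_evE Theta); congr (_ *: _); apply: (word_nf_deg aT vT).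
  have := @xgetPex _ [::] [set u | word_deg u = word_deg w].
  by move=> /(_ (ex_intro _ w erefl))/= ->.
transitivity (\sum_(g <- poly_degs p) \sum_(q <- p | word_deg q.2 == g)
    (q.1 * word_phase Theta q.2) *: nf g); last first.
  by apply: eq_bigr => g _; rewrite scaler_suml.
rewrite (exchange_big_dep xpredT)//= /poly_ev; apply: eq_big_seq => q qp.
rewrite big_mkcond (bigD1_seq (word_deg q.2)) ?undup_uniq//=; last first.
  by rewrite mem_undup; apply/mapP; exists q.
rewrite eqxx big1 ?addr0 => [|g]; first by rewrite nfE scalerA.
by rewrite eq_sym => /negPf ->.
Qed.

End Evaluation.

Lemma poly_size_mul L M p q : poly_size_le L p -> poly_size_le M q ->
  poly_size_le (L + M) (poly_mul p q).
Proof.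
move=> pL qM _ /allpairsP[[a b] /= [ap bq ->]] /=; rewrite size_cat.
by rewrite leq_add ?pL ?qM.
Qed.

Lemma poly_size_sq L p n : poly_size_le L p -> poly_size_le (L * 2 ^ n) (poly_sq p n).
Proof.
move=> pL; elim: n => [|n IH]; first by rewrite muln1.
by rewrite /poly_sq iterS expnS mul2n -addnn mulnDr; exact: poly_size_mul.
Qed.

Lemma poly_size_ex p : exists L, poly_size_le L p.
Proof.
exists (\max_(q <- p) size q.2)%N => q qp.
by rewrite (big_rem q)//= leq_maxl.
Qed.

Lemma word_deg_bound (w : seq (letter d)) L k : (size w <= L)%N ->
  - (L%:Z) <= word_deg w 0 k <= L%:Z.
Proof.
move=> wL; rewrite word_deg_count.
have h (a : pred (letter d)) : (count a w <= L)%N := leq_trans (count_size _ _) wL.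
move: (h (pred1 (k, true))) (h (pred1 (k, false))).
by move: (count_mem _ w) (count_mem _ w) => x y; lia.
Qed.

(** The degrees lie in the box [-L, L]^d; shifting by [L] encodes them injectively as maps into
    ['I_(2 * L).+1]. *)
Lemma size_poly_degs L p : poly_size_le L p ->
  (size (poly_degs p) <= (2 * L + 1) ^ d)%N.
Proof.
move=> pL.
pose f (g : 'rV[int]_d) : {ffun 'I_d -> 'I_(2 * L).+1} :=
  [ffun k => inord (absz (g ord0 k + L%:Z))].
have bnd g : g \in poly_degs p -> forall k, - (L%:Z) <= g 0 k <= L%:Z.
  rewrite mem_undup => /mapP[q qp ->] k; exact: word_deg_bound (pL _ qp).
have uf : uniq (map f (poly_degs p)).
  rewrite map_inj_in_uniq ?undup_uniq// => g h gp hp /ffunP fgh.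
  apply/rowP => k; have := congr1 val (fgh k); rewrite !ffunE /=.
  have := bnd _ gp k; have := bnd _ hp k.
  move: (g 0 k) (h 0 k) => x y hy hx; rewrite !inordK; lia.
rewrite -(size_map f) -(card_uniqP uf); apply: leq_trans (max_card _) _.
by rewrite card_ffun !card_ord addn1.
Qed.

Section Domination.
Variables (B C : cstarAlgType R) (v : 'I_d -> B) (U : 'I_d -> C).
Hypotheses (vT : torus_rel Theta v)
  (UC : forall p g, `|poly_coef p g| <= `|poly_ev U p|).

Lemma poly_dominated L p : poly_size_le L p ->
  rnorm (poly_ev v p) <= ((2 * L + 1) ^ d)%:R * rnorm (poly_ev U p).
Proof.
move=> pL; have [nf [nf1 ->]] := poly_evE vT p.
apply: le_trans (rnorm_sum _ _) _.
apply: (@le_trans _ _ (\sum_(g <- poly_degs p) rnorm (poly_ev U p))).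
  apply: ler_sum => g _; apply: (@le_trans _ _ (rnorm (poly_ev U p) * rnorm (nf g))).
    by apply: cabs_rnormZ; rewrite rnormE.
  by rewrite ler_piMr ?rnorm_ge0.
rewrite big_const_seq count_predT iter_addr_0 -[leLHS]mulr_natl ler_wpM2r ?rnorm_ge0//.
by rewrite ler_nat size_poly_degs.
Qed.

(* Apply [poly_dominated] to the powers (p^* p)^(2^n). *)
Lemma rnorm_poly_le p : rnorm (poly_ev v p) <= rnorm (poly_ev U p).
Proof.
pose h := poly_mul (poly_star p) p.
have hE (D : cstarAlgType R) (u : 'I_d -> D) :
    poly_ev u h = cmul (star (poly_ev u p)) (poly_ev u p).
  by rewrite poly_ev_mul poly_ev_star.
have hs (D : cstarAlgType R) (u : 'I_d -> D) : star (poly_ev u h) = poly_ev u h.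
  by rewrite hE starM starK.
rewrite -(@ler_pXn2r _ 2)// ?nnegrE ?rnorm_ge0//.
rewrite -!cstar_rnorm -!hE.
have [L pL] := poly_size_ex h.
apply: (@power_trick _ _ _ L d); rewrite ?rnorm_ge0// => n.
by rewrite -!rnorm_poly_sq//; apply/poly_dominated/poly_size_sq.
Qed.

End Domination.
End TorusPolynomials.
(** * Isometric representations of tori *)

Section Contractivity.
Context {R : realType}.

(** The partial sums of the geometric series are Cauchy. A left inverse is enough for the lower
    bound on 1 - S^* S / s drawn from it. *)
Lemma neumann (A : cstarAlgType R) (x : A) : rnorm x < 1 ->
  exists y, cmul y (cone - x) = cone.
Proof.
move=> x1; set r := rnorm x in x1; have r0 : 0 <= r by exact: rnorm_ge0.
pose xp n := iter n (fun y => cmul y x) cone.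
have one : rnorm (cone : A) <= 1.
  by apply: unitary_rnorm_le1; split; rewrite star1 cmul1l.
have xpn n : rnorm (xp n) <= r ^+ n.
  elim: n => [//|n IH]; rewrite exprSr /=; apply: le_trans (rnorm_cmul _ _) _.
  by rewrite ler_wpM2r.
pose y n := \sum_(k < n) xp k.
have yx n : y n - cmul (y n) x = cone - xp n.
  elim: n => [|n IH].
    rewrite /y big_ord0 -[X in cmul X x](scale0r (0 : A)) cmulZl scale0r subrr.
    by rewrite subrr.
  rewrite /y big_ord_recr /= -/(y n) cmulDl opprD addrACA IH.
  by rewrite addrA subrK.
have r1 : 0 < 1 - r by rewrite subr_gt0.
have yB m n : (m <= n)%N -> rnorm (y m - y n) <= r ^+ m / (1 - r).
  move=> mn; rewrite rnorm_distC.
  suff : rnorm (y n - y m) <= (r ^+ m - r ^+ n) / (1 - r).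
    move/le_trans; apply; rewrite ler_pM2r ?invr_gt0//.
    by rewrite gerBl exprn_ge0.
  elim: n mn => [|n IH]; first by rewrite leqn0 => /eqP ->; rewrite !subrr rnorm0 mul0r.
  rewrite leq_eqVlt => /orP[/eqP->|]; first by rewrite !subrr rnorm0 mul0r.
  rewrite ltnS => mn; rewrite /y big_ord_recr /= addrAC -/(y n) -/(y m).
  apply: le_trans (rnormD _ _) _.
  apply: le_trans (lerD (IH mn) (xpn n)) _.
  rewrite le_eqVlt; apply/orP; left; apply/eqP; rewrite exprS; field.
  by rewrite gt_eqF.
have small (e : R) : 0 < e -> exists N, forall n, (N <= n)%N -> r ^+ n <= e.
  move=> e0; have : r ^+ n @[n --> \oo] --> 0 by apply: cvg_expr; rewrite ger0_norm.
  move=> /cvgrPdist_le/(_ _ e0)[N _ NP]; exists N => n /NP /=.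
  by rewrite sub0r normrN ger0_norm ?exprn_ge0.
pose F := y @ \oo.
have tail (e : R) : 0 < e -> exists N, r ^+ N <= e /\ F [set z | rnorm (y N - z) <= e].
  move=> e0; have e1 : 0 < Num.min e (e * (1 - r)) by rewrite lt_min e0 mulr_gt0.
  have [N NP] := small _ e1; exists N; have := NP N (leqnn N).
  rewrite le_min => /andP[h1 h2]; split=> //; exists N => // n /= Nn.
  by apply: le_trans (yB _ _ Nn) _; rewrite ler_pdivrMr.
have cF : cauchy F.
  apply: cauchy_real => e e0; have e2 : 0 < e / 2 by rewrite divr_gt0.
  have [N [_ FN]] := tail _ e2; exists (y N); apply: filterS FN => z /= /le_lt_trans; apply.
  by rewrite ltr_pdivrMr// mulrDr mulr1 ltrDl.
have [l Fl] := cauchy_filter_lim _ cF.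
exists l; apply/eqP; rewrite -subr_eq0; apply/eqP; apply: (@rnorm_small _ _ _ 3) => // e e0.
have [N [rN FN]] := tail _ e0; have yl := Fl _ _ FN.
have -> : cmul l (cone - x) - cone = (cmul (y N - l) x - (y N - l)) - xp N.
  rewrite cmulDr cmul1r -[- x]scaleN1r cmulZr scaleN1r.
  rewrite cmulDl -[- l]scaleN1r cmulZl !scaleN1r.
  have -> : xp N = cone - (y N - cmul (y N) x) by rewrite yx opprB addrC subrK.
  move: (cmul (y N) x) (cmul l x) (y N) => p b c.
  rewrite !opprB [RHS]addrA; congr (_ - _).
  rewrite -[RHS]addrA (addrA (l - c)) subrK [RHS]addrC [RHS]addrA subrK.
  by [].
apply: le_trans (rnormD _ _) _; rewrite rnormN.
have h1 : rnorm (cmul (y N - l) x - (y N - l)) <= e + e.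
  apply: le_trans (rnormD _ _) _; rewrite rnormN lerD//.
  apply: le_trans (rnorm_cmul _ _) _; apply: le_trans _ yl.
  by rewrite ler_piMr ?rnorm_ge0// ltW.
have h2 := le_trans (xpn N) rN; lra.
Qed.

(* With S = psi a and s = |S|^2 > |a|^2, the element 1 - a^* a / s is invertible,
   hence so is 1 - S^* S / s; this forces |S|^2 < s. *)
Lemma star_hom_contractive (A : cstarAlgType R) (H : hilbertType R) (psi : A -> bop H) a :
  star_hom psi -> rnorm (psi a) <= rnorm a.
Proof.
move=> hpsi; set S := psi a; rewrite leNgt; apply/negP => aS.
have S0 : 0 < rnorm S by apply: le_lt_trans aS; exact: rnorm_ge0.
set s := rnorm S ^+ 2; have s0 : 0 < s by rewrite exprn_gt0.
pose h := cmul (star a) a; pose x := (s^-1)%:C *: h.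
have x1 : rnorm x < 1.
  rewrite /x rnormZ ger0_norm ?ler0c ?invr_ge0 ?(ltW s0)// /h cstar_rnorm mulrC.
  by rewrite ltr_pdivrMr// mul1r ltrXn2r// ?rnorm_ge0.
have [y yx] := neumann x1.
set N := rnorm (psi y); have N0 : 0 <= N by exact: rnorm_ge0.
pose Sa := star S.
have key v : rnorm v <= N * rnorm (v - (s^-1)%:C *: Sa (S v)).
  have E : psi (cone - x) = cone - (s^-1)%:C *: cmul Sa S.
    rewrite addrC -scaleN1r (shom_lin hpsi)// scaleN1r addrC (shom_one hpsi).
    congr (_ - _); rewrite /x -[_ *: h]addr0 (shom_lin hpsi)//.
    have -> : psi 0 = 0.
      have := shom_lin hpsi (-1) (I : setT 0) (I : setT 0).
      by rewrite scaler0 addr0 scaleN1r addNr.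
    by rewrite addr0 /h (shom_mul hpsi)// (shom_star hpsi).
  have : cmul (psi y) (psi (cone - x)) v = v.
    by rewrite -(shom_mul hpsi)// yx (shom_one hpsi).
  rewrite E => {1}<-.
  exact: (le_opnorm (psi y)).
have San w : rnorm (Sa w) ^+ 2 <= s * rnorm w ^+ 2.
  rewrite /s -exprMn ler_pXn2r// ?nnegrE ?mulr_ge0 ?rnorm_ge0//.
  by have := le_opnorm Sa w; rewrite -[opnorm Sa]/(rnorm Sa) rnorm_star.
(* The bound from [key] and |S v|^2 <= s |v|^2 are added; this gives the denominator N^2 + 1, which
   cannot vanish, and a factor strictly below 1. *)
have bnd v : rnorm (S v) ^+ 2 <= s * N ^+ 2 / (N ^+ 2 + 1) * rnorm v ^+ 2.
  have k2 : rnorm v ^+ 2 <= N ^+ 2 * rnorm (v - (s^-1)%:C *: Sa (S v)) ^+ 2.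
    by rewrite -exprMn ler_pXn2r// ?nnegrE ?mulr_ge0 ?rnorm_ge0.
  have E : rnorm (v - (s^-1)%:C *: Sa (S v)) ^+ 2 =
     rnorm v ^+ 2 - 2 * s^-1 * rnorm (S v) ^+ 2 + s^-1 ^+ 2 * rnorm (Sa (S v)) ^+ 2.
    rewrite -!rdotxx !rdotDl !rdotDr !rdotNl !rdotNr !rdotZl !rdotZr.
    have -> : rdot (Sa (S v)) v = rdot (S v) (S v) by rewrite /rdot bop_adjP'.
    have -> : rdot v (Sa (S v)) = rdot (S v) (S v) by rewrite /rdot bop_adjP.
    by ring.
  have Sv : rnorm (S v) ^+ 2 <= s * rnorm v ^+ 2.
    rewrite /s -exprMn ler_pXn2r// ?nnegrE ?mulr_ge0 ?rnorm_ge0//.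
    exact: (le_opnorm S v).
  have San' := San (S v).
  have Q0 : 0 < N ^+ 2 + 1 by rewrite ltr_wpDl ?sqr_ge0.
  (* The quadratic term in 1 / s absorbs half of the linear one, since |S^* S v|^2 <= s |S v|^2. *)
  have E' : rnorm (v - (s^-1)%:C *: Sa (S v)) ^+ 2 <= rnorm v ^+ 2 - s^-1 * rnorm (S v) ^+ 2.
    rewrite E; have : s^-1 ^+ 2 * rnorm (Sa (S v)) ^+ 2 <= s^-1 * rnorm (S v) ^+ 2.
      rewrite expr2 -mulrA ler_pM2l ?invr_gt0//.
      by rewrite ler_pdivrMl.
    lra.
  have k3 : rnorm v ^+ 2 <= N ^+ 2 * (rnorm v ^+ 2 - s^-1 * rnorm (S v) ^+ 2).
    by apply: le_trans k2 _; rewrite ler_wpM2l ?sqr_ge0.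
  have Sv' : s^-1 * rnorm (S v) ^+ 2 <= rnorm v ^+ 2 by rewrite ler_pdivrMl.
  rewrite mulrAC ler_pdivlMr// -(ler_pM2l (_ : 0 < s^-1)) ?invr_gt0//.
  rewrite -[s * _ * _]mulrA mulKf ?gt_eqF//.
  by rewrite mulrA; move: k3 Sv'; lra.
have : rnorm S ^+ 2 <= s * N ^+ 2 / (N ^+ 2 + 1).
  have c0 : 0 <= s * N ^+ 2 / (N ^+ 2 + 1).
    apply: divr_ge0; first by apply: mulr_ge0; [exact: ltW|exact: sqr_ge0].
    by apply: addr_ge0; rewrite ?sqr_ge0 ?ler01.
  rewrite -[leRHS]sqr_sqrtr// ler_pXn2r// ?nnegrE ?rnorm_ge0 ?sqrtr_ge0//.
  apply: (@opnorm_leM _ _ S); first exact: sqrtr_ge0.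
  move=> v; rewrite -(@ler_pXn2r _ 2)// ?nnegrE ?mulr_ge0 ?sqrtr_ge0 ?rnorm_ge0//.
  by rewrite exprMn sqr_sqrtr.
rewrite -/s -mulrA ler_pMr// ler_pdivlMr ?ltr_wpDl ?sqr_ge0// mul1r.
lra.
Qed.

End Contractivity.

(** * Faithfulness of representations with bounded coefficients *)

Section TorusFaithful.
Context {R : realType}.
Variables (d : nat) (Theta : 'M[R]_d).
Hypothesis aT : antisymmetric_mx Theta.

Lemma star_hom_lin (A B : cstarAlgType R) (psi : A -> B) : star_hom psi -> linear psi.
Proof. by move=> h a x y; rewrite (shom_lin h). Qed.

Lemma star_homB (A B : cstarAlgType R) (psi : A -> B) x y : star_hom psi ->
  psi (x - y) = psi x - psi y.
Proof.
by move=> /star_hom_lin pl; rewrite -scaleN1r addrC pl scaleN1r addrC.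
Qed.

Section Polynomials.
Variables (B : cstarAlgType R) (v : 'I_d -> B).

Lemma poly_ev_cat (p q : poly_t d) : poly_ev v (p ++ q) = poly_ev v p + poly_ev v q.
Proof. by rewrite /poly_ev big_cat. Qed.

Lemma poly_evZ (a : R[i]) (p : poly_t d) :
  poly_ev v [seq (a * q.1, q.2) | q <- p] = a *: poly_ev v p.
Proof.
rewrite /poly_ev big_map scaler_sumr; apply: eq_bigr => q _ /=.
by rewrite scalerA.
Qed.

Lemma poly_ev_one : poly_ev v [:: (1, [::])] = cone.
Proof. by rewrite /poly_ev big_seq1 /= scale1r. Qed.

Lemma poly_ev_gen k : poly_ev v [:: (1, [:: (k, true)])] = v k.
Proof. by rewrite /poly_ev big_seq1 /= scale1r cmul1r. Qed.

Lemma poly_ev_hom (C : cstarAlgType R) (psi : B -> C) p :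
  star_hom psi -> psi (poly_ev v p) = poly_ev (fun k => psi (v k)) p.
Proof.
move=> h; have psi0 : psi 0 = 0 by rewrite -(subrr (0 : B)) star_homB// subrr.
have psiw w : psi (word_ev v w) = word_ev (fun k => psi (v k)) w.
  elim: w => [|[k b] w IH] /=; first exact: (shom_one h).
  rewrite (shom_mul h)// IH; congr (cmul _ _); rewrite /letter_ev /=.
  by case: b => //; rewrite (shom_star h).
rewrite /poly_ev; elim: p => [|q p IH]; first by rewrite !big_nil.
by rewrite !big_cons (shom_lin h)// IH psiw.
Qed.

Lemma poly_dense : closed_star_subalg (adherent (range (poly_ev v))).
Proof.
split.
- apply/closedP_adherent => x xD e e0; have e2 : 0 < e / 2 by rewrite divr_gt0.
  have [y yD xy] := xD _ e2; have [z zr yz] := yD _ e2; exists z => //.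
  by apply: le_lt_trans (rnorm_dist_trans y _ _) _; rewrite [ltRHS](splitr e) ltrD.
- move=> e e0; exists cone; last by rewrite subrr rnorm0.
  by exists [:: (1, [::])] => //; exact: poly_ev_one.
- move=> a x y xD yD e e0; have [M M0 aM] := normc_real a.
  have M1 : 0 < M + 1 by rewrite ltr_wpDl.
  have d1 : 0 < e / (M + 1) / 2 by rewrite !divr_gt0.
  have d2 : 0 < e / 2 by rewrite divr_gt0.
  have [_ [p _ <-] xp] := xD _ d1; have [_ [q _ <-] yq] := yD _ d2.
  exists (a *: poly_ev v p + poly_ev v q).
    by exists ([seq (a * r.1, r.2) | r <- p] ++ q) => //; rewrite poly_ev_cat poly_evZ.
  exact: rnorm_dist_scaleD M0 aM e0 xp yq.
- move=> x y xD yD e e0.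
  pose M := rnorm x + rnorm y + 1.
  have M0 : 0 < M by rewrite ltr_wpDl// addr_ge0 ?rnorm_ge0.
  (* The bound 1 keeps |P| <= |x| + 1; the two error terms then add up to at most M e / (2 M) = e /
     2. *)
  have d1 : 0 < Num.min 1 (e / (2 * M)) by rewrite lt_min ltr01 divr_gt0 ?mulr_gt0.
  have [_ [p _ <-] ] := xD _ d1; rewrite lt_min => /andP[xp1 xp].
  have [_ [q _ <-] ] := yD _ d1; rewrite lt_min => /andP[_ yq].
  exists (cmul (poly_ev v p) (poly_ev v q)).
    by exists (poly_mul p q) => //; exact: poly_ev_mul.
  set P := poly_ev v p in xp xp1 *; set Q := poly_ev v q in yq *.
  have -> : cmul x y - cmul P Q = cmul (x - P) y + cmul P (y - Q).
    rewrite cmulDl cmulDr -[- P]scaleN1r -[- Q]scaleN1r cmulZl cmulZr !scaleN1r.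
    by rewrite addrA subrK.
  have Pn : rnorm P <= rnorm x + 1.
    rewrite -[P](subrK x); apply: le_trans (rnormD _ _) _.
    by rewrite addrC lerD2l rnorm_distC ltW.
  apply: le_lt_trans (rnormD _ _) _.
  have h1 : rnorm (cmul (x - P) y) <= e / (2 * M) * rnorm y.
    by apply: le_trans (rnorm_cmul _ _) _; rewrite ler_wpM2r ?rnorm_ge0// ltW.
  have h2 : rnorm (cmul P (y - Q)) <= (rnorm x + 1) * (e / (2 * M)).
    by apply: le_trans (rnorm_cmul _ _) _; rewrite ler_pM ?rnorm_ge0// ltW.
  apply: le_lt_trans (lerD h1 h2) _.
  rewrite mulrC -mulrDl addrA (addrC (rnorm y)) -/M invfM [e * _]mulrA mulrCA mulfV ?gt_eqF//.
  by rewrite mulr1 ltr_pdivrMr// mulrDr mulr1 ltrDl.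
- move=> x xD e e0; have [_ [p _ <-] xp] := xD _ e0; exists (star (poly_ev v p)).
    by exists (poly_star p) => //; exact: poly_ev_star.
  have -> : star x - star (poly_ev v p) = star (x - poly_ev v p).
    by rewrite starD -[- poly_ev v p]scaleN1r starZ rmorphN1 scaleN1r.
  by rewrite rnorm_star.
Qed.

End Polynomials.

(** Universality gives [psi] from [A] to B(H). It is isometric on the dense *-polynomials, hence
    everywhere, so its range is closed and equals C*(U). *)
Lemma torus_sim (A : cstarAlgType R) (u : 'I_d -> A) (H : hilbertType R)
    (U : 'I_d -> bop H) :
  nc_torus Theta u -> torus_rel Theta U ->
  (forall p g, `|poly_coef Theta p g| <= `|poly_ev U p|) -> sim U u.
Proof.
move=> nu UT UC; have [psi [hpsi psiu]] := nc_torus_univ nu UT.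
have psip p : psi (poly_ev u p) = poly_ev U p.
  by rewrite poly_ev_hom//; congr (poly_ev _ p); apply/funext.
have dense a : adherent (range (poly_ev u)) a.
  have : cstar_gen u a by rewrite (nc_torus_gen nu).
  apply; split; first exact: poly_dense.
  move=> k e e0; exists (u k); last by rewrite subrr rnorm0.
  by exists [:: (1, [:: (k, true)])] => //; exact: poly_ev_gen.
have psin a : rnorm (psi a) = rnorm a.
  apply/eqP; rewrite eq_le star_hom_contractive//=.
  apply/ler_addgt0Pr => e e0; have e2 : 0 < e / 2 by rewrite divr_gt0.
  have [_ [p _ <-] ap] := dense a _ e2.
  have h1 : rnorm a <= rnorm (a - poly_ev u p) + rnorm (poly_ev u p).
    by rewrite -{1}[a](subrK (poly_ev u p)) rnormD.
  have h2 := rnorm_poly_le aT (nc_torus_rel nu) UC p.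
  have h3 : rnorm (poly_ev U p) <= rnorm (psi a) + rnorm (a - poly_ev u p).
    rewrite -psip; have -> : psi (poly_ev u p) = psi a - psi (a - poly_ev u p).
      by rewrite -star_homB// subKr.
    apply: le_trans (rnormD _ _) _; rewrite rnormN lerD2l.
    exact: star_hom_contractive.
  lra.
have psiI : injective psi.
  move=> a b ab; apply/eqP; rewrite -subr_eq0; apply/eqP/rnorm0_eq0.
  by rewrite -psin star_homB// ab subrr rnorm0.
have genU : cstar_gen U = range psi.
  apply/seteqP; split=> [b bU|_ [a _ <-] S [SS SU]].
    apply: bU; split; last by move=> k; exists (u k) => //; exact: psiu.
    split.
    - by apply: isometry_range_closed psin => x y; exact: star_homB.
    - by exists cone => //; exact: (shom_one hpsi).
    - by move=> c _ _ [x _ <-] [y _ <-]; exists (c *: x + y) => //; rewrite (shom_lin hpsi).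
    - by move=> _ _ [x _ <-] [y _ <-]; exists (cmul x y) => //; rewrite (shom_mul hpsi).
    - by move=> _ [x _ <-]; exists (star x) => //; rewrite (shom_star hpsi).
  have : cstar_gen u a by rewrite (nc_torus_gen nu).
  move=> /(_ [set x | S (psi x)]); apply; split; last by move=> k /=; rewrite psiu.
  have := closedP_adherent S => -[/(_ (csubalg_closed SS)) Sad _].
  split.
  - apply/closedP_adherent => x xS; apply: Sad => e e0; have [y yS xy] := xS _ e0.
    exists (psi y) => //; rewrite -star_homB//.
    by rewrite psin.
  - by rewrite /= (shom_one hpsi); exact: csubalg_one.
  - by move=> c x y xS yS; rewrite /= (shom_lin hpsi)//; exact: csubalg_lin.
  - by move=> x y xS yS; rewrite /= (shom_mul hpsi)//; exact: csubalg_mul.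
  - by move=> x xS; rewrite /= (shom_star hpsi)//; exact: csubalg_star.
(* [sim U u] asks for the map in the opposite direction, which is the inverse of [psi] on its range;
   the default [cone] is taken only off that range. *)
pose phi b := xget (cone : A) [set a | psi a = b].
have phiK a : phi (psi a) = a.
  by apply: psiI; exact: (xgetPex cone (ex_intro [set x | psi x = psi a] a erefl)).
exists phi; rewrite genU (nc_torus_gen nu); split.
- split.
  + by move=> c _ _ [x _ <-] [y _ <-]; rewrite -(shom_lin hpsi)// !phiK.
  + by move=> _ _ [x _ <-] [y _ <-]; rewrite -(shom_mul hpsi)// !phiK.
  + by move=> _ [x _ <-]; rewrite -(shom_star hpsi)// !phiK.
  + by rewrite -(shom_one hpsi) phiK.
- split=> //.
  + by move=> _ _ /set_mem[x _ <-] /set_mem[y _ <-]; rewrite !phiK => ->.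
  + by move=> a _; exists (psi a) => //; exact: phiK.
- by move=> k; rewrite -psiu phiK.
Qed.

End TorusFaithful.
(** * The dilation of the regular representation *)

Section ShiftRepresentation.
Context {R : realType}.
Variables (d : nat) (Theta : 'M[R]_d).
Hypothesis aT : antisymmetric_mx Theta.
Local Notation X := 'rV[int]_d.
Variables (Z : eqType) (pr : Z -> X) (tr : X -> Z -> Z) (z0 : Z).
Hypotheses (tr0 : forall z, tr 0 z = z) (trD : forall g h z, tr (g + h) z = tr g (tr h z))
  (pr_tr : forall g z, pr (tr g z) = pr z + g) (pr0 : pr z0 = 0).

Lemma tr_cancel g : cancel (tr g) (tr (- g)).
Proof. by move=> z; rewrite -trD addNr tr0. Qed.

(** [Z] is any set with an action of Z^d and an equivariant map [pr] to Z^d, so that Z^d and its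
    product with [Y] are treated together. The adjoint is included because words contain adjoint
    letters. *)
Definition is_shift (k : 'I_d) (T : bop (@l2 R Z)) : Prop :=
  [/\ unitary T,
    forall f z, T f z = phase Theta (unitv k) (pr z) * f (tr (- unitv k) z) &
    forall f z, star T f z = phase Theta (- unitv k) (pr z) * f (tr (unitv k) z)].

Lemma shift_tuple_ex : exists U, forall k, is_shift k (U k).
Proof.
suff sh k : exists T, is_shift k T by have [U UP] := choice sh; exists U.
have sgK := tr_cancel (unitv k).
have tauK : cancel (tr (- unitv k)) (tr (unitv k)).
  by have := tr_cancel (- unitv k); rewrite opprK.
have [T [uT TE TsE]] := @monomial_unitary R Z _ _ (fun z => phase Theta (unitv k) (pr z))
  sgK tauK (fun z => norm_phase _ _ _).
exists T; split=> // f z; rewrite TsE phase_conj//.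
(* The phase is taken at the translated point; the extra factor phase e_k e_k is 1. *)
by rewrite phaseNl// pr_tr phaseDl phasexx// mulr1.
Qed.

Variable U : 'I_d -> bop (@l2 R Z).
Hypothesis US : forall k, is_shift k (U k).

Lemma shift_torus : torus_rel Theta U.
Proof.
split=> [k|k l]; first by have [] := US k.
apply: bopP => f; apply: l2_ext => z.
have [_ Uk _] := US k; have [_ Ul _] := US l.
rewrite bopZE l2ZE /cmul /= Ul Uk Uk Ul !pr_tr !phaseDr !phaseNr//.
rewrite -!trD addrC.
have -> : cexp ('i * (Theta k l)%:C) = phase Theta (unitv l) (unitv k) ^+ 2.
  rewrite /phase expr2 -cexpD twist_unitv -mulrDr -rmorphD.
  by congr (cexp (_ * _%:C)); field.
have := phaseC aT (unitv l) (unitv k).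
move: (f _) (phase _ (unitv l) (unitv k)) (phase _ (unitv k) (unitv l)) => F p q pq.
rewrite -[in LHS](mulr1 (phase _ _ _ * _)) -pq; ring.
Qed.

Lemma shift_word w f z : word_ev U w f z =
  word_phase Theta w * phase Theta (word_deg w) (pr z) * f (tr (- word_deg w) z).
Proof.
elim: w z => [|a w IH] z.
  by rewrite /= /word_deg big_nil oppr0 tr0 phase0l !mul1r.
have lE g y : letter_ev U a g y = phase Theta (letter_deg a) (pr y) * g (tr (- letter_deg a) y).
  case: a => k []; rewrite /letter_ev /letter_deg /= ?opprK; by have [_ h1 h2] := US k.
rewrite word_deg_cons /= /cmul /= lE IH pr_tr !phaseDr phaseDl phaseNr// opprD addrC trD.
by ring.
Qed.

(** The coefficient is the matrix entry between the basis vector at [z0] and that at its translate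
    by [g]; words of another degree move [z0] to a different point, as [pr] shows. *)
Lemma shift_coef p g : `|poly_coef Theta p g| <= `|poly_ev U p|.
Proof.
have E : dot (poly_ev U p (l2_delta z0)) (l2_delta (tr g z0)) = poly_coef Theta p g.
  have -> : poly_ev U p (l2_delta z0) = \sum_(q <- p) q.1 *: word_ev U q.2 (l2_delta z0).
    rewrite /poly_ev; elim: (p) => [|q r IH]; first by rewrite !big_nil.
    by rewrite !big_cons bopDE bopZE IH.
  rewrite dot_suml /poly_coef [RHS]big_mkcond; apply: eq_bigr => q _.
  rewrite dotZl dot_delta shift_word pr_tr pr0 add0r /= -trD.
  have -> : (tr (- word_deg q.2 + g) z0 == z0) = (word_deg q.2 == g).
    apply/eqP/eqP => [/(congr1 pr)|<-]; last by rewrite addNr tr0.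
    by rewrite pr_tr pr0 add0r addrC => /eqP; rewrite subr_eq0 => /eqP.
  by case: eqP => [->|_]; rewrite ?mulr0// phasexx// !mulr1.
have d1 z : rnorm (l2_delta z : @l2 R Z) = 1.
  apply/eqP; rewrite -(@eqrXn2 _ 2)// ?rnorm_ge0// expr1n -rdotxx /rdot dot_delta /=.
  by rewrite eqxx.
rewrite -E; apply: le_trans (dot_cauchy _ _) _; rewrite d1 mulr1 -rnormE lecR.
by apply: le_trans (le_opnorm _ _) _; rewrite d1 mulr1.
Qed.

End ShiftRepresentation.

(** * Coherent vectors in an explicit Fock space *)

Section CoherentVectors.
Context {R : realType}.
Variable d : nat.

Definition tensor_index (k : nat) : finType := {ffun 'I_k -> 'I_d}.
Definition fock_index : eqType := {k : nat & tensor_index k}.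

Definition fock_index_upto (n : nat) : seq fock_index :=
  [seq Tagged tensor_index f | k <- iota 0 n, f <- enum (tensor_index k)].

Lemma fock_index_upto_uniq n : uniq (fock_index_upto n).
Proof.
apply: allpairs_uniq_dep; first exact: iota_uniq.
- by move=> k _; exact: enum_uniq.
- by move=> [k f] [l g] _ _ /=.
Qed.

Lemma mem_fock_index_upto n (y : fock_index) : (tag y < n)%N -> y \in fock_index_upto n.
Proof.
move=> yn; case: y yn => k f /= kn; apply/allpairsPdep; exists k, f; split=> //.
  by rewrite mem_iota.
by rewrite mem_enum.
Qed.

Lemma sum_fock_index_upto (V : nmodType) n (F : fock_index -> V) :
  \sum_(y <- fock_index_upto n) F y =
  \sum_(k < n) \sum_(f : tensor_index k) F (Tagged tensor_index f).
Proof.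
rewrite /fock_index_upto big_allpairs_dep -(big_mkord xpredT (fun k => \sum_(f : tensor_index k) F (Tagged tensor_index f))).
rewrite /index_iota subn0; apply: eq_bigr => k _.
by rewrite big_enum.
Qed.

(** Coordinates of the exponential vector of [v] in the full Fock space of C^d, indexed by a degree
    [k] and a basis tensor. The model is explicit because the inequality presupposes no
    [fockSpace]. *)
Definition coherent_fun (v : 'I_d -> R[i]) (y : fock_index) : R[i] :=
  ((Num.sqrt (tag y)`!%:R)^-1)%:C * \prod_(i < tag y) v (tagged y i).

(** Expanding the k-th power of the inner product over all maps ['I_k -> 'I_d] reproduces the
    coordinates of degree k. *)
Lemma coherent_mul (v w : 'I_d -> R[i]) n :
  \sum_(y <- fock_index_upto n) coherent_fun v y * Num.conj (coherent_fun w y) =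
  exp_sum n (\sum_j v j * Num.conj (w j)).
Proof.
rewrite sum_fock_index_upto; apply: eq_bigr => k _.
have -> : (\sum_j v j * Num.conj (w j)) ^+ k =
    \sum_(f : tensor_index k) \prod_i (v (f i) * Num.conj (w (f i))).
  rewrite -(bigA_distr_bigA (fun (_ : 'I_k) j => v j * Num.conj (w j))).
  by rewrite prodr_const card_ord.
rewrite mulr_suml; apply: eq_bigr => f _; rewrite /coherent_fun /=.
rewrite rmorphM /= conj_real mulrACA -rmorphM -invfM -expr2 sqr_sqrtr// mulrC.
rewrite fmorphV rmorph_nat rmorph_prod -big_split.
by [].
Qed.

Lemma coherent_subproof (v : 'I_d -> R[i]) : (coherent_fun v : fock_index -> R[i]^o) \in @l2_pred R fock_index.
Proof.
rewrite inE; exists (expR (\sum_j nsq (v j))) => s us.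
have [n sn] : exists n, {subset s <= fock_index_upto n}.
  exists (\max_(y <- s) (tag y).+1)%N => y ys; apply: mem_fock_index_upto.
  by rewrite (big_rem y)//= leq_maxl.
apply: (@le_trans _ _ (\sum_(y <- fock_index_upto n) nsq (coherent_fun v y))).
  apply: le_trans (sum_catl_undup (fock_index_upto n) (fun y => nsq_ge0 _) us) _.
  apply: sum_perm_le; apply: uniq_perm; rewrite ?undup_uniq ?fock_index_upto_uniq//.
  move=> y; rewrite mem_undup mem_cat; apply/orP/idP => [[/sn|]//|]; last by right.
have n0 : 0 <= \sum_j nsq (v j) by apply: sumr_ge0 => j _; exact: nsq_ge0.
apply: le_trans (exp_sum_le_expR n n0); rewrite -lecR -exp_sum_real rmorph_sum.
have -> : (\sum_j nsq (v j))%:C = \sum_j v j * Num.conj (v j) :> R[i].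
  by rewrite rmorph_sum; apply: eq_bigr => j _; rewrite nsq_mul_conj.
rewrite -coherent_mul le_eqVlt; apply/orP; left; apply/eqP.
by apply: eq_bigr => y _; rewrite nsq_mul_conj.
Qed.

Definition coherent (v : 'I_d -> R[i]) : @l2 R fock_index := L2 (coherent_subproof v).

Lemma dot_coherent (v w : 'I_d -> R[i]) :
  dot (coherent v) (coherent w) = cexp (\sum_j v j * Num.conj (w j)).
Proof.
apply/eqP; rewrite -subr_eq0; apply/eqP; apply: (@complex_small _ _ 2) => // e e0.
have S := casummable_dot (l2P (coherent v)) (l2P (coherent w)).
have [|y|N1 h1] := csum_lim (s := fock_index_upto) S _ _ e0.
- exact: fock_index_upto_uniq.
- by exists (tag y).+1 => n yn; exact: mem_fock_index_upto.
have [N2 h2] := exp_sum_cvg (\sum_j v j * Num.conj (w j)) e0.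
have {}h1 := h1 (maxn N1 N2) (leq_maxl _ _).
have {}h2 := h2 (maxn N1 N2) (leq_maxr _ _).
rewrite -coherent_mul in h2; rewrite l2_dotE.
set s := \sum_(_ <- _) _ in h1 h2; set a := csum _ in h1 *; set b := cexp _ in h2 *.
have -> : a - b = - (s - a) + (s - b) by ring.
apply: le_trans (ler_normD _ _) _; rewrite normrN mulr_natr mulr2n rmorphD.
by rewrite lerD.
Qed.

End CoherentVectors.

(** * The dilation from Theta to Theta' by coherent vectors *)

Section TorusDilation.
Context {R : realType}.
Variables (d : nat) (Theta Theta' : 'M[R]_d).
Hypotheses (aT : antisymmetric_mx Theta) (aT' : antisymmetric_mx Theta').
Local Notation X := 'rV[int]_d.
Local Notation t := (mxopnorm (Theta' - Theta)).
Variable y : 'I_d -> 'I_d -> R[i].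
Hypothesis yG : forall l k,
  \sum_i y l i * Num.conj (y k i) = gram_entry t (Theta' - Theta) l k.

Lemma antisymmetric_mxB : antisymmetric_mx (Theta' - Theta).
Proof. by rewrite /antisymmetric_mx linearB /= aT aT' opprB opprK addrC. Qed.

Definition lattice_vec (g : X) (j : 'I_d) : R[i] := \sum_i (g 0 i)%:~R * y i j.

Definition lattice_dot (g h : X) : R[i] :=
  \sum_j lattice_vec g j * Num.conj (lattice_vec h j).

Lemma lattice_vecD g h j : lattice_vec (g + h) j = lattice_vec g j + lattice_vec h j.
Proof.
rewrite /lattice_vec -big_split; apply: eq_bigr => i _.
by rewrite mxE intrD mulrDl.
Qed.

Lemma lattice_dotDl g g' h : lattice_dot (g + g') h = lattice_dot g h + lattice_dot g' h.
Proof.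
rewrite /lattice_dot -big_split; apply: eq_bigr => j _.
by rewrite lattice_vecD mulrDl.
Qed.

Lemma lattice_dotC g h : lattice_dot h g = Num.conj (lattice_dot g h).
Proof.
rewrite /lattice_dot rmorph_sum; apply: eq_bigr => j _.
by rewrite rmorphM /= conjCK mulrC.
Qed.

Lemma lattice_dotDr g h h' : lattice_dot g (h + h') = lattice_dot g h + lattice_dot g h'.
Proof. by rewrite lattice_dotC lattice_dotDl rmorphD /= -!lattice_dotC. Qed.

Lemma lattice_dotE g h : lattice_dot g h =
  \sum_i \sum_k (g 0 i)%:~R * (h 0 k)%:~R * gram_entry t (Theta' - Theta) i k.
Proof.
transitivity (\sum_j \sum_i \sum_k ((g 0 i)%:~R * (h 0 k)%:~R) * (y i j * Num.conj (y k j))).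
  apply: eq_bigr => j _; rewrite /lattice_vec mulr_suml; apply: eq_bigr => i _.
  rewrite rmorph_sum mulr_sumr; apply: eq_bigr => k _.
  by rewrite rmorphM /= rmorph_int mulrACA.
rewrite exchange_big; apply: eq_bigr => i _; rewrite exchange_big; apply: eq_bigr => k _.
by rewrite -mulr_sumr yG.
Qed.

(** This imaginary part is the exponent in the phase for Theta' - Theta, which is why these vectors
    can correct one phase into the other. *)
Lemma lattice_dot_im g h : complex.Im (lattice_dot g h) = twist (Theta' - Theta) g h / 2.
Proof.
rewrite lattice_dotE raddf_sum /twist exchange_big mulr_suml; apply: eq_bigr => i _.
rewrite raddf_sum mulr_suml; apply: eq_bigr => k _ /=.
have intC (n : int) : n%:~R = (n%:~R : R)%:C :> R[i] by rewrite rmorph_int.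
rewrite !intC -rmorphM /gram_entry; simpc => /=.
ring.
Qed.

Lemma lattice_dot_unitv k : lattice_dot (unitv k) (unitv k) = (t / 2)%:C.
Proof.
rewrite -(gram_entry_diag t k antisymmetric_mxB) -yG.
have uv j : lattice_vec (unitv k) j = y k j.
  rewrite /lattice_vec (bigD1 k)//= mxE !eqxx mul1r big1 ?addr0// => i ik.
  by rewrite mxE (negPf ik) andbF mul0r.
by apply: eq_bigr => j _; rewrite uv.
Qed.

Definition coherent_unit (g : X) : l2 (fock_index d) :=
  cexp (- (lattice_dot g g / 2)) *: coherent (lattice_vec g).

Lemma lattice_dot_self_real g : Num.conj (lattice_dot g g) = lattice_dot g g.
Proof. by rewrite -lattice_dotC. Qed.

Lemma dot_coherent_unit g h : dot (coherent_unit g) (coherent_unit h) =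
  cexp (lattice_dot g h - lattice_dot g g / 2 - lattice_dot h h / 2).
Proof.
rewrite dotZl dotZr dot_coherent conj_cexp -!cexpD; congr cexp.
rewrite rmorphN rmorphM /= lattice_dot_self_real fmorphV rmorph_nat -/(lattice_dot g h).
by ring.
Qed.

Lemma coherent_unit1 g : dot (coherent_unit g) (coherent_unit g) = 1.
Proof.
rewrite dot_coherent_unit (_ : _ - _ = 0) ?cexp0//.
by field.
Qed.

(* The angle between neighbouring coherent vectors absorbs the difference of the
   two phases, and its modulus is the inverse of the dilation constant. *)
Lemma coherent_unit_shift k (h : X) :
  phase Theta' (unitv k) h * dot (coherent_unit (h - unitv k)) (coherent_unit h) =
  (expR (- (4^-1 * t)))%:C * phase Theta (unitv k) h.
Proof.
set e := unitv k; rewrite dot_coherent_unit /phase -cexpR -!cexpD; congr cexp.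
(* With b = <e, h>, the exponent of the overlap collapses to (conj b - b) / 2 - t / 4: the terms in
   <h, h> and the real part of b cancel. *)
have NE g : lattice_dot (h - e) g = lattice_dot h g - lattice_dot e g.
  have := lattice_dotDl (h - e) e g; rewrite subrK => ->; ring.
have NE' g : lattice_dot g (h - e) = lattice_dot g h - lattice_dot g e.
  have := lattice_dotDr g (h - e) e; rewrite subrK => ->; ring.
rewrite !NE !NE' lattice_dot_unitv (lattice_dotC e h).
have im : lattice_dot e h - Num.conj (lattice_dot e h) =
    'i * (twist (Theta' - Theta) e h)%:C.
  have := lattice_dot_im e h; case: (lattice_dot e h) => a b /= ->.
  by rewrite conjE; apply/eqP; rewrite eq_complex /=; apply/andP; split; apply/eqP; field.
have tw : twist Theta' e h = twist Theta e h + twist (Theta' - Theta) e h.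
  rewrite /twist -big_split; apply: eq_bigr => j _; rewrite -big_split.
  by apply: eq_bigr => i _; rewrite !mxE /=; ring.
rewrite tw.
have -> : 'i * ((twist Theta e h + twist (Theta' - Theta) e h) / 2)%:C =
    'i * (twist Theta e h / 2)%:C + ('i * (twist (Theta' - Theta) e h)%:C) / 2.
  by rewrite mulrDl rmorphD mulrDr -mulrA; congr (_ + 'i * _); rewrite rmorphM fmorphV rmorph_nat.
rewrite -im.
have -> : (- (4^-1 * t))%:C = - ((t / 2)%:C / 2) :> R[i].
  have -> : 4^-1 * t = t / 2 / 2 by field.
  by rewrite rmorphN [X in - X]rmorphM fmorphV rmorph_nat.
move: (lattice_dot h h) (lattice_dot e h) (Num.conj _) => a b c.
by field.
Qed.

Lemma torus_prec (A A' : cstarAlgType R) (u : 'I_d -> A) (u' : 'I_d -> A') :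
  nc_torus Theta u -> nc_torus Theta' u' -> prec u (expR (4^-1 * t)) u'.
Proof.
move=> nu nu'; pose Y := fock_index d.
(* A base point for [shift_coef] on the product; degree 0 has an index even when d = 0. *)
have [y0 _] : exists y0 : Y, True.
  have : (0 < #|tensor_index d 0|)%N by rewrite card_ffun !card_ord expn0.
  by move=> /card_gt0P[f _]; exists (Tagged (tensor_index d) f).
pose pr1 (h : X) := h; pose tr1 (g h : X) := h + g.
pose pr2 (z : X * Y) := z.1; pose tr2 (g : X) (z : X * Y) := (z.1 + g, z.2).
have tr10 h : tr1 0 h = h by exact: addr0.
have tr1D g g' h : tr1 (g + g') h = tr1 g (tr1 g' h) by rewrite /tr1 [g + _]addrC addrA.
have tr20 z : tr2 0 z = z by case: z => h b; rewrite /tr2 addr0.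
have tr2D g g' z : tr2 (g + g') z = tr2 g (tr2 g' z).
  by rewrite /tr2 /= [g + _]addrC addrA.
have p1 g h : pr1 (tr1 g h) = pr1 h + g by [].
have p2 g z : pr2 (tr2 g z) = pr2 z + g by [].
have [U US] := shift_tuple_ex aT tr10 tr1D p1.
have [V VS] := shift_tuple_ex aT' tr20 tr2D p2.
pose iota := amplify coherent_unit1.
have ii : isometric iota by exact: amplify_isometric.
exists (@l2 R X), (@l2 R (X * Y)%type), iota, U, V; split=> //.
- apply: (torus_sim aT nu); first exact: (shift_torus aT tr1D p1 US).
  by move=> p g; apply: (shift_coef (z0 := 0) aT tr10 tr1D p1 _ US).
- apply: (torus_sim aT' nu'); first exact: (shift_torus aT' tr2D p2 VS).
  by move=> p g; apply: (shift_coef (z0 := (0, y0)) aT' tr20 tr2D p2 _ VS).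
move=> k f; apply/esym/orthproj_range => // g.
apply: dot_l2_prod => h.
have [_ Uk _] := US k; have [_ Vk _] := VS k.
rewrite Uk /pr1 /tr1.
set c := expR _.
(* On the fibre over [h], the shifted vector carries the coherent vector of h - e_k and the test
   vector that of [h], so the fibre sum is their overlap. *)
transitivity (csum (fun b => (c%:C * phase Theta' (unitv k) h * f (h - unitv k) * Num.conj (g h)) *
   (coherent_unit (h - unitv k) b * Num.conj (coherent_unit h b)))).
  congr csum; apply/funext => b; rewrite bopZE l2ZE Vk /pr2 /tr2 /= rmorphM /=.
  by ring.
rewrite csumZ; last by apply: casummable_dot; exact: l2P.
rewrite -l2_dotE.
have := coherent_unit_shift k h; rewrite expRN => E.
have c0 : c%:C != 0 :> R[i] by rewrite -[0]/(0%:C) (inj_eq (@complexI R)) gt_eqF ?expR_gt0.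
have -> : phase Theta (unitv k) h = c%:C * (phase Theta' (unitv k) h *
    dot (coherent_unit (h - unitv k)) (coherent_unit h)).
  by rewrite E mulrA -rmorphM mulfV ?rmorph1 ?mul1r// gt_eqF ?expR_gt0.
ring.
Qed.

End TorusDilation.

Theorem theorem5p4 (R : realType) (d : nat) :
  (forall Theta Theta' : 'M[R]_d,
    antisymmetric_mx Theta -> antisymmetric_mx Theta' ->
    (exists (H K : hilbertType R) (iota : H -> K) (z : 'I_d -> K)
       (x : 'I_d -> H), weyl_config Theta Theta' iota z x) /\
    (forall (H K : hilbertType R) (iota : H -> K) (z : 'I_d -> K)
       (x : 'I_d -> H), weyl_config Theta Theta' iota z x ->
     forall (GH : fockSpace H) (GK : fockSpace K),
     [/\ forall (A : cstarAlgType R) (u : 'I_d -> A), nc_torus Theta u ->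
           exists pi : A -> bop GH,
             star_hom pi /\ forall k, pi (u k) = weyl GH (x k),
         forall (A : cstarAlgType R) (u : 'I_d -> A), nc_torus Theta' u ->
           exists pi : A -> bop GK,
             star_hom pi /\ forall k, pi (u k) = weyl GK (z k)
       & exists J : GH -> GK, fock_inclusion iota J /\
           forall k, is_compression J (weyl GH (x k))
             ((expR (4^-1 * mxopnorm (Theta - Theta')))%:C *: weyl GK (z k))]))
  /\
  (forall Theta Theta' : 'M[R]_d,
    antisymmetric_mx Theta -> antisymmetric_mx Theta' ->
    forall (A A' : cstarAlgType R) (u : 'I_d -> A) (u' : 'I_d -> A'),
    nc_torus Theta u -> nc_torus Theta' u' ->
    (dil_const u u' <= (expR (4^-1 * mxopnorm (Theta - Theta')))%:E)%E).
Proof.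
split=> Theta Theta' aT aT'; last first.
  move=> A A' u u' nu nu'; apply: ereal_inf_lbound.
  have [y yG] := gram_factor (antisymmetric_mxB aT aT') (lexx (mxopnorm (Theta' - Theta))).
  exists (expR (4^-1 * mxopnorm (Theta - Theta'))) => //; split; first exact: expR_gt0.
  by rewrite mxopnormB; exact: torus_prec aT aT' _ yG _ _ _ _ nu nu'.
split; first exact: weyl_config_ex.
move=> H K iota z x wc GH GK; have ii := wc_iota wc; split.
- move=> A u nu; exact: (nc_torus_univ nu (weyl_torus GH (wc_x_im wc))).
- move=> A u nu; exact: (nc_torus_univ nu (weyl_torus GK (wc_z_im wc))).
have [J JP] := fock_inclusion_ex ii GH GK.
exists J; split=> // k.
have [h [zh zg]] := orthproj_range_ex (z k) ii.
have hx : iota h = iota (x k) by rewrite (wc_proj wc) zh.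
have zx g : dot (z k) (iota g) = dot (x k) g by rewrite zg -ii.2 hx ii.2.
(* By Pythagoras the difference of squared norms is |y_k|^2, which is half the operator norm; the
   halving in the Gaussian factor makes it a quarter. *)
have -> : 4^-1 * mxopnorm (Theta - Theta') = (rnorm (z k) ^+ 2 - rnorm (x k) ^+ 2) / 2.
  have := wc_y_norm wc k; rewrite (orthproj_compl_range ii (esym (wc_proj wc k))).
  rewrite -rnormE -rmorphXn => /complexI; rewrite -(rdotxx (z k - _)).
  rewrite rdotDl !rdotDr !rdotNl !rdotNr (rdotC (iota _) (z k)).
  rewrite /rdot zx ii.2 -/(rdot (x k) (x k)) -/(rdot (z k) (z k)) !rdotxx mxopnormB.
  lra.
exact: (weyl_compression ii JP zx).
Qed.
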